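(* Let $\mathcal{C}$ be an $\infty$-category, and let $p:\mathcal{M}^{\otimes}\to\mathcal{C}\times N(\mathsf{Fin}_{\ast})$ be a $\mathcal{C}$-family of $\infty$-operads. Let $K\to\mathcal{C}$ be a map of simplicial sets, let $n\geq1$, and let $f,g_{1},\dots,g_{n}:K\to\mathcal{M}_{\mathrm{act}}^{\otimes}$ be maps over $\mathcal{C}$. Assume the following: (1) For each $1\leq i\leq n$, there is an inert natural transformation $\alpha_{i}:f\to g_{i}$ over $\mathcal{C}$ (that is, a map $\alpha_i:K\times\Delta^{1}\to\mathcal{M}^{\otimes}$ over $\mathcal{C}$, restricting to $f$ on $K\times\{0\}$ and to $g_i$ on $K\times\{1\}$, all of whose components are inert morphisms of $\mathcal{M}^{\otimes}$). (2) For each vertex $v$ of $K$, the maps $\alpha_{i}$ give rise to a $p$-limit cone $\{f(v)\to g_{i}(v)\}_{1\leq i\leq n}$ lying over maps $\{\langle m(v)\rangle\to\langle m_{i}(v)\rangle\}_{1\leq i\leq n}$ of $N(\mathsf{Fin}_{\ast})$ that induce a bijection $\langle m(v)\rangle^{\circ}\cong\coprod_{i=1}^{n}\langle m_{i}(v)\rangle^{\circ}$. Then $f$ is naturally equivalent over $\mathcal{C}$ to the composite $$K\xrightarrow{(g_{i})_{i=1}^{n}}(\mathcal{M}_{\mathrm{act}}^{\otimes})^{n}\times_{\mathcal{C}^{n}}\mathcal{C}\xrightarrow{\bigoplus_{i=1}^{n}}\mathcal{M}_{\mathrm{act}}^{\otimes}.$$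
   Context: $\infty$-categories are quasi-categories. $\mathsf{Fin}_{\ast}$ is the category of pointed sets $\langle n\rangle=\{\ast,1,\dots,n\}$; $\langle n\rangle^{\circ}=\{1,\dots,n\}$. A map $\alpha:\langle m\rangle\to\langle n\rangle$ is inert if $\alpha^{-1}(i)$ is a singleton for every $1\le i\le n$ (so it induces an injection $\langle n\rangle^{\circ}\to\langle m\rangle^{\circ}$, $i\mapsto\alpha^{-1}(i)$), and active if $\alpha^{-1}(\ast)=\{\ast\}$. $\rho^{i}:\langle n\rangle\to\langle1\rangle$ is the inert map with $(\rho^{i})^{-1}(1)=\{i\}$. A $\mathcal{C}$-family of $\infty$-operads (Lurie, Higher Algebra 2.3.2.10) is a categorical fibration $p:\mathcal{M}^{\otimes}\to\mathcal{C}\times N(\mathsf{Fin}_{\ast})$ such that: (a) for each $M$ over $(C,\langle m\rangle)$ and inert $\alpha:\langle m\rangle\to\langle n\rangle$, $(\mathrm{id}_{C},\alpha)$ has a $p$-cocartesian lift with source $M$; (b) for $M$ over $(C,\langle m\rangle)$, $m\geq1$, any $p$-cocartesian lifts $M\to M_{i}$ of $(\mathrm{id}_{C},\rho^{i})$ form a $p$-limit cone, and every object over $\langle0\rangle$ is $p$-terminal; (c) for $n\geq1$, $C\in\mathcal{C}$ and objects $M_{1},\dots,M_{n}$ over $(C,\langle1\rangle)$, there is $M$ over $(C,\langle n\rangle)$ with $p$-cocartesian morphisms $M\to M_{i}$ over $(\mathrm{id}_{C},\rho^{i})$, and the fiber over each $(C,\langle0\rangle)$ is non-empty. A morphism of $\mathcal{M}^{\otimes}$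 is inert if it is $p$-cocartesian, its image in $\mathcal{C}$ is an equivalence and its image in $N(\mathsf{Fin}_{\ast})$ is inert. $\mathcal{M}_{\mathrm{act}}^{\otimes}\subset\mathcal{M}^{\otimes}$ is the subcategory of all objects and of the morphisms whose image in $N(\mathsf{Fin}_{\ast})$ is active. Fiberwise direct sum functor. Let $\mathrm{Env}(\mathcal{M})^{\otimes}=\mathcal{M}^{\otimes}\times_{\mathrm{Fun}(\{0\},N(\mathsf{Fin}_{\ast}))}\mathrm{Fun}^{\mathrm{act}}(\Delta^{1},N(\mathsf{Fin}_{\ast}))$ (with $\mathrm{Fun}^{\mathrm{act}}$ the full subcategory of $\mathrm{Fun}(\Delta^{1},N(\mathsf{Fin}_\ast))$ on active morphisms), mapping to $\mathcal{C}\times N(\mathsf{Fin}_{\ast})$ via $\mathcal{M}^{\otimes}\to\mathcal{C}$ and evaluation at $1\in\Delta^{1}$; it is again a $\mathcal{C}$-family of $\infty$-operads, and its fiber $\mathrm{Env}(\mathcal{M})^{\otimes}_{\langle1\rangle}$ over $\langle 1\rangle$ is identified with $\mathcal{M}_{\mathrm{act}}^{\otimes}$. The cocartesian pushforwards $\rho^{i}_{!}:\mathrm{Env}(\mathcal{M})^{\otimes}_{\langle n\rangle}\to\mathrm{Env}(\mathcal{M})^{\otimes}_{\langle1\rangle}=\mathcal{M}_{\mathrm{act}}^{\otimes}$ over $\mathcal{C}$ induce a categorical equivalence $\mathrm{Env}(\mathcal{M})_{\langle n\rangle}^{\otimes}\to(\mathcal{M}_{\mathrm{act}}^{\otimes})^{n}\times_{\mathcal{C}^{n}}\mathcal{C}$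 over $\mathcal{C}$. The functor $\bigoplus_{i=1}^{n}:(\mathcal{M}_{\mathrm{act}}^{\otimes})^{n}\times_{\mathcal{C}^{n}}\mathcal{C}\to\mathcal{M}_{\mathrm{act}}^{\otimes}$ is the composite of an inverse equivalence over $\mathcal{C}$ with the forgetful functor $\mathrm{Env}(\mathcal{M})^{\otimes}_{\langle n\rangle}\to\mathcal{M}_{\mathrm{act}}^{\otimes}$; it is a functor over $\mathcal{C}$, well defined up to natural equivalence over $\mathcal{C}$. *)

(* Defs.v *)
From mathcomp Require Import all_boot.
From mathcomp Require Import boolp.

Set Implicit Arguments.
Unset Strict Implicit.
Unset Printing Implicit Defensive.

(* Primitive projections make the category Delta, and hence the functoriality
   of most simplicial sets below, strict up to conversion. *)
Set Primitive Projections.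

(* A map [m] -> [n] of Delta, with [n] = 'I_n.+1. *)
Record mono (m n : nat) := Mono {
  mfun :> 'I_m.+1 -> 'I_n.+1;
  mfunP : forall i j : 'I_m.+1, i <= j -> mfun i <= mfun j }.

Definition mid n : mono n n := Mono (fun i j (h : i <= j) => h).

Definition mcomp l m n (b : mono m n) (a : mono l m) : mono l n :=
  Mono (fun i j h => mfunP b (mfunP a h)).

Definition mconst m n (i : 'I_n.+1) : mono m n :=
  Mono (mfun := fun _ => i) (fun _ _ _ => leqnn i).

Lemma mono_eq m n (a b : mono m n) : (forall i, a i = b i) -> a = b.
Proof.
case: a b => [a aP] [b bP] /= /funext e; case: _ / e bP => bP.
by congr Mono; apply: Prop_irrelevance.
Qed.

Lemma mcomp_const l m n (a : mono m n) (i : 'I_m.+1) :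
  mcomp a (mconst l i) = mconst l (a i).
Proof. by congr Mono; apply: Prop_irrelevance. Qed.

Definition edge_fun n (i j : 'I_n.+1) (t : 'I_2) : 'I_n.+1 :=
  if nat_of_ord t is 0 then i else j.

Lemma edge_funP n (i j : 'I_n.+1) (h : i <= j) (s t : 'I_2) :
  s <= t -> edge_fun i j s <= edge_fun i j t.
Proof. by case: s t => [[|s] ?] [[|t] ?]. Qed.

Definition medge n (i j : 'I_n.+1) (h : i <= j) : mono 1 n :=
  Mono (edge_funP h).

Lemma faceP n (i : 'I_n.+2) (s t : 'I_n.+1) : s <= t -> lift i s <= lift i t.
Proof. by move=> h; rewrite leq_bump2. Qed.

Definition mface n (i : 'I_n.+2) : mono n n.+1 := Mono (faceP i).

Record sset := SSet {
  cells :> nat -> Type;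
  restr : forall m n, mono m n -> cells n -> cells m;
  restr_id : forall n (x : cells n), restr (mid n) x = x;
  restr_comp : forall l m n (b : mono m n) (a : mono l m) (x : cells n),
    restr (mcomp b a) x = restr a (restr b x) }.

Record smap (X Y : sset) := SMap {
  app :> forall n, X n -> Y n;
  app_nat : forall m n (a : mono m n) (x : X n),
    app (restr a x) = restr a (app x) }.

Lemma smap_eq X Y (f g : smap X Y) : (forall n x, f n x = g n x) -> f = g.
Proof.
case: f g => [f fP] [g gP] /= e.
have {}e : f = g by apply: functional_extensionality_dep => n; apply/funext/e.
by move: gP; rewrite -e => gP; rewrite (Prop_irrelevance fP gP).
Qed.

Definition sid X : smap X X :=
  {| app := fun n x => x; app_nat := fun m n a x => erefl |}.

Definition scomp X Y Z (g : smap Y Z) (f : smap X Y) : smap X Z.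
Proof.
refine {| app := fun n x => g n (f n x) |}.
by move=> m n a x; rewrite !app_nat.
Defined.

Definition src (X : sset) (e : X 1) : X 0 := restr (mconst 0 ord0) e.
Definition tgt (X : sset) (e : X 1) : X 0 := restr (mconst 0 ord_max) e.
Definition degen (X : sset) n (x : X 0) : X n := restr (mconst n ord0) x.

Section SubSet.
Variables (X : sset) (P : forall n, X n -> Prop).
Hypothesis PP : forall m n (a : mono m n) (x : X n), P x -> P (restr a x).

Definition sub_sset : sset.
Proof.
refine {| cells := fun n => {x : X n | P x};
          restr := fun m n a x => exist _ (restr a (sval x)) (PP a (svalP x)) |}.
- by move=> n [x Px]; apply: eq_exist; rewrite /= restr_id.
- by move=> l m n b a [x Px]; apply: eq_exist; rewrite /= restr_comp.
Defined.

Definition sub_incl : smap sub_sset X :=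
  {| app := fun n (x : sub_sset n) => sval x; app_nat := fun m n a x => erefl |}.
End SubSet.

Definition sprod (X Y : sset) : sset.
Proof.
refine {| cells := fun n => (X n * Y n)%type;
          restr := fun m n a x => (restr a x.1, restr a x.2) |}.
- by move=> n [x y]; rewrite !restr_id.
- by move=> l m n b a [x y]; rewrite !restr_comp.
Defined.

Definition sfst X Y : smap (sprod X Y) X :=
  {| app := fun n (x : sprod X Y n) => x.1; app_nat := fun m n a x => erefl |}.
Definition ssnd X Y : smap (sprod X Y) Y :=
  {| app := fun n (x : sprod X Y n) => x.2; app_nat := fun m n a x => erefl |}.

Definition sprod_map X X' Y Y' (f : smap X X') (g : smap Y Y') :
  smap (sprod X Y) (sprod X' Y').
Proof.
refine {| app := fun n (x : sprod X Y n) =>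
                   ((f n x.1, g n x.2) : sprod X' Y' n) |}.
by move=> m n a x /=; rewrite !app_nat.
Defined.

Definition pullback X Y Z (f : smap X Z) (g : smap Y Z) : sset.
Proof.
refine (@sub_sset (sprod X Y) (fun n x => f n x.1 = g n x.2) _).
by move=> m n a x /= e; rewrite !app_nat e.
Defined.

Definition power (I : Type) (X : sset) : sset.
Proof.
refine {| cells := fun n => I -> X n;
          restr := fun m n a x i => restr a (x i) |}.
- by move=> n x; apply: funext => i; rewrite restr_id.
- by move=> l m n b a x; apply: funext => i; rewrite restr_comp.
Defined.

Definition power_map I X Y (f : smap X Y) : smap (power I X) (power I Y).
Proof.
refine {| app := fun n (x : power I X n) => (fun i => f n (x i)) : power I Y n |}.
by move=> m n a x; apply: funext => i /=; rewrite app_nat.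
Defined.

Definition diag I X : smap X (power I X) :=
  {| app := fun n x => (fun _ => x) : power I X n;
     app_nat := fun m n a x => erefl |}.

Definition discrete (I : Type) : sset :=
  {| cells := fun _ => I; restr := fun m n a i => i;
     restr_id := fun n i => erefl; restr_comp := fun l m n b a i => erefl |}.

Definition simplex (n : nat) : sset :=
  {| cells := fun m => mono m n; restr := fun l m a b => mcomp b a;
     restr_id := fun m b => erefl; restr_comp := fun k l m b a c => erefl |}.

Definition simplex_map m n (a : mono m n) : smap (simplex m) (simplex n) :=
  {| app := fun k (b : simplex m k) => (mcomp a b : simplex n k);
     app_nat := fun k l c b => erefl |}.

Definition horn_pred n (i : 'I_n.+1) m (s : simplex n m) : Prop :=
  exists2 j : 'I_n.+1, j != i & forall t, s t != j.

Lemma horn_predP n (i : 'I_n.+1) l m (a : mono l m) (s : simplex n m) :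
  horn_pred i s -> horn_pred i (restr a s).
Proof. by case=> j ji h; exists j => // t; apply: h. Qed.

Definition horn n (i : 'I_n.+1) : sset := sub_sset (@horn_predP n i).

Definition bound_pred n m (s : simplex n m) : Prop :=
  exists j : 'I_n.+1, forall t, s t != j.

Lemma bound_predP n l m (a : mono l m) (s : simplex n m) :
  bound_pred s -> bound_pred (restr a s).
Proof. by case=> j h; exists j => t; apply: h. Qed.

Definition bound n : sset := sub_sset (@bound_predP n).

Definition sfun (K X : sset) : sset.
Proof.
refine {| cells := fun n => smap (sprod K (simplex n)) X;
          restr := fun m n a h => scomp h (sprod_map (sid K) (simplex_map a)) |}.
- by move=> n h; apply: smap_eq => m [x b].
- by move=> l m n b a h; apply: smap_eq => k [x c].
Defined.

Definition has_lifts A B X Y (i : smap A B) (p : smap X Y) : Prop :=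
  forall (u : smap A X) (v : smap B Y), (forall n a, p n (u n a) = v n (i n a)) ->
  exists h : smap B X, (forall n a, h n (i n a) = u n a) /\
                       (forall n b, p n (h n b) = v n b).

Definition trivial_fibration X Y (p : smap X Y) : Prop :=
  forall n, has_lifts (sub_incl (@bound_predP n)) p.

Definition quasicategory (X : sset) : Prop :=
  forall n (i : 'I_n.+1), 0 < i < n -> forall u : smap (horn i) X,
  exists h : smap (simplex n) X, forall m (s : horn i m), h m (sval s) = u m s.

(* Equivalences of a quasi-category: the edges with a two-sided inverse in the
   homotopy category. *)
Definition is_equiv (X : sset) (e : X 1) : Prop :=
  exists e' : X 1,
    (exists s : X 2, [/\ restr (mface ord_max) s = e,
                         restr (mface ord0) s = e' &
                         restr (mface (lift ord0 ord0)) s = degen 1 (src e)]) /\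
    (exists s : X 2, [/\ restr (mface ord_max) s = e',
                         restr (mface ord0) s = e &
                         restr (mface (lift ord0 ord0)) s = degen 1 (tgt e)]).

Definition restricts_to K X (h : smap (sprod K (simplex 1)) X)
    (f g : smap K X) : Prop :=
  forall m (x : K m), h m (x, mconst m ord0) = f m x /\
                      h m (x, mconst m ord_max) = g m x.

Definition component K X (h : smap (sprod K (simplex 1)) X) (v : K 0) : X 1 :=
  h 1 (degen 1 v, mid 1).

Definition nat_equiv K X (f g : smap K X) : Prop :=
  exists e : sfun K X 1, is_equiv e /\ restricts_to e f g.

(* Joyal's form of the definition: for every quasi-category X,
   Fun(B, X) -> Fun(A, X) is bijective on equivalence classes of objects. *)
Definition categorical_equivalence A B (i : smap A B) : Prop :=
  forall X, quasicategory X ->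
  (forall u : smap A X, exists v : smap B X, nat_equiv (scomp v i) u) /\
  (forall v w : smap B X, nat_equiv (scomp v i) (scomp w i) -> nat_equiv v w).

Definition monomorphism A B (i : smap A B) : Prop := forall n, injective (i n).

Definition categorical_fibration X Y (p : smap X Y) : Prop :=
  forall A B (i : smap A B), monomorphism i -> categorical_equivalence i ->
  has_lifts i p.

Definition lies_over K X B (pi : smap X B) (k : smap K B) (f : smap K X) : Prop :=
  forall m (x : K m), pi m (f m x) = k m x.

(* Fun_B(K, X). *)
Definition sfun_over K X B (pi : smap X B) (k : smap K B) : sset.
Proof.
refine (@sub_sset (sfun K X)
          (fun n h => lies_over pi (scomp k (sfst K (simplex n))) h) _).
by move=> m n a h hP l x /=; rewrite hP.
Defined.

Definition nat_equiv_over K X B (pi : smap X B) (k : smap K B)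
    (f g : smap K X) : Prop :=
  exists e : sfun_over pi k 1, is_equiv e /\ restricts_to (sval e) f g.

(* An n-simplex of X * Y is a decomposition of [n] into an initial part
   I = cut^-1(0) and a final part I' = cut^-1(1), with an element of
   X(I) x Y(I').  As I need not be literally some [k], an element of X(I) is
   given by its compatible restrictions along the maps [k] -> I in Delta; for
   I empty there are none, so that X(I) is a point, as it should. *)
Record join_cell (X Y : sset) (n : nat) := JoinCell {
  cut : mono n 1;
  jl : forall k (b : mono k n), (forall t, cut (b t) = ord0) -> X k;
  jl_nat : forall k l (b : mono k n) (c : mono l k)
    (h : forall t, cut (b t) = ord0) (h' : forall t, cut (b (c t)) = ord0),
    jl (b := mcomp b c) h' = restr c (jl h);
  jr : forall k (b : mono k n), (forall t, cut (b t) = ord_max) -> Y k;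
  jr_nat : forall k l (b : mono k n) (c : mono l k)
    (h : forall t, cut (b t) = ord_max) (h' : forall t, cut (b (c t)) = ord_max),
    jr (b := mcomp b c) h' = restr c (jr h) }.

Definition join (X Y : sset) : sset :=
  {| cells := join_cell X Y;
     restr := fun m n (a : mono m n) (x : join_cell X Y n) =>
       {| cut := mcomp (cut x) a;
          jl := fun k b h => jl (b := mcomp a b) h;
          jl_nat := fun k l b c h h' => jl_nat (b := mcomp a b) (c := c) h h';
          jr := fun k b h => jr (b := mcomp a b) h;
          jr_nat := fun k l b c h h' => jr_nat (b := mcomp a b) (c := c) h h' |};
     restr_id := fun n x => erefl;
     restr_comp := fun l m n b a x => erefl |}.

Lemma join_cell_eq X Y n c l lP r rP l' lP' r' rP' :
  (forall k b h, l k b h = l' k b h) -> (forall k b h, r k b h = r' k b h) ->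
  @JoinCell X Y n c l lP r rP = @JoinCell X Y n c l' lP' r' rP'.
Proof.
move=> el er.
have {}el : l = l'.
  by do 3 ![apply: functional_extensionality_dep => ?]; apply: el.
have {}er : r = r'.
  by do 3 ![apply: functional_extensionality_dep => ?]; apply: er.
case: _ / el lP' => lP'; case: _ / er rP' => rP'.
by rewrite (Prop_irrelevance lP lP') (Prop_irrelevance rP rP').
Qed.

Section JoinMap.
Variables (X X' Y Y' : sset) (f : smap X X') (g : smap Y Y').

Definition join_map_cell n (x : join X Y n) : join X' Y' n.
Proof.
refine {| cut := cut x;
          jl := fun k b h => f k (jl (b := b) h);
          jr := fun k b h => g k (jr (b := b) h) |}.
- by move=> k l b c h h'; rewrite (jl_nat h) app_nat.
- by move=> k l b c h h'; rewrite (jr_nat h) app_nat.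
Defined.

Definition join_map : smap (join X Y) (join X' Y').
Proof.
refine {| app := join_map_cell |}.
by move=> m n a x; apply: join_cell_eq.
Defined.
End JoinMap.

Lemma join_map_id X Y n (x : join X Y n) : join_map (sid X) (sid Y) n x = x.
Proof. by apply: (@join_cell_eq _ _ _ (cut x)). Qed.

Lemma join_map_comp X X' X'' Y Y' Y'' (f' : smap X' X'') (f : smap X X')
    (g' : smap Y' Y'') (g : smap Y Y') n (x : join X Y n) :
  join_map (scomp f' f) (scomp g' g) n x = join_map f' g' n (join_map f g n x).
Proof. by apply: join_cell_eq. Qed.

Lemma max_neq0 n (b : mono n 1) :
  (forall t, b t = ord0) -> (forall t, b t = ord_max) -> False.
Proof. by move=> h0 h1; move: (h0 ord0); rewrite h1. Qed.

Lemma inr_cell_absurd n k (b : mono k n) :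
  (forall t, mconst (n := 1) n ord_max (b t) = ord0) -> False.
Proof. by move=> h; apply: (max_neq0 (b := mcomp (mconst n ord_max) b)). Qed.

Definition inr_cell (X Y : sset) n (y : Y n) : join X Y n.
Proof.
refine {| cut := mconst n ord_max;
          jl := fun k b h => False_rect (X k) (inr_cell_absurd h);
          jr := fun k b _ => restr b y |}.
- by move=> k l b c h h'; case: (inr_cell_absurd h).
- by move=> k l b c h h'; rewrite restr_comp.
Defined.

Lemma join_map_inr X X' Y Y' (f : smap X X') (g : smap Y Y') n (y : Y n) :
  join_map f g n (inr_cell X y) = inr_cell X' (g n y).
Proof.
rewrite /= /join_map_cell /inr_cell /=.
apply: join_cell_eq => k b h; last by rewrite app_nat.
by case: (inr_cell_absurd h).
Qed.

Definition join_inr (X Y : sset) : smap Y (join X Y).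
Proof.
refine {| app := fun n y => inr_cell X y : join X Y n |}.
move=> m n a y; rewrite /inr_cell /=; apply: join_cell_eq => k b h.
  by case: (inr_cell_absurd h).
by rewrite -restr_comp.
Defined.

Definition left_cone (K : sset) : sset := join (simplex 0) K.

(* X_{/q}: the n-simplices are the maps from the join of Delta^n and K to X
   which restrict to q on K. *)
Section Slice.
Variables (K X : sset) (q : forall n, K n -> X n).

Definition slice_pred n (h : smap (join (simplex n) K) X) : Prop :=
  forall m y, h m (inr_cell (simplex n) y) = q y.

Lemma slice_predP m n (a : mono m n) (h : smap (join (simplex n) K) X) :
  slice_pred h -> slice_pred (scomp h (join_map (simplex_map a) (sid K))).
Proof.
by move=> hP k y; rewrite -hP; congr (h k _); apply: join_map_inr.
Qed.

Definition slice : sset.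
Proof.
refine {| cells := fun n => {h : smap (join (simplex n) K) X | slice_pred h};
          restr := fun m n a h => exist _ _ (slice_predP a (svalP h)) |}.
- move=> n [h hP]; apply: eq_exist; apply: smap_eq => m x.
  by congr (h m _); apply: join_map_id.
- move=> l m n b a [h hP]; apply: eq_exist; apply: smap_eq => k x.
  by congr (h k _); apply: join_cell_eq.
Defined.
End Slice.

Lemma slice_postP (K X S : sset) (p : smap X S) (q : forall n, K n -> X n) n
    (h : smap (join (simplex n) K) X) :
  slice_pred q h -> slice_pred (fun n y => p n (q n y)) (scomp p h).
Proof. by move=> hP m y; rewrite -hP. Qed.

Definition slice_post (K X S : sset) (p : smap X S) (q : forall n, K n -> X n) :
  smap (slice q) (slice (fun n y => p n (q n y))).
Proof.
refine {| app := fun n (h : slice q n) =>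
  (exist _ _ (slice_postP p (svalP h)) : slice (fun n y => p n (q n y)) n) |}.
by move=> m n a h; apply: eq_exist; apply: smap_eq.
Defined.

Lemma slice_preP (K L X : sset) (j : smap L K) (q : forall n, K n -> X n) n
    (h : smap (join (simplex n) K) X) :
  slice_pred q h ->
  slice_pred (fun n y => q n (j n y))
    (scomp h (join_map (sid (simplex n)) j)).
Proof.
by move=> hP m y; rewrite -hP; congr (h m _); apply: join_map_inr.
Qed.

Definition slice_pre (K L X : sset) (j : smap L K) (q : forall n, K n -> X n) :
  smap (slice q) (slice (fun n y => q n (j n y))).
Proof.
refine {| app := fun n (h : slice q n) =>
  (exist _ _ (slice_preP j (svalP h)) : slice (fun n y => q n (j n y)) n) |}.
move=> m n a h; apply: eq_exist; apply: smap_eq => k x.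
by congr (sval h k _); apply: join_cell_eq.
Defined.

Section Limit.
Variables (X S K : sset) (p : smap X S) (q : smap (left_cone K) X).
Let j := join_inr (simplex 0) K.

Definition limit_target : sset :=
  pullback (slice_post p (fun n y => q n (j n y)))
           (slice_pre j (fun n y => p n (q n y))).

Lemma limit_mapP n (h : slice q n) :
  slice_post p (fun n y => q n (j n y)) n (slice_pre j q n h) =
  slice_pre j (fun n y => p n (q n y)) n (slice_post p q n h).
Proof. by apply: eq_exist; apply: smap_eq. Qed.

(* X_{/q} -> X_{/q|K} x_{S_{/pq|K}} S_{/pq} *)
Definition limit_map : smap (slice q) limit_target.
Proof.
refine {| app := fun n (h : slice q n) =>
  (exist _ (slice_pre j q n h, slice_post p q n h) (limit_mapP h) :
     limit_target n) |}.
move=> m n a h; apply: eq_exist.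
by apply/pair_equal_spec; split; apply: app_nat.
Defined.

Definition is_limit : Prop := trivial_fibration limit_map.
End Limit.

Lemma apex_absurd k (b : mono k 0) :
  (forall t, mconst (n := 1) 0 ord0 (b t) = ord_max) -> False.
Proof.
by move=> h; apply: (max_neq0 (b := mcomp (mconst 0 ord0) b) (fun _ => erefl)).
Qed.

Definition apex (I : Type) : left_cone (discrete I) 0.
Proof.
refine {| cut := mconst 0 ord0;
          jl := fun k b _ => (mconst k ord0 : simplex 0 k);
          jr := fun k b h => False_rect (discrete I k) (apex_absurd h) |} => //.
by move=> k l b c h h'; case: (apex_absurd h).
Defined.

(* For i in I, the edge of the left cone on I from the cone point to i. *)
Definition leg (I : Type) (i : I) : left_cone (discrete I) 1 :=
  {| cut := mid 1;
     jl := fun k b _ => (mconst k ord0 : simplex 0 k);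
     jl_nat := fun k l b c h h' => erefl;
     jr := fun k b _ => (i : discrete I k);
     jr_nat := fun k l b c h h' => erefl |}.

Definition is_limit_cone X S (p : smap X S) I (x : X 0) (e : I -> X 1) : Prop :=
  exists q : smap (left_cone (discrete I)) X,
    [/\ q 0 (apex I) = x, forall i, q 1 (leg i) = e i & is_limit p q].

Definition is_terminal X S (p : smap X S) (x : X 0) : Prop :=
  exists q : smap (left_cone (discrete void)) X,
    q 0 (apex void) = x /\ is_limit p q.

(* The second condition says that u maps the edge {0, 1} of the horn to e; for
   n.+2 >= 2 that edge does belong to the horn. *)
Definition cocartesian X S (p : smap X S) (e : X 1) : Prop :=
  forall n (u : smap (horn (ord0 : 'I_n.+3)) X) (v : smap (simplex n.+2) S),
  (forall m s, p m (u m s) = v m (sval s)) ->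
  (forall s : horn (ord0 : 'I_n.+3) 1,
     sval s = @medge n.+2 ord0 (lift ord0 ord0) (leq0n _) -> u 1 s = e) ->
  exists h : smap (simplex n.+2) X,
    (forall m s, h m (sval s) = u m s) /\ (forall m s, p m (h m s) = v m s).

Record category := Category {
  ob : Type;
  hom : ob -> ob -> Type;
  idm : forall a, hom a a;
  cmp : forall a b c, hom b c -> hom a b -> hom a c;
  cmp1m : forall a b (f : hom a b), cmp (idm b) f = f;
  cmpm1 : forall a b (f : hom a b), cmp f (idm a) = f;
  cmpA : forall a b c d (h : hom c d) (g : hom b c) (f : hom a b),
    cmp h (cmp g f) = cmp (cmp h g) f }.

Record chain (C : category) (n : nat) := Chain {
  cob : 'I_n.+1 -> ob C;
  cmor : forall i j : 'I_n.+1, i <= j -> hom (cob i) (cob j);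
  cmor_id : forall (i : 'I_n.+1) (h : i <= i), cmor h = idm (cob i);
  cmor_cmp : forall (i j k : 'I_n.+1) (hij : i <= j) (hjk : j <= k) (hik : i <= k),
    cmor hik = cmp (cmor hjk) (cmor hij) }.

Definition nerve (C : category) : sset :=
  {| cells := chain C;
     restr := fun m n a x =>
       {| cob := fun i => cob x (a i);
          cmor := fun i j h => cmor x (mfunP a h);
          cmor_id := fun i h => cmor_id x (mfunP a h);
          cmor_cmp := fun i j k hij hjk hik =>
            cmor_cmp x (mfunP a hij) (mfunP a hjk) (mfunP a hik) |};
     restr_id := fun n x => erefl;
     restr_comp := fun l m n b a x => erefl |}.

Definition nvert (C : category) (a : ob C) : nerve C 0 :=
  {| cob := fun _ => a;
     cmor := fun _ _ _ => idm a;
     cmor_id := fun _ _ => erefl;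
     cmor_cmp := fun _ _ _ _ _ _ => esym (cmp1m (idm a)) |}.

Section Nedge.
Variables (C : category) (a b : ob C) (u : hom a b).

Definition nedge_ob (i : nat) : ob C := if i is 0 then a else b.

Definition nedge_mor (i j : nat) : i <= j -> hom (nedge_ob i) (nedge_ob j) :=
  match i, j return i <= j -> hom (nedge_ob i) (nedge_ob j) with
  | 0, 0 => fun _ => idm a
  | 0, _.+1 => fun _ => u
  | _.+1, 0 => fun h => False_rect _ (notF h)
  | _.+1, _.+1 => fun _ => idm b
  end.

Definition nedge : nerve C 1.
Proof.
refine {| cob := fun i : 'I_2 => nedge_ob i;
          cmor := fun (i j : 'I_2) (h : i <= j) => nedge_mor h |}.
- by move=> [[|i] ?].
- by move=> [[|i] ?] [[|j] ?] [[|k] ?] //= *; rewrite ?cmp1m ?cmpm1.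
Defined.
End Nedge.

(* <n> = option 'I_n, with base point None. *)
Record fhom (m n : nat) := FHom {
  ffunc :> option 'I_m -> option 'I_n;
  ffunc0 : ffunc None = None }.

Lemma fhom_eq m n (f g : fhom m n) : ffunc f = ffunc g -> f = g.
Proof.
case: f g => [f f0] [g g0] /= e; case: _ / e g0 => g0.
by rewrite (Prop_irrelevance f0 g0).
Qed.

Definition fid n : fhom n n := FHom (ffunc := id) erefl.

Definition fcomp l m n (g : fhom m n) (f : fhom l m) : fhom l n.
Proof.
by refine {| ffunc := fun x => g (f x) |}; rewrite !ffunc0.
Defined.

Definition FinPt : category.
Proof.
refine {| ob := nat; hom := fhom; idm := fid; cmp := fcomp |}.
- by move=> a b f; apply: fhom_eq.
- by move=> a b f; apply: fhom_eq.
- by move=> a b c d h g f; apply: fhom_eq.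
Defined.

Definition inert m n (f : fhom m n) : Prop :=
  forall i : 'I_n, exists! x, f x = Some i.

Definition active m n (f : fhom m n) : Prop :=
  forall x, f x = None -> x = None.

Definition rho n (i : 'I_n) : fhom n 1 :=
  FHom (ffunc := fun x => if x == Some i then Some ord0 else None) erefl.

Notation NFin := (nerve FinPt).

Definition edge_hom (t : NFin 1) : fhom (cob t ord0) (cob t ord_max) :=
  cmor t (i := ord0) (j := ord_max) (leq0n _).

Lemma active_cmp n (t : NFin n) (i j k : 'I_n.+1) (hij : i <= j) (hjk : j <= k)
    (hik : i <= k) :
  active (cmor t hij) -> active (cmor t hjk) -> active (cmor t hik).
Proof. by move=> aij ajk x; rewrite (cmor_cmp t hij hjk) => /ajk/aij. Qed.

Lemma active_cmpr n (t : NFin n) (i j k : 'I_n.+1) (hij : i <= j) (hjk : j <= k)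
    (hik : i <= k) :
  active (cmor t hik) -> active (cmor t hij).
Proof.
by move=> aik x xN; apply: aik; rewrite (cmor_cmp t hij hjk) /= xN ffunc0.
Qed.

Lemma active_edgeE n (t : NFin n) (i j : 'I_n.+1) (h : i <= j) :
  active (cmor t h) = active (edge_hom (restr (medge h) t)).
Proof. by congr (active (cmor t _)); apply: bool_irrelevance. Qed.

Definition step_fun (c : nat) (t : 'I_3) : 'I_2 :=
  if t <= c then ord0 else ord_max.

Lemma step_funP c (t u : 'I_3) : t <= u -> step_fun c t <= step_fun c u.
Proof.
rewrite /step_fun => tu; case: (leqP u c) => [uc|_]; first by rewrite (leq_trans tu).
by case: ifP.
Qed.

Section Family.
Variables (C M : sset) (p : smap M (sprod C NFin)).

Definition base (x : M 0) : C 0 := (p 0 x).1.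
Definition arity (x : M 0) : nat := cob (p 0 x).2 ord0.

Definition cocart_lift (x : M 0) m n (u : fhom m n) (e : M 1) : Prop :=
  [/\ src e = x, p 1 e = (degen 1 (base x), nedge (C := FinPt) u) &
      cocartesian p e].

Record operad_family : Prop := OperadFamily {
  family_fib : categorical_fibration p;
  family_inert : forall (x : M 0) n (u : fhom (arity x) n),
    inert u -> exists e, cocart_lift x u e;
  family_limit : forall (x : M 0) (e : 'I_(arity x) -> M 1),
    1 <= arity x -> (forall i, cocart_lift x (rho i) (e i)) ->
    is_limit_cone p x e;
  family_terminal : forall x : M 0, arity x = 0 -> is_terminal p x;
  family_prod : forall n (c : C 0) (y : 'I_n -> M 0),
    1 <= n -> (forall i, p 0 (y i) = (c, nvert (C := FinPt) 1)) ->
    exists (x : M 0) (e : 'I_n -> M 1), p 0 x = (c, nvert (C := FinPt) n) /\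
      forall i, cocart_lift x (rho i) (e i) /\ tgt (e i) = y i;
  family_unit : forall c : C 0, exists x : M 0,
    p 0 x = (c, nvert (C := FinPt) 0) }.

Definition inert_edge (e : M 1) : Prop :=
  [/\ cocartesian p e, is_equiv (p 1 e).1 & inert (edge_hom (p 1 e).2)].

Definition active_chain n (t : NFin n) : Prop :=
  forall (i j : 'I_n.+1) (h : i <= j), active (cmor t h).

Lemma act_predP m n (a : mono m n) (x : M n) :
  active_chain (p n x).2 -> active_chain (p m (restr a x)).2.
Proof. by rewrite app_nat => h i j ij; apply: h. Qed.

(* M_act: the simplices of M all of whose edges lie over active maps. *)
Definition Mact : sset := sub_sset act_predP.

Definition Mact_base : smap Mact C :=
  scomp (sfst C NFin) (scomp p (sub_incl act_predP)).

Definition FunArr : sset := sfun (simplex 1) NFin.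

(* The object of Fun(Delta^1, N(Fin)) at the vertex i of t is an active map. *)
Definition funact_pred n (t : FunArr n) : Prop :=
  forall i : 'I_n.+1, active (edge_hom (t 1 (mid 1, mconst 1 i))).

Lemma funact_predP m n (a : mono m n) (t : FunArr n) :
  funact_pred t -> funact_pred (restr a t).
Proof. by move=> h i; rewrite /= mcomp_const; apply: h. Qed.

Definition FunAct : sset := sub_sset funact_predP.

Definition eval (i : 'I_2) : smap FunAct NFin.
Proof.
refine {| app := fun n (t : FunAct n) => sval t n (mconst n i, mid n) |}.
by move=> m n a [t tP]; apply: (app_nat t a (mconst n i, mid n)).
Defined.

Definition Env : sset := pullback (scomp (ssnd C NFin) p) (eval ord0).

Definition Env_proj : smap Env (sprod C NFin).
Proof.
refine {| app := fun n (x : Env n) =>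
  (((p n (sval x).1).1, eval ord_max n (sval x).2) : sprod C NFin n) |}.
by move=> m n a x; congr pair; [rewrite /= app_nat | apply: app_nat].
Defined.

Definition env_fib_pred (n : nat) k (x : Env k) : Prop :=
  (Env_proj k x).2 = degen k (nvert (C := FinPt) n).

Lemma env_fib_predP (n : nat) l k (a : mono l k) (x : Env k) :
  env_fib_pred n x -> env_fib_pred n (restr a x).
Proof. by rewrite /env_fib_pred app_nat /= => ->. Qed.

Definition Env_fib (n : nat) : sset := sub_sset (@env_fib_predP n).

Definition env_fib_base (n : nat) : smap (Env_fib n) C :=
  scomp (sfst C NFin) (scomp Env_proj (sub_incl (@env_fib_predP n))).

(* The first projection Env(M)_<n> -> M takes its values in M_act; for n = 1
   it is the isomorphism identifying Env(M)_<1> with M_act. *)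
Lemma env_fib_active (n : nat) k (x : Env_fib n k) :
  active_chain (p k (sval (sval x)).1).2.
Proof.
case: x => [[[x [t tP]] /= e] /= f] i j ij.
have e0 : (p k x).2 = t k (mconst k ord0, mid k) := e.
have f1 : t k (mconst k ord_max, mid k) = degen k (nvert (C := FinPt) n) := f.
rewrite e0 active_edgeE -app_nat.
pose d : mono 1 k := medge ij; pose s c : mono 2 1 := Mono (@step_funP c).
have edgeE c c' (u v : 'I_3) (uv : u <= v) (a : mono 1 1) (b : mono 1 k) :
    (forall w, step_fun c (edge_fun u v w) = a w) ->
    (forall w, d (step_fun c' (edge_fun u v w)) = b w) ->
    active (cmor (t 2 (s c, mcomp d (s c'))) uv) = active (edge_hom (t 1 (a, b))).
  move=> ha hb; rewrite active_edgeE -app_nat /=; congr (active (edge_hom (t 1 (_, _))));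
  exact: mono_eq.
pose o : 'I_3 := lift ord0 ord0.
have le01 : (ord0 : 'I_3) <= o by []. have le12 : o <= (ord_max : 'I_3) by [].
have le02 : (ord0 : 'I_3) <= (ord_max : 'I_3) by [].
suff : active (cmor (t 2 (s 1, mcomp d (s 0))) le01).
  by rewrite (edgeE _ _ _ _ _ (mconst 1 ord0) d) //; case=> [[|[|w]] ?] //;
   congr (edge_fun _ _ _); apply: val_inj.
apply: (@active_cmpr _ _ _ _ _ le01 le12 le02).
rewrite (edgeE _ _ _ _ _ (mid 1) d); first last.
- by case=> [[|[|w]] ?].
- by case=> [[|[|w]] ?] //; apply: val_inj.
rewrite -(edgeE 0 1 ord0 ord_max le02); first last.
- by case=> [[|[|w]] ?].
- by case=> [[|[|w]] ?] //; apply: val_inj.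
apply: (@active_cmp _ _ _ _ _ le01 le12).
  rewrite (edgeE _ _ _ _ _ (mid 1) (mconst 1 i)); first exact: tP.
  - by case=> [[|[|w]] ?] //; apply: val_inj.
  - by case=> [[|[|w]] ?].
rewrite (edgeE _ _ _ _ _ (mconst 1 ord_max) d).
- have -> : t 1 (mconst 1 ord_max, d) = restr d (t k (mconst k ord_max, mid k)).
    by rewrite -app_nat.
  by rewrite f1.
- by case=> [[|[|w]] ?].
- by case=> [[|[|w]] ?].
Qed.

Definition Env_forget (n : nat) : smap (Env_fib n) Mact.
Proof.
refine {| app := fun k (x : Env_fib n k) =>
  (exist _ (sval (sval x)).1 (@env_fib_active n k x) : Mact k) |}.
by move=> l k a x; apply: eq_exist.
Defined.

(* R is a cocartesian pushforward functor along rho i, exhibited by H. *)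
Definition is_pushforward n (i : 'I_n) (R : smap (Env_fib n) (Env_fib 1)) : Prop :=
  exists H : smap (sprod (Env_fib n) (simplex 1)) Env,
    [/\ restricts_to H (sub_incl (@env_fib_predP n))
                       (scomp (sub_incl (@env_fib_predP 1)) R),
        forall k (x : Env_fib n k) (t : simplex 1 k),
          Env_proj k (H k (x, t)) =
          (env_fib_base n k x, restr t (nedge (C := FinPt) (rho i))) &
        forall x : Env_fib n 0, cocartesian Env_proj (component H x)].

Definition Mact_pow (n : nat) : sset :=
  pullback (power_map 'I_n Mact_base) (diag 'I_n C).

Definition Mact_pow_base (n : nat) : smap (Mact_pow n) C :=
  {| app := fun k (x : Mact_pow n k) => (sval x).2;
     app_nat := fun l k a x => erefl |}.

Definition Mact_pow_proj (n : nat) (i : 'I_n) k (x : Mact_pow n k) : Mact k :=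
  (sval x).1 i.

Definition Mact_pow_tuple K (k : smap K C) (n : nat) (g : 'I_n -> smap K Mact)
  (gP : forall i, lies_over Mact_base k (g i)) : smap K (Mact_pow n).
Proof.
refine {| app := fun m (x : K m) => (exist _ (fun i => g i m x, k m x)
    (funext (fun i => gP i m x)) : Mact_pow n m) |}.
move=> m m' a x; apply: eq_exist; rewrite /= app_nat; congr pair.
by apply: funext => i; rewrite app_nat.
Defined.

(* S is the composite of an inverse over C, called inv, of the equivalence
   T = (rho^1_!, ..., rho^n_!) with the forgetful functor.  All the choices
   involved being unique up to equivalence over C only, this is a predicate. *)
Definition is_direct_sum (n : nat) (S : smap (Mact_pow n) Mact) : Prop :=
  exists (R : 'I_n -> smap (Env_fib n) (Env_fib 1))
         (T : smap (Env_fib n) (Mact_pow n))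
         (inv : smap (Mact_pow n) (Env_fib n)),
    [/\ forall i, is_pushforward i (R i),
        lies_over (Mact_pow_base n) (env_fib_base n) T /\
        (forall i k (x : Env_fib n k),
           Mact_pow_proj i (T k x) = Env_forget 1 k (R i k x)),
        lies_over (env_fib_base n) (Mact_pow_base n) inv,
        nat_equiv_over (env_fib_base n) (env_fib_base n)
          (scomp inv T) (sid (Env_fib n)) /\
        nat_equiv_over (Mact_pow_base n) (Mact_pow_base n)
          (scomp T inv) (sid (Mact_pow n)) &
        S = scomp (Env_forget n) inv].

End Family.

(* The maps u i : <m> -> <m_ i> induce a bijection from the disjoint union of
   the sets <m_ i>^o to <m>^o, sending j in <m_ i>^o to its preimage by u i. *)
Definition induces_bijection (I : finType) (m : nat) (m_ : I -> nat)
    (u : forall i, fhom m (m_ i)) : Prop :=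
  exists b : {i : I & 'I_(m_ i)} -> 'I_m,
    bijective b /\ forall s, u (tag s) (Some (b s)) = Some (tagged s).

(* Main.v *)
(** Let F : K -> Env(M)_<n> be f together with the active maps
    <m(v)> -> <n> collapsing the summand <m_i(v)>^o of <m(v)>^o to i.  The
    transformation alpha_i lifts to a transformation of maps K -> Env(M) from F
    to g_i : K -> Env(M)_<1> = M_act over rho^i, and a morphism of Env(M) over an
    inert cocartesian morphism of M is cocartesian: an inert map is a projection,
    and the elements it kills must be killed by any competing map, since these
    are compatible with active maps, which kill nothing.  By uniqueness of
    cocartesian lifts, rho^i_! F and g_i are equivalent, hence so are F and the
    image of (g_i) under the inverse equivalence; forgetting the active maps
    gives the theorem.

    Uniqueness of cocartesian lifts over an arbitrary K needs the extension of
    maps from (bd Delta^m) x Delta^n u Delta^m x Lambda^n_j to Delta^m x Delta^n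
    for j < n.  The simplices to be added are chains in [m] x [n]; they are paired
    by inserting or removing the point below the first point in row j + 1, and
    attached in order of increasing size and, at equal size, of decreasing column
    of that point.  This also shows that inner horn inclusions are categorical
    equivalences, so that categorical fibrations are inner fibrations. *)

From Stdlib Require Eqdep_dec PeanoNat.
Require Import Defs.
From mathcomp Require Import all_boot.
From mathcomp Require Import boolp zify.

Set Implicit Arguments.
Unset Strict Implicit.
Unset Printing Implicit Defensive.

(** A natural equivalence is an edge of a function complex, so the comparison of transformations
    takes place in Fun(K, Env(M)) over Fun(K, C x N(Fin)). An edge with cocartesian components is
    cocartesian there. The pushforward transformation at F and the lift of alpha_i have the same
    source and the same projection; hence their targets are equivalent in a fibre. This is why
    prisms are also filled for j = 0: the only outer horns met start with the edge Delta^0 x {0, 1}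
    at the vertex 0, which is assumed cocartesian.

    A second obstacle is that a horn of Env(M) cannot be filled by lifting in M alone. The
    underlying horn of N(Fin) has to be extended before, compatibly with the active maps, and in
    dimensions 2 and 3 a horn lacks an edge or a composition law. The extension is made uniformly in
    all dimensions: by composing through the vertex j for an inner horn, and by composing with a
    section of the inert map for an outer horn. *)

Lemma sub_eq (X : sset) (P : forall n, X n -> Prop)
    (PP : forall m n (a : mono m n) (x : X n), P n x -> P m (restr a x))
    n (x y : sub_sset PP n) : sval x = sval y -> x = y.
Proof. by case: x y => [x Px] [y Py] /= e; apply: eq_exist. Qed.

(** * Extension of maps cell by cell *)

Section Adjoin.
Variables (Y X S : sset) (q : smap X S) (v : smap Y S).
Variables (P P' : forall n, Y n -> Prop).
Hypothesis PP : forall m n (a : mono m n) (y : Y n), P y -> P (restr a y).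
Hypothesis PP' : forall m n (a : mono m n) (y : Y n), P' y -> P' (restr a y).
Variable h : smap (sub_sset PP) X.
Hypothesis hv : forall n y, q n (h n y) = v n (sval y).
Variables (I : Type) (D : I -> sset) (phi : forall i, smap (D i) Y).
Hypothesis phi_inj : forall i j n (s : D i n) (t : D j n),
  ~ P (phi i n s) -> phi i n s = phi j n t ->
  existT (fun i => D i n) i s = existT (fun i => D i n) j t.
Hypothesis fill : forall i, exists g : smap (D i) X,
  (forall n s (Ps : P (phi i n s)), g n s = h n (exist _ _ Ps)) /\
  (forall n s, q n (g n s) = v n (phi i n s)).
Hypothesis cover : forall n (y : Y n), P' y ->
  P y \/ exists i (s : D i n), y = phi i n s.

(* The cells of the images of the maps [phi i] outside [P] have a unique
   preimage, so that the union of [P] with these images is a pushout. *)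
Lemma adjoin : exists h' : smap (sub_sset PP') X,
  (forall n (y : Y n) (Py : P y) (Py' : P' y),
     h' n (exist _ y Py') = h n (exist _ y Py)) /\
  (forall n y, q n (h' n y) = v n (sval y)).
Proof.
have [g gP] : exists g : forall i, smap (D i) X, forall i,
    (forall n s (Ps : P (phi i n s)), g i n s = h n (exist _ _ Ps)) /\
    (forall n s, q n (g i n s) = v n (phi i n s)).
  by exists (fun i => sval (cid (fill i))) => i; exact: svalP (cid (fill i)).
(* The value at a cell is specified by all descriptions of the cell at once, so that naturality
   follows from uniqueness and no choice of a description has to be compatible with restriction. *)
have ex n (y : sub_sset PP' n) : exists x : X n,
    (forall Py : P (sval y), x = h n (exist _ (sval y) Py)) /\
    (forall i (s : D i n), sval y = phi i n s -> x = g i n s).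
  case: y => [y Py'] /=; case: (pselect (P y)) => [Py|nPy].
    exists (h n (exist _ y Py)); split=> [Qy|i s e].
      by rewrite (Prop_irrelevance Py Qy).
    by move: Py; rewrite e => Py; rewrite -(gP i).1.
  have [//|[i [s e]]] := cover Py'; exists (g i n s); split=> [//|j t e'].
  have nPs : ~ P (phi i n s) by rewrite -e.
  have E := phi_inj nPs (etrans (esym e) e').
  by have := congr1 (fun z => g (projT1 z) n (projT2 z)) E.
pose f n y := sval (cid (ex n y)).
have fP n y := svalP (cid (ex n y)).
have fnat m n (a : mono m n) (y : sub_sset PP' n) :
    f m (restr a y) = restr a (f n y).
  case: (fP n y) (fP m (restr a y)) => [f1 f2] [f1' f2'].
  rewrite /f; case: (pselect (P (sval y))) => [Py|nPy].
    by rewrite (f1 Py) -app_nat (f1' (PP a Py)); congr (h m _); apply: sub_eq.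
  have [//|[i [s e]]] := cover (svalP y).
  rewrite (f2 i s e) -app_nat; apply: f2'.
  by rewrite app_nat -e.
exists {| app := f; app_nat := fnat |}; split=> [n y Py Py'|n y] /=.
  exact: (fP n (exist _ y Py')).1.
case: (fP n y) => [f1 f2]; rewrite /f.
case: (cover (svalP y)) => [Py|[i [s e]]]; first by rewrite (f1 Py) hv.
by rewrite (f2 i s e) (gP i).2 e.
Qed.
End Adjoin.

Section Filtration.
Variables (Y X S : sset) (q : smap X S) (v : smap Y S).
Variable P : nat -> forall n, Y n -> Prop.
Hypothesis PP : forall d m n (a : mono m n) (y : Y n), P d y -> P d (restr a y).
Hypothesis PS : forall d n (y : Y n), P d y -> P d.+1 y.
Hypothesis Pex : forall n (y : Y n), exists d, P d y.
Variable h0 : smap (sub_sset (@PP 0)) X.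
Let good d (h : smap (sub_sset (@PP d)) X) :=
  (forall n y, q n (h n y) = v n (sval y)) /\
  (forall n (y : Y n) (y0 : P 0 y) (yd : P d y),
     h n (exist _ y yd) = h0 n (exist _ y y0)).
Hypothesis h0v : forall n y, q n (h0 n y) = v n (sval y).
Hypothesis step : forall d (h : smap (sub_sset (@PP d)) X), good h ->
  exists h' : smap (sub_sset (@PP d.+1)) X,
  (forall n (y : Y n) (Py : P d y) (Py' : P d.+1 y),
     h' n (exist _ y Py') = h n (exist _ y Py)) /\
  (forall n y, q n (h' n y) = v n (sval y)).

(** An increasing union is a colimit: a cell is mapped by any stage that contains it. The invariant
    [good] also remembers [h0], because filling an outer horn needs the value on the original
    domain, where an edge is known to be cocartesian. *)
Lemma filtration : exists h : smap Y X,
  (forall n (y : Y n) (Py : P 0 y), h n y = h0 n (exist _ y Py)) /\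
  (forall n y, q n (h n y) = v n y).
Proof.
have P0 d n (y : Y n) : P 0 y -> P d y by elim: d => [//|d IH] /IH /PS.
have good0 : good h0.
  by split=> // n y y0 y0'; rewrite (Prop_irrelevance y0 y0').
have step' d (h : {h : smap (sub_sset (@PP d)) X | good h}) :
    {h' : {h : smap (sub_sset (@PP d.+1)) X | good h} |
     forall n (y : Y n) (Py : P d y) (Py' : P d.+1 y),
       sval h' n (exist _ y Py') = sval h n (exist _ y Py)}.
  case: h => [h gh]; have [h' [h'1 h'2]] := cid (step gh).
  have gh' : good h'.
    by split=> // n y y0 yd; rewrite (h'1 _ _ (P0 d _ _ y0)) (gh.2 _ _ y0).
  by exists (exist _ h' gh').
pose H := nat_rect (fun d => {h : smap (sub_sset (@PP d)) X | good h})
  (exist _ h0 good0) (fun d h => sval (step' d h)).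
have HS d n (y : Y n) (Py : P d y) (Py' : P d.+1 y) :
    sval (H d.+1) n (exist _ y Py') = sval (H d) n (exist _ y Py).
  exact: (svalP (step' d (H d))).
have Hle d e n (y : Y n) (Py : P d y) (Py' : P (e + d) y) :
    sval (H (e + d)) n (exist _ y Py') = sval (H d) n (exist _ y Py).
  elim: e Py' => [|e IH] Py'; first by rewrite (Prop_irrelevance Py' Py).
  have Py2 : P (e + d) y by elim: (e) => [//|e' /PS].
  by rewrite (HS _ _ _ Py2).
have HH d e n (y : Y n) (Py : P d y) (Py' : P e y) :
    sval (H e) n (exist _ y Py') = sval (H d) n (exist _ y Py).
  case: (leqP d e) => [de|/ltnW de].
    by move: Py'; rewrite -(subnK de) => Py'; apply: Hle.
  by move: Py; rewrite -(subnK de) => Py; symmetry; apply: Hle.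
pose dd n (y : Y n) := sval (cid (Pex y)).
have ddP n (y : Y n) : P (dd n y) y := svalP (cid (Pex y)).
pose f n (y : Y n) := sval (H (dd n y)) n (exist _ y (ddP n y)).
have fnat m n (a : mono m n) (y : Y n) : f m (restr a y) = restr a (f n y).
  by rewrite /f -app_nat /=; apply: HH.
exists {| app := f; app_nat := fnat |}; split=> [n y Py|n y] /=.
  exact: (HH 0).
exact: (svalP (H (dd n y))).1.
Qed.
End Filtration.

(** * Horn inclusions times boundary inclusions *)

Lemma mono_lt m n (s : mono m n) (i j : 'I_m.+1) :
  injective s -> i < j -> s i < s j.
Proof.
move=> s_inj ij; rewrite ltn_neqAle mfunP 1?ltnW // andbT.
by apply/eqP => /val_inj /s_inj e; rewrite e ltnn in ij.
Qed.

Lemma mono_inj_id n (s : mono n n) : injective s -> s = mid n.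
Proof.
move=> s_inj; apply: mono_eq => i; apply/val_inj => /=.
have lo k : forall i : 'I_n.+1, i = k :> nat -> k <= s i.
  elim: k => [//|k IH] r rk; have kn : k < n.+1 by rewrite ltnW // -rk.
  by apply: (leq_ltn_trans (IH (Ordinal kn) erefl)); apply: mono_lt; rewrite //= rk.
have up k : forall i : 'I_n.+1, n - i = k -> k <= n - s i.
  elim: k => [//|k IH] r rk; have kn : r.+1 < n.+1 by lia.
  have := IH (Ordinal kn) ltac:(move=> /=; lia).
  have := @mono_lt _ _ s r (Ordinal kn) s_inj (leqnn _).
  by have := ltn_ord (s (Ordinal kn)); lia.
by have := lo _ _ (erefl (i : nat)); have := up _ _ (erefl (n - i));
   have := ltn_ord i; have := ltn_ord (s i); lia.
Qed.

Lemma mono_surj_inj n (s : mono n n) : (forall j, exists i, s i = j) -> injective s.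
Proof.
move=> s_surj; have /imset_injP : #|[set s x | x in 'I_n.+1]| == #|'I_n.+1|.
  suff -> : [set s x | x in 'I_n.+1] = [set: 'I_n.+1] by rewrite cardsT.
  by apply/setP=> j; rewrite inE; apply/imsetP; case: (s_surj j) => i <-; exists i.
by move=> h x y; apply: h.
Qed.

Definition yoneda (Y : sset) n (y : Y n) : smap (simplex n) Y :=
  {| app := fun k (s : simplex n k) => restr s y;
     app_nat := fun k l (a : mono k l) (s : simplex n l) => restr_comp s a y |}.

Definition inner_fibration X S (q : smap X S) : Prop :=
  forall n (i : 'I_n.+1), 0 < i < n -> has_lifts (sub_incl (@horn_predP n i)) q.

Section Prism.
Variables (m n : nat) (j : 'I_n.+1).
Hypothesis jn : j < n.

Let T := ('I_m.+1 * 'I_n.+1)%type.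
Let D := sprod (simplex m) (simplex n).
Let j1 : 'I_n.+1 := Ordinal (jn : j.+1 < n.+1).

Let pr k (z : D k) (r : 'I_k.+1) : T := (z.1 r, z.2 r).
Let im k (z : D k) : {set T} := [set pr z r | r in 'I_k.+1].

Let le (x y : T) := (x.1 <= y.1) && (x.2 <= y.2).
Implicit Types c : {set T}.
Let chn c := forall x y, x \in c -> y \in c -> le x y || le y x.
(** A simplex of the prism is studied through its set of points, which is blind to degeneracies. The
    simplices outside the domain are those with a full set of points ([prism_domPn]): every column
    is met, and every row except possibly [j]. *)
Let full (c : {set T}) : Prop :=
  (forall a, exists b, (a, b) \in c) /\ (forall b, b != j -> exists a, (a, b) \in c).

Definition prism_dom k (z : D k) : Prop := bound_pred z.1 \/ horn_pred j z.2.

Lemma prism_domP l k (a : mono l k) (z : D k) :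
  prism_dom z -> prism_dom (restr a z).
Proof.
by case=> [/(bound_predP a)|/(horn_predP a)] h; [left | right].
Qed.

Let imP k (z : D k) x : reflect (exists r, x = pr z r) (x \in im z).
Proof.
apply: (iffP idP) => [/imsetP [r _ ->]|[r ->]]; [by exists r | exact: imset_f].
Qed.

Let prism_domPn k (z : D k) : ~ prism_dom z <-> full (im z).
Proof.
split=> [nz|[h1 h2] [[a ha]|[b bj hb]]].
- split=> [a|b bj].
    apply: contrapT => h; apply: nz; left; exists a => r; apply/eqP => e.
    by apply: h; exists (z.2 r); apply/imP; exists r; rewrite /pr e.
  apply: contrapT => h; apply: nz; right; exists b => // r; apply/eqP => e.
  by apply: h; exists (z.1 r); apply/imP; exists r; rewrite /pr e.
- by have [b /imP [r [e _]]] := h1 a; have := ha r; rewrite -e eqxx.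
- by have [a /imP [r [_ e]]] := h2 b bj; have := hb r; rewrite -e eqxx.
Qed.

Let chn_im k (z : D k) : chn (im z).
Proof.
move=> x y /imP [r ->] /imP [s ->]; rewrite /le /pr /=.
by case: (leqP r s) => [rs|/ltnW rs]; rewrite (mfunP z.1 rs) (mfunP z.2 rs) ?orbT.
Qed.

(* The least column in which the chain [c] meets the row [j.+1]; adding or
   removing the point just below is the involution by which the simplices of
   the prism are paired. *)
Let col (c : {set T}) : 'I_m.+1 :=
  odflt ord0 [pick a | ((a, j1) \in c) && [forall b, ((b, j1) \in c) ==> (a <= b)]].
Let pt c : T := (col c, j).
Let big c := pt c |: c.
(** The lexicographic order by size, then by decreasing column, is written as one number, since
    [m - col c <= m]. The size is that of [big c], so that both members of a pair have the same rank
    and are attached together. *)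
Let rank c := #|big c| * m.+1 + (m - col c).

Let j1j : j1 != j.
Proof. by apply/eqP => /(congr1 val) /= /eqP; rewrite eqn_leq ltnn. Qed.

Let colP c : full c ->
  (col c, j1) \in c /\ forall b, (b, j1) \in c -> col c <= b.
Proof.
move=> [_ /(_ j1 j1j) [a0 a0c]]; rewrite /col; case: pickP => [a /andP [ac /forallP h]|].
  by split=> // b; have /implyP := h b.
case: (@arg_minnP _ a0 (fun a => (a, j1) \in c) val a0c) => a ac amin /(_ a).
by rewrite ac /= => /forallP []; move=> b; apply/implyP/amin.
Qed.

Let colE c a : full c -> (a, j1) \in c -> (forall b, (b, j1) \in c -> a <= b) -> col c = a.
Proof.
move=> /colP [h1 h2] ac amin; apply/val_inj/eqP.
by rewrite eqn_leq h2 // amin.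
Qed.

Let full_sub c c' : full c -> c \subset c' -> full c'.
Proof.
move=> [h1 h2] /subsetP cc'; split=> [a|b /h2 [a ab]]; last by exists a; apply: cc'.
by have [b ab] := h1 a; exists b; apply: cc'.
Qed.

Let col_big c : full c -> col (big c) = col c.
Proof.
move=> fc; have [h1 h2] := colP fc; apply: colE.
- exact: full_sub fc (subsetUr _ _).
- by rewrite in_setU1 h1 orbT.
- by move=> b; rewrite in_setU1 xpair_eqE (negPf j1j) andbF /=; apply: h2.
Qed.

Let big_big c : full c -> big (big c) = big c.
Proof. by move=> fc; rewrite {1}/big /pt col_big // /big setUA setUid. Qed.

Let rank_big c : full c -> rank (big c) = rank c.
Proof. by move=> fc; rewrite /rank big_big // col_big. Qed.

Let chn_big c : full c -> chn c -> chn (big c).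
Proof.
move=> fc cc; have [h1 h2] := colP fc.
have key x : x \in c -> le x (pt c) || le (pt c) x.
  move=> xc; have := cc _ _ xc h1; rewrite /le /pt /=.
  case: x xc => [x1 x2] /= xc; case: (leqP x2 j) => xj.
    by rewrite andbF orbF => /andP [-> _].
  rewrite andbF /= (ltnW xj) !andbT => /orP [/andP [_ h]|//].
  by apply: h2; rewrite (_ : j1 = x2) //; apply/val_inj => /=; lia.
move=> x y /setU1P [->|xc] /setU1P [->|yc]; first by rewrite /le !leqnn.
- by rewrite orbC; apply: key.
- exact: key.
- exact: cc.
Qed.

Let pt_big c : big c = c -> pt c \in c.
Proof. by move=> bc; rewrite -{2}bc setU11. Qed.

(** Without [pt c] a chain is still full: the column of [pt c] contains the point in row [j.+1], and
    row [j] need not be met. *)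
Let full_top c c' : full c -> big c = c -> c :\ pt c \subset c' -> full c'.
Proof.
move=> fc bc; apply: full_sub; have [h1 h2] := colP fc; case: (fc) => f1 f2; split.
  move=> a; have [b ab] := f1 a; case: (eqVneq (a, b) (pt c)) => [[-> _]|ne].
    by exists j1; rewrite in_setD1 h1 andbT xpair_eqE negb_and j1j orbT.
  by exists b; rewrite in_setD1 ab ne.
move=> b bj; have [a ab] := f2 b bj; exists a.
by rewrite in_setD1 ab andbT xpair_eqE negb_and bj orbT.
Qed.

Let big_top c c' : full c -> big c = c -> c :\ pt c \subset c' -> c' \subset c ->
  big c' = c.
Proof.
move=> fc bc h /subsetP hc; have fc' := full_top fc bc h; have [h1 h2] := colP fc.
have e : col c' = col c.
  apply: colE => // [|b /hc]; last exact: h2.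
  by apply: (subsetP h); rewrite in_setD1 h1 andbT xpair_eqE negb_and j1j orbT.
apply/setP => x; rewrite /big in_setU1 /pt e -/(pt c).
apply/orP/idP => [[/eqP ->|/hc//]|xc]; first exact: pt_big.
case: (eqVneq x (pt c)) => [|ne]; first by left.
by right; apply: (subsetP h); rewrite in_setD1 ne.
Qed.

(** Some point other than [pt c] is missing in [c']. If [c'] still contains [(col c, j1)], the
    columns agree and [big c'] is a proper subset of [c]. Otherwise the column increases, while
    [big c'] has at most one point more than [c'], hence at most as many as [c]. *)
Let rank_lt c c' : full c -> big c = c -> full c' -> c' \subset c ->
  ~~ (c :\ pt c \subset c') -> rank c' < rank c.
Proof.
move=> fc bc fc' c'c /subsetPn [x]; rewrite in_setD1 => /andP [xpt xc] xc'.
have [h1 h2] := colP fc; have [h1' h2'] := colP fc'.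
have lecol : col c <= col c' by apply: h2; apply: (subsetP c'c).
have lt1 : #|c'| < #|c|.
  by apply: proper_card; rewrite properE c'c; apply/subsetPn; exists x.
have ltm := ltn_ord (col c'); rewrite /rank bc.
case: (boolP ((col c, j1) \in c')) => [inc'|ninc'].
  have e : col c' = col c by apply/val_inj/eqP; rewrite eqn_leq lecol h2'.
  have : big c' \proper c.
    rewrite properE; apply/andP; split.
      by apply/subsetP => y /setU1P [->|/(subsetP c'c)//]; rewrite /pt e; apply: pt_big.
    by apply/subsetPn; exists x => //; rewrite in_setU1 negb_or xc' andbT /pt e.
  by move=> /proper_card lt2; rewrite e ltn_add2r ltn_pmul2r.
have lt3 : col c < col c'.
  rewrite ltn_neqAle lecol andbT; apply/eqP => /val_inj e.
  by rewrite e h1' in ninc'.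
apply: leq_ltn_trans (_ : #|c| * m.+1 + (m - col c') < _).
  by rewrite leq_add2r leq_mul2r /big cardsU1 (leq_trans _ lt1) ?orbT //; case: (_ \notin _).
by rewrite ltn_add2l ltn_sub2l // (leq_trans lt3).
Qed.

Let rank_le c c' : full c -> full c' -> c' \subset c -> rank c' <= rank c.
Proof.
move=> fc fc' c'c; have fb : full (big c) by apply: full_sub fc (subsetUr _ _).
have bb := big_big fc.
have c'b : c' \subset big c by apply: subset_trans c'c (subsetUr _ _).
rewrite -(rank_big fc).
case: (boolP (big c :\ pt (big c) \subset c')) => h; last exact/ltnW/rank_lt.
by rewrite -(big_top fb bb h c'b) rank_big.
Qed.

Let pr_inj k (z : D k) := injective (pr z).

Let chn_le (c : {set T}) x y : chn c -> x \in c -> y \in c ->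
  x.1 + x.2 <= y.1 + y.2 -> le x y.
Proof.
move=> cc xc yc h; case/orP: (cc _ _ xc yc) => // /andP [h1 h2].
move: h h1 h2; case: x y {xc yc} => [[x1 ?] [x2 ?]] [[y1 ?] [y2 ?]]; rewrite /le /=.
by lia.
Qed.

(** On a chain the product order is the order by the sum of the coordinates ([chn_le]), so sorting
    by this sum lists the points as the vertices of a nondegenerate simplex. *)
Let chain_enum (c : {set T}) : chn c -> c != set0 ->
  exists d (y : D d), pr_inj y /\ im y = c.
Proof.
move=> cc /set0Pn [x0 x0c].
pose w (x y : T) := x.1 + x.2 <= y.1 + y.2.
pose s := sort w (enum c).
have w_total : total w by move=> x y; apply: leq_total.
have w_trans : transitive w by move=> y x z; apply: leq_trans.
have s_in x : x \in s = (x \in c) by rewrite mem_sort mem_enum.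
have s_uniq : uniq s by rewrite sort_uniq enum_uniq.
have s_sorted : sorted w s by apply: sort_sorted.
have s_pos : 0 < size s by case: (s) (s_in x0) => //=; rewrite x0c.
case E: (size s) => [|d]; first by rewrite E in s_pos.
have wle (r r' : 'I_d.+1) : r <= r' -> le (nth x0 s r) (nth x0 s r').
  move=> rr'; apply: (@chn_le c); rewrite -?s_in ?mem_nth ?E //.
  apply: (sorted_leq_nth w_trans _ x0 s_sorted) => //; rewrite ?inE ?E //.
  by move=> x; apply: leqnn.
have mon1 (r r' : 'I_d.+1) : r <= r' -> (nth x0 s r).1 <= (nth x0 s r').1.
  by move=> /wle /andP [].
have mon2 (r r' : 'I_d.+1) : r <= r' -> (nth x0 s r).2 <= (nth x0 s r').2.
  by move=> /wle /andP [].
pose y : D d := (Mono mon1, Mono mon2).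
have yE r : pr y r = nth x0 s r by rewrite /pr /= -surjective_pairing.
exists d, y; split=> [r r'|].
  rewrite !yE => /eqP; rewrite nth_uniq ?E // => /eqP e; exact: val_inj.
apply/setP => x; rewrite -s_in; apply/imP/idP => [[r ->]|xs].
  by rewrite yE mem_nth ?E.
have xi : index x s < d.+1 by rewrite -E index_mem.
by exists (Ordinal xi); rewrite yE /= nth_index.
Qed.

Let factor d (y : D d) k (z : D k) : pr_inj y -> im z \subset im y ->
  exists s : mono k d, z = restr s y.
Proof.
move=> yi /subsetP zy.
have ex r : exists r', pr z r = pr y r' by apply/imP/zy/imP; exists r.
have [s sP] := choice ex.
have mon (r r' : 'I_k.+1) : r <= r' -> s r <= s r'.
  move=> rr'; rewrite leqNgt; apply/negP => lt.
  have e : pr y (s r) = pr y (s r').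
    rewrite -!sP; have [] := sP r; have [] := sP r'; rewrite /pr => e1 e2 e3 e4.
    congr pair; apply/val_inj/eqP; rewrite eqn_leq mfunP //=.
      by rewrite e1 e3 mfunP // ltnW.
    by rewrite e2 e4 mfunP // ltnW.
  by rewrite (yi _ _ e) ltnn in lt.
exists (Mono mon); case: z sP {zy ex} => z1 z2 sP; rewrite /pr /= in sP.
by congr pair; apply: mono_eq => r /=; case: (sP r).
Qed.

Let restr_pr_inj d (y : D d) k (s s' : mono k d) :
  pr_inj y -> restr s y = restr s' y -> s = s'.
Proof.
move=> yi e; apply: mono_eq => r; apply: yi.
by have := congr1 (fun z : D k => pr z r) e.
Qed.

Let cell_eq d (y : D d) d' (y' : D d') : pr_inj y -> pr_inj y' -> im y = im y' ->
  existT (fun d => D d) d y = existT (fun d => D d) d' y'.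
Proof.
move=> yi yi' e.
have : d.+1 = d'.+1.
  by rewrite -[LHS]card_ord -[RHS]card_ord -(card_imset _ yi) -(card_imset _ yi') -/(im y) e.
case=> dd; subst d'; have [|s E] := @factor _ y _ y' yi; first by rewrite e.
suff -> : y' = y by [].
rewrite E (@mono_inj_id _ s) ?restr_id // => r r' ss.
by apply: yi'; rewrite E /pr /= ss.
Qed.

Let im_restr k l (a : mono l k) (z : D k) : im (restr a z) \subset im z.
Proof. by apply/subsetP => x /imP [r ->]; apply/imP; exists (a r). Qed.

Let P t k (z : D k) := prism_dom z \/ rank (im z) < t.

Let PP t l k (a : mono l k) (z : D k) : P t z -> P t (restr a z).
Proof.
case=> [/(prism_domP a)|lt]; first by left.
case: (pselect (prism_dom (restr a z))) => [|nz]; first by left.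
right; apply: leq_ltn_trans lt; have fa := (prism_domPn _).1 nz.
by apply: rank_le; rewrite // ?im_restr //; apply: full_sub fa (im_restr _ _).
Qed.

Variables (X S : sset) (q : smap X S).
Hypothesis q_inner : inner_fibration q.
Variables (u : smap (sub_sset prism_domP) X) (v : smap D S).
Hypothesis uv : forall k z, q k (u k z) = v k (sval z).
(* If [j = 0], the simplex [Delta^0 x Delta^{0, 1}] at the vertex 0 is the
   initial edge of the outer horns to be filled. *)
Hypothesis u0 : j = 0 :> nat -> 1 < n /\ forall z : sub_sset prism_domP 1,
  (sval z).1 = mconst 1 ord0 -> (sval z).2 ord0 = ord0 ->
  (sval z).2 ord_max = 1 :> nat -> cocartesian q (u 1 z).

Let cell t := {d & {y : D d | [/\ pr_inj y, full (im y), big (im y) = im y &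
                                 rank (im y) = t]}}.

(** The faces of [y] that omit a point other than [pt] lie in the domain or have smaller rank, while
    the face opposite [pt] is paired with [y] itself. What is present before [y] is attached is
    therefore exactly a horn, at the position [l] of [pt]. *)
Let restr_dom d (y : D d) (l : 'I_d.+1) t k (s : mono k d) :
  pr_inj y -> full (im y) -> big (im y) = im y -> rank (im y) = t ->
  pr y l = pt (im y) -> P t (restr s y) <-> horn_pred l s.
Proof.
move=> yi fy by_ ry yl.
have top : ~ horn_pred l s -> im y :\ pt (im y) \subset im (restr s y).
  move=> nh; apply/subsetP => x; rewrite in_setD1 => /andP [ne /imP [r xr]].
  apply: contrapT => nx; apply: nh; exists r.
    by apply: contraNneq ne => rl; rewrite xr rl yl.
  by move=> i; apply/eqP => e; apply: nx; apply/imP; exists i; rewrite xr -e.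
split=> [Ps|[r rl rs]].
  apply: contrapT => /top h; have bt := big_top fy by_ h (im_restr _ _).
  have ft := full_top fy by_ h.
  case: Ps => [|]; first exact/prism_domPn.
  by rewrite -{}ry -[X in _ < rank X]bt rank_big // ltnn.
case: (pselect (prism_dom (restr s y))) => [|/prism_domPn nd]; first by left.
right; rewrite -ry; apply: (rank_lt fy by_ nd (im_restr s y)).
apply/subsetPn; exists (pr y r); last first.
  by apply/imP => -[i /yi e]; have := rs i; rewrite e eqxx.
by rewrite in_setD1 -yl (inj_eq yi) rl; apply/imP; exists r.
Qed.

Let edge_horn : 1 < n -> j = 0 :> nat -> forall k (z : D k),
  (forall r, z.2 r <= 1) -> prism_dom z.
Proof.
move=> n1 j0 k z h; right; have n2 : 2 < n.+1 by [].
exists (Ordinal n2) => [|r]; first by rewrite -val_eqE /= j0.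
by rewrite -val_eqE /= neq_ltn (leq_ltn_trans (h r)).
Qed.

(** The position [l] of [pt] precedes that of the point above it, so it is not the last one, and the
    horn is inner unless [l = 0]. In that case [pt] is the least point, hence [(0, 0)], and the horn
    starts with the edge from [(0, 0)] to [(0, 1)], to which [u0] applies. *)
Let fill t (h : smap (sub_sset (PP (t := t))) X) (i : cell t) :
  (forall k z, q k (h k z) = v k (sval z)) ->
  (forall k (z : D k) (z0 : prism_dom z) (zd : P t z),
     h k (exist _ z zd) = u k (exist _ z z0)) ->
  exists g : smap (simplex (projT1 i)) X,
  (forall k s (Ps : P t (yoneda (sval (projT2 i)) k s)),
     g k s = h k (exist _ _ Ps)) /\
  (forall k s, q k (g k s) = v k (yoneda (sval (projT2 i)) k s)).
Proof.
case: i => d [y [yi fy by_ ry]] /= hv hu.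
have /imP [l /esym yl] : pt (im y) \in im y by rewrite -{2}by_ setU11.
have dom k s := @restr_dom d y l t k s yi fy by_ ry yl.
have [w wE] : exists w : smap (horn l) (sub_sset (PP (t := t))),
    forall k s, sval (w k s) = restr (sval s) y.
  unshelve refine (ex_intro _ {| app := fun k (s : horn l k) =>
    exist _ (restr (sval s) y) ((dom k (sval s)).2 (svalP s)) : sub_sset (PP (t := t)) k |} _) => //.
  by move=> k k' a s; apply: sub_eq.
suff [g [g1 g2]] : exists g : smap (simplex d) X,
    (forall k s, g k (sval s) = scomp h w k s) /\
    (forall k s, q k (g k s) = scomp v (yoneda y) k s).
  exists g; split=> // k s Ps; have hs := (dom k s).1 Ps.
  by rewrite (g1 k (exist _ s hs)) /=; congr (h k _); apply: sub_eq; rewrite wE.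
have [c1 c2] := colP fy.
have /imP [l1 l1E] := c1.
have ll1 : l < l1.
  rewrite ltnNge; apply/negP => /(mfunP y.2); move: yl l1E => [_ ->] [_ <-] /=.
  by rewrite ltnn.
have ld : l < d by apply: leq_trans ll1 _; rewrite -ltnS.
have hwv k s : q k (scomp h w k s) = scomp v (yoneda y) k (sval s).
  by rewrite /= hv wE.
case: (posnP l) => [l0|lpos]; last first.
  by apply: (q_inner (i := l)); rewrite ?lpos.
have y0le x : x \in im y -> le (pt (im y)) x.
  by move=> /imP [r ->]; rewrite -yl /le /pr /= !mfunP // l0.
have col0 : col (im y) = ord0.
  have [b /y0le /andP [/= h1 _]] := fy.1 ord0; apply/val_inj/eqP => /=.
  by rewrite -leqn0.
have j0 : j = 0 :> nat.
  apply/eqP/negPn/negP => jne; have [|a /y0le /andP [_ /=]] := fy.2 ord0.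
    by rewrite -val_eqE /= eq_sym.
  by rewrite leqn0 (negPf jne).
have [n1 uc] := u0 j0.
have n2 : 2 < n.+1 by [].
(* Since [1 < n], row 2 is met as well; thus [d >= 2], and the horn contains its initial edge. *)
have [|a2 /imP [l2 l2E]] := fy.2 (Ordinal n2); first by rewrite -val_eqE /= j0.
have l12 : l1 < l2.
  rewrite ltnNge; apply/negP => /(mfunP y.2); move: l2E l1E => [_ <-] [_ <-] /=.
  by rewrite j0.
have d2 : 1 < d by have := ltn_ord l2; lia.
(* A vertex strictly between [(0, 0)] and [(0, 1)] would coincide with one of them. *)
have {ld} l10 : l1 = 1 :> nat.
  apply/eqP/negPn/negP => ne1; have o1 : 1 < d.+1 by lia.
  have a1 : Ordinal o1 <= l1 by rewrite /=; lia.
  have a0 : l <= Ordinal o1 by rewrite l0.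
  have [yl1 yl2] := yl; have [yl3 yl4] := l1E.
  have h1 : y.1 (Ordinal o1) = 0 :> nat.
    by apply/eqP; rewrite -leqn0 (leq_trans (mfunP y.1 a1)) // -yl3 col0.
  have h2 : y.2 (Ordinal o1) <= 1.
    by rewrite (leq_trans (mfunP y.2 a1)) // -yl4 /= j0.
  have [e|e] : y.2 (Ordinal o1) = 0 :> nat \/ y.2 (Ordinal o1) = 1 :> nat.
    by case: (nat_of_ord (y.2 _)) h2 => [|[|]]; [left | right |].
    have /yi /(congr1 val) /= : pr y (Ordinal o1) = pr y l; last by rewrite l0.
    by rewrite yl /pt col0; congr pair; apply/val_inj => //=; rewrite e j0.
  have /yi /(congr1 val) /= : pr y (Ordinal o1) = pr y l1; last by lia.
  by rewrite -l1E col0; congr pair; apply/val_inj => //=; rewrite e j0.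
case: d y yi fy by_ ry l yl dom w wE hwv c1 c2 l1 l1E ll1 l0 y0le col0 n2 a2 l2 l2E l12 d2 l10
  => [//|[//|d]] y yi fy by_ ry l yl dom w wE hwv c1 c2 l1 l1E ll1 l0 y0le col0 n2 a2 l2 l2E l12 d2 l10.
have ll : l = ord0 by apply/val_inj.
subst l; have l1o : l1 = lift ord0 ord0 by apply/val_inj.
have [yl1 yl2] := yl; have [yl3 yl4] := l1E.
have o0 : edge_fun (ord0 : 'I_d.+3) (lift ord0 ord0) ord0 = ord0 by [].
have o1 : edge_fun (ord0 : 'I_d.+3) (lift ord0 ord0) ord_max = l1 by rewrite l1o.
have ol r : edge_fun (ord0 : 'I_d.+3) (lift ord0 ord0) r <= l1.
  by rewrite l1o; case: r => [[|r] ?].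
pose z : D 1 := restr (@medge d.+2 ord0 (lift ord0 ord0) (leq0n _)) y.
have z2 r : z.2 r <= 1.
  by apply: (leq_trans (mfunP y.2 (ol r))); rewrite -yl4 /= j0.
have zd := edge_horn n1 j0 z2.
apply: (uc (exist _ z zd) _ _ _ _ _ _ hwv) => [|||s sE].
- apply: mono_eq => r; apply/val_inj/eqP; rewrite -leqn0.
  by apply: (leq_trans (mfunP y.1 (ol r))); rewrite -yl3 col0.
- by apply/val_inj; rewrite /= o0 yl2 j0.
- by rewrite /= o1 -yl4 /= j0.
rewrite /= -(hu _ z zd (or_introl zd)); congr (h 1 _); apply: sub_eq.
by rewrite wE sE.
Qed.

Lemma prism_lift : exists h : smap D X,
  (forall k (z : D k) (z0 : prism_dom z), h k z = u k (exist _ z z0)) /\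
  (forall k z, q k (h k z) = v k z).
Proof.
have P0 k (z : D k) : P 0 z -> prism_dom z by case.
have [w wE] : exists w : smap (sub_sset (PP (t := 0))) (sub_sset prism_domP),
    forall k s, sval (w k s) = sval s.
  unshelve refine (ex_intro _ {| app := fun k (s : sub_sset (PP (t := 0)) k) =>
    exist _ (sval s) (P0 k _ (svalP s)) : sub_sset prism_domP k |} _) => //.
  by move=> k k' a s; apply: sub_eq.
have [|k z|k z|t h [hv hu]|h [h1 h2]] := @filtration D X S q v P PP _ _ (scomp u w).
- by move=> t k z [|lt]; [left | right; apply: ltnW].
- by exists (rank (im z)).+1; right.
- by rewrite /= uv wE.
- have {}hu k (z : D k) (z0 : prism_dom z) (zd : P t z) :
      h k (exist _ z zd) = u k (exist _ z z0).
    rewrite (hu _ _ (or_introl z0)) /=; congr (u k _); apply: sub_eq.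
    by rewrite wE.
  apply: (@adjoin D X S q v _ _ _ (@PP t.+1) h hv (cell t)
    (fun i => simplex (projT1 i)) (fun i => yoneda (sval (projT2 i)))).
  + move=> [d [y yc]] [d' [y' yc']] k /= s s' ns e.
    have [yi fy by_ ry] := yc; have [yi' fy' by' ry'] := yc'.
    (* A restriction of [x] outside [P t] contains every point of [x] except possibly [pt], so [big]
       recovers the points of [x]. Hence a new cell belongs to one attached simplex only. *)
    have key e1 (x : D e1) (a : mono k e1) : full (im x) -> big (im x) = im x ->
        rank (im x) = t -> ~ P t (restr a x) -> big (im (restr a x)) = im x.
      move=> fx bx rx na; apply: (big_top fx bx _ (im_restr a x)).
      apply: contrapT => /negP nsub; apply: na.
      case: (pselect (prism_dom (restr a x))) => [|/prism_domPn nd]; first by left.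
      by right; rewrite -rx; apply: (rank_lt fx bx nd (im_restr a x)).
    have {}e : restr s y = restr s' y' := e.
    have imE : im y = im y'.
      by rewrite -(key _ y s fy by_ ry ns) e (key _ y' s' fy' by' ry') // -e.
    have E := cell_eq yi yi' imE.
    have dd : d = d' by exact: (congr1 (fun w => projT1 w) E).
    subst d'; have {}E := Eqdep_dec.inj_pair2_eq_dec _ PeanoNat.Nat.eq_dec _ _ _ _ E.
    move: e yc'; rewrite -E => /(restr_pr_inj yi) -> yc'.
    by rewrite (Prop_irrelevance yc yc').
  + by move=> i; apply: fill.
  + move=> k z [z0|]; first by left; left.
    case: (pselect (prism_dom z)) => [z0|/prism_domPn fz]; first by left; left.
    rewrite ltnS leq_eqVlt => /orP [/eqP rz|]; last by left; right.
    (* A cell of rank [t] factors through the simplex spanned by [big] of its points, which has the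
       same rank. *)
    right; have fb : full (big (im z)) by apply: full_sub fz (subsetUr _ _).
    have [|d [y [yi yE]]] := chain_enum (chn_big fz (chn_im (z := z))).
      by apply/set0Pn; exists (pt (im z)); apply: setU11.
    have [|s sE] := @factor _ y _ z yi; first by rewrite yE subsetUr.
    have yc : [/\ pr_inj y, full (im y), big (im y) = im y & rank (im y) = t].
      by rewrite yE big_big // rank_big.
    by exists (existT _ d (exist _ y yc)), s.
exists h; split=> // k z z0; rewrite (h1 _ _ (or_introl z0)) /=.
by congr (u k _); apply: sub_eq; rewrite wE.
Qed.
End Prism.

(** * Function complexes of inner fibrations *)

Lemma mono_factor n k (a : mono k n.+1) (i : 'I_n.+2) :
  (forall t, a t != i) -> exists b : mono k n, a = mcomp (mface i) b.
Proof.
move=> ai; have ex t : exists r, lift i r = a t.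
  have := ai t; rewrite eq_sym => /unlift_some [r -> _]; by exists r.
have [b bP] := choice ex.
have mon (t t' : 'I_k.+1) : t <= t' -> b t <= b t'.
  by move=> /(mfunP a); rewrite -!bP leq_bump2.
by exists (Mono mon); apply: mono_eq => t /=; rewrite bP.
Qed.

(** * Skeleta and nondegenerate simplices *)

Section Skeleton.
Variable K : sset.

(** For [k = d], the negation says that [x] is nondegenerate. *)
Definition skel d k (x : K k) : Prop :=
  exists e (y : K e) (s : mono k e), e < d /\ x = restr s y.

Lemma skelP d l k (a : mono l k) (x : K k) : skel d x -> skel d (restr a x).
Proof.
move=> [e [y [s [ed ->]]]]; exists e, y, (mcomp s a).
by rewrite restr_comp.
Qed.

Lemma skel_missing d (x : K d) k (a : mono k d) i :
  (forall t, a t != i) -> skel d (restr a x).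
Proof.
case: d x a i => [|d] x a i ai.
  by have := ai ord0; rewrite (ord1 i) (ord1 (a _)) eqxx.
have [b ->] := mono_factor ai; exists d, (restr (mface i) x), b.
by rewrite restr_comp.
Qed.

(** The value of the section at [a r] is prescribed: with a section through each [r] in turn, two
    surjections can be compared one vertex at a time. *)
Lemma mono_section d k (a : mono k d) (r : 'I_k.+1) :
  (forall i, exists t, a t = i) ->
  exists2 b : mono d k, mcomp a b = mid d & b (a r) = r.
Proof.
move=> a_surj.
have ex i : exists t, a t = i /\ (i = a r -> t = r).
  case: (eqVneq i (a r)) => [->|ne]; first by exists r.
  by have [t ti] := a_surj i; exists t; split=> // e; rewrite e eqxx in ne.
have [b bP] := choice ex.
have mon (i i' : 'I_d.+1) : i <= i' -> b i <= b i'.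
  move=> ii'; rewrite leqNgt; apply/negP => lt; have := mfunP a (ltnW lt).
  rewrite (bP i).1 (bP i').1 => i'i.
  have e : i = i' by apply/val_inj/eqP; rewrite eqn_leq ii'.
  by rewrite e ltnn in lt.
exists (Mono mon); last exact: (bP (a r)).2.
by apply: mono_eq => i /=; rewrite (bP i).1.
Qed.

Lemma skel_surj d (x : K d) k (a : mono k d) :
  ~ skel d (restr a x) -> forall i, exists t, a t = i.
Proof.
move=> nsk i; apply: contrapT => h; apply: nsk; apply: (@skel_missing _ _ _ _ i) => t.
by apply/eqP => e; apply: h; exists t.
Qed.

(* The uniqueness part of the Eilenberg-Zilber lemma. *)
Lemma nondegenerate_unique d (x y : K d) k (a b : mono k d) :
  ~ skel d x -> ~ skel d (restr a x) -> restr a x = restr b y -> x = y /\ a = b.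
Proof.
move=> nx nax e; have a_surj := skel_surj nax.
have key r : mcomp a (mid k) r = b r /\ x = y.
  have [c ac cr] := mono_section r a_surj.
  have xE : x = restr (mcomp b c) y by rewrite restr_comp -e -restr_comp ac restr_id.
  (* The nondegenerate [x] is the restriction of [y] along [mcomp b c], which is therefore
     surjective, hence the identity. *)
  have bc : mcomp b c = mid d.
    by apply/mono_inj_id/mono_surj_inj/(@skel_surj _ y); rewrite -xE.
  split; last by rewrite xE bc restr_id.
  have := congr1 (fun f : mono d d => f (a r)) bc.
  by rewrite /= cr.
by split; [apply: (key ord0).2 | apply: mono_eq => r; apply: (key r).1].
Qed.
End Skeleton.

Definition sfun_post K X S (q : smap X S) : smap (sfun K X) (sfun K S).
Proof.
refine {| app := fun n (h : sfun K X n) => (scomp q h : sfun K S n) |}.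
by move=> m n a h; apply: smap_eq.
Defined.

(** * Horns in function complexes *)

Section RelativeHorn.
Variables (K X S : sset) (q : smap X S) (n : nat) (j : 'I_n.+1).
Hypothesis (jn : j < n) (q_inner : inner_fibration q).
Variables (u : smap (horn j) (sfun K X)) (v : smap (simplex n) (sfun K S)).
Hypothesis uv : forall m s, sfun_post K q m (u m s) = v m (sval s).
Hypothesis u0 : j = 0 :> nat -> 1 < n /\ forall s : horn j 1,
  sval s ord0 = ord0 -> sval s ord_max = 1 :> nat ->
  forall x, cocartesian q (component (u 1 s) x).

Let Y := sprod K (simplex n).
Let P d k (z : Y k) := skel d z.1 \/ horn_pred j z.2.

Let PP d l k (a : mono l k) (z : Y k) : P d z -> P d (restr a z).
Proof. by case=> [/(skelP a)|/(horn_predP a)]; [left | right]. Qed.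

Let P0 k (z : Y k) : P 0 z -> horn_pred j z.2.
Proof. by case=> // -[e [y [s []]]]. Qed.

Let w : smap (sub_sset (PP (d := 0))) X.
Proof.
refine {| app := fun k (z : sub_sset (PP (d := 0)) k) =>
  u k (exist _ (sval z).2 (P0 (svalP z))) k ((sval z).1, mid k) |}.
move=> l k a z; rewrite -app_nat.
set s := exist _ _ _; set t := exist _ _ _.
by have -> : s = @restr (horn j) _ _ a t; [exact: sub_eq | rewrite app_nat].
Defined.

Let v' : smap Y S.
Proof.
refine {| app := fun k (z : Y k) => v k z.2 k (z.1, mid k) |}.
by move=> l k a z; rewrite -app_nat (app_nat v a z.2).
Defined.

Let wv k z : q k (w k z) = v' k (sval z).
Proof. by rewrite /= -(uv (exist _ _ (P0 (svalP z)))). Qed.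

(** One prism is attached for each nondegenerate [d]-simplex [x] of [K]. Pulled back along [x], the
    part already treated becomes [prism_dom], because a restriction of [x] along a surjection does
    not satisfy [skel d]. *)
Let step d (h : smap (sub_sset (PP (d := d))) X) :
  (forall k z, q k (h k z) = v' k (sval z)) /\
  (forall k (z : Y k) (z0 : P 0 z) (zd : P d z),
     h k (exist _ z zd) = w k (exist _ z z0)) ->
  exists h' : smap (sub_sset (PP (d := d.+1))) X,
  (forall k (z : Y k) (zd : P d z) (zd' : P d.+1 z),
     h' k (exist _ z zd') = h k (exist _ z zd)) /\
  (forall k z, q k (h' k z) = v' k (sval z)).
Proof.
case=> hv hw.
pose D := sprod (simplex d) (simplex n).
pose phi (i : {x : K d | ~ skel d x}) : smap D Y :=
  sprod_map (yoneda (sval i)) (sid (simplex n)).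
apply: (@adjoin Y X S q v' _ _ _ (@PP d.+1) h hv {x : K d | ~ skel d x}
  (fun i => D) phi).
- move=> [x nx] [x' nx'] k [a b] [a' b'] /= nP [e <-].
  have [|xx aa] := nondegenerate_unique nx _ e; first by move=> h'; apply: nP; left.
  move: nx' {nP e}; rewrite -xx -aa => nx'.
  by rewrite (Prop_irrelevance nx nx').
- move=> [x nx]; rewrite /phi /=.
  have dom k (z : D k) : P d (phi (exist _ x nx) k z) <-> prism_dom j z.
    split=> [[sk|]|[[i hi]|]]; [left|by right|left|by right].
      apply: contrapT => nb; apply: (nx).
      have a_surj i : exists t, z.1 t = i.
        apply: contrapT => h'; apply: nb; exists i => t; apply/eqP => e.
        by apply: h'; exists t.
      have [c ac _] := mono_section ord0 a_surj.
      by rewrite -[x]restr_id -ac restr_comp; apply: skelP.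
    exact: skel_missing hi.
  have [g gE] : exists g : smap (sub_sset (@prism_domP d n j)) (sub_sset (PP (d := d))),
      forall k z, sval (g k z) = phi (exist _ x nx) k (sval z).
    unshelve refine (ex_intro _ {| app := fun k (z : sub_sset (@prism_domP d n j) k) =>
      exist _ (phi (exist _ x nx) k (sval z)) ((dom k (sval z)).2 (svalP z))
        : sub_sset (PP (d := d)) k |} _) => //.
    by move=> k k' a s; apply: sub_eq; rewrite /= restr_comp.
  have [||f [f1 f2]] := @prism_lift d n j jn X S q q_inner (scomp h g)
    (scomp v' (phi (exist _ x nx))).
  + by move=> k z; rewrite /= hv gE.
  (* The initial edge of the outer horns over [x] is a component, at the first vertex of [x], of an
     edge in the image of [u]. *)
  + move=> j0; have [n1 uc] := u0 j0; split=> // z z1 z20 z21.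
    have z2h : horn_pred j (sval z).2.
      have n2 : 2 < n.+1 by [].
      exists (Ordinal n2) => [|r]; first by rewrite -val_eqE /= j0.
      rewrite -val_eqE /= neq_ltn (leq_ltn_trans (mfunP _ (leq_ord r : r <= ord_max))) //.
      by rewrite z21.
    have := uc (exist _ _ z2h) z20 z21 (restr (mconst 0 ord0) x).
    congr (cocartesian q _); rewrite /component /degen -restr_comp mcomp_const.
    rewrite /=; have zE := gE 1 z; move: (g 1 z) zE => [g1 g1P] /= zE.
    move: g1P; rewrite zE => g1P; rewrite (hw _ (restr (sval z).1 x, (sval z).2) (or_intror z2h)) /= z1.
    by congr (u 1 _ 1 _); apply: sub_eq.
  exists f; split=> k z; last exact: f2.
  move=> zd; rewrite (f1 _ _ ((dom k z).1 zd)) /=; congr (h k _).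
  by apply: sub_eq; rewrite gE.
- move=> k [x s] [[e [y [a [ed xE]]]]|]; last by left; right.
  rewrite /= in xE; move: ed; rewrite ltnS leq_eqVlt => /orP [/eqP ed|ed].
    subst e; case: (pselect (skel d y)) => [sk|nsk].
      by left; left; rewrite /= xE; apply: skelP.
    by right; exists (exist _ y nsk), (a, s); rewrite xE.
  by left; left; exists e, y, a.
Qed.

(** Maps into [sfun K X] are maps out of products with [K], so the problem becomes to lift along the
    inclusion of K x Lambda^n_j in K x Delta^n, which is done by induction on the skeleta of [K]. *)
Lemma relative_horn_lift : exists h : smap (simplex n) (sfun K X),
  (forall m (s : horn j m), h m (sval s) = u m s) /\
  (forall m s, sfun_post K q m (h m s) = v m s).
Proof.
have [|k z|h [h1 h2]] := @filtration Y X S q v' P PP _ _ w wv step.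
- move=> d k z [[e [y [s [ed zE]]]]|]; [left | by right].
  by exists e, y, s; rewrite ltnW.
- by exists k.+1; left; exists k, z.1, (mid k); rewrite restr_id.
unshelve eexists {| app := fun m (s : simplex n m) =>
    scomp h (sprod_map (sid K) (yoneda (Y := simplex n) s)) : sfun K X m |}.
  by move=> l m a s; apply: smap_eq => k x.
split=> m s; apply: smap_eq => k [x a] /=.
  have sa : horn_pred j (mcomp (sval s) a) by apply: (horn_predP a (svalP s)).
  rewrite (h1 k (x, mcomp (sval s) a) (or_intror sa)) /=.
  set t := exist _ _ _; have -> : t = @restr (horn j) _ _ a s.
    exact: (@sub_eq (simplex n) _ (@horn_predP n j)).

  by rewrite app_nat.
by rewrite h2 /= app_nat.
Qed.
End RelativeHorn.

Lemma sfun_inner K X S (q : smap X S) :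
  inner_fibration q -> inner_fibration (sfun_post K q).
Proof.
move=> q_inner n j /andP [j0 jn] u v uv; apply: relative_horn_lift => //.
by move=> jz; rewrite jz in j0.
Qed.

(** The horn sends the edge {0, 1} to [e], and the outer horns over a simplex of [K] involve only
    the component of [e] at the first vertex of that simplex. *)
Lemma sfun_cocartesian K X S (q : smap X S) (e : sfun K X 1) :
  inner_fibration q -> (forall x, cocartesian q (component e x)) ->
  cocartesian (sfun_post K q) e.
Proof.
move=> q_inner ec n u v uv ue; apply: relative_horn_lift => // _; split=> // s s0 s1 x.
rewrite ue //; apply: mono_eq => -[[|[|r]] r2] //; apply/val_inj.
  by rewrite /= (_ : Ordinal r2 = ord0) ?s0 //; apply/val_inj.
by rewrite /= (_ : Ordinal r2 = ord_max) ?s1 //; apply/val_inj.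
Qed.

(** * Inner horns are categorical equivalences *)

Lemma bump_ltS n i (t : 'I_n.+1) : bump i t < n.+2.
Proof. by rewrite /bump; have := ltn_ord t; lia. Qed.

Lemma bump_le n i (s t : 'I_n.+1) : s <= t -> bump i s <= bump i t.
Proof. by rewrite leq_bump2. Qed.

(* For [i > n.+1], [fc n i] is the junk value [fun t => t], which is not a face. *)
Definition fc n (i : nat) : mono n n.+1 :=
  Mono (mfun := fun t => Ordinal (bump_ltS i t)) (@bump_le n i).

Lemma mface_fc n (i : 'I_n.+2) : mface i = fc n i.
Proof. by apply: mono_eq => t; apply: val_inj. Qed.

Lemma fc_comm n i j : i < j -> mcomp (fc n.+1 j) (fc n i) = mcomp (fc n.+1 i) (fc n j.-1).
Proof.
move=> ij; apply: mono_eq => t; apply: val_inj => /=; rewrite /bump.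
by lia.
Qed.

Lemma fc_inj n i : injective (fc n i).
Proof. by move=> s t /(congr1 val) /= /(can_inj (bumpK i)) /val_inj. Qed.

Lemma fc_neq n i (t : 'I_n.+1) : (fc n i t : nat) != i.
Proof. by rewrite eq_sym /= neq_bump. Qed.

Lemma mcomp_fc_inj n i k (a b : mono k n) : mcomp (fc n i) a = mcomp (fc n i) b -> a = b.
Proof.
move=> e; apply: mono_eq => t; apply: (@fc_inj _ i).
by have := congr1 (fun f : mono _ _ => f t) e.
Qed.

Lemma fc_factor n i k (s : mono k n.+1) : i < n.+2 ->
  (forall t, (s t : nat) != i) -> exists a, s = mcomp (fc n i) a.
Proof.
move=> ilt si; have [|a ->] := @mono_factor _ _ s (Ordinal ilt).
  by move=> t; rewrite -val_eqE /=.
by exists a; rewrite mface_fc.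
Qed.

Section Glue.
Variables (Z : sset) (n : nat) (P : forall k, simplex n.+2 k -> Prop).
Hypothesis PP : forall l k (a : mono l k) (s : simplex n.+2 k), P s -> P (restr a s).
Variables (J : nat -> Prop) (x : nat -> Z n.+1).
Hypothesis cover : forall k (s : simplex n.+2 k), P s ->
  exists i, [/\ J i, i < n.+3 & forall t, (s t : nat) != i].
Hypothesis compat : forall i j, i < j -> j < n.+3 -> J i -> J j ->
  restr (fc n j.-1) (x i) = restr (fc n i) (x j).

(** A cell in two faces lies in their intersection, where [compat] applies, so its value does not
    depend on the face used. If [J] contains every index the result is a map out of the boundary; if
    [J] excludes [j], a map out of the horn at [j]. *)
Lemma glue : exists u : smap (sub_sset PP) Z, forall i, J i -> i < n.+3 ->
  forall k (s : sub_sset PP k) (a : mono k n.+1),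
  sval s = mcomp (fc n.+1 i) a -> u k s = restr a (x i).
Proof.
have lt_case i j k (a b : mono k n.+1) : i < j -> j < n.+3 -> J i -> J j ->
    mcomp (fc n.+1 i) a = mcomp (fc n.+1 j) b -> restr a (x i) = restr b (x j).
  move=> ij jn Ji Jj e.
  have [||c ac] := @fc_factor n j.-1 _ a; first by lia.
    move=> t; have := congr1 (fun f : mono _ _ => (f t : nat)) e; rewrite /= /bump.
    by lia.
  have bc : b = mcomp (fc n i) c.
    apply: (@mcomp_fc_inj _ j); rewrite -e ac -[LHS]/(mcomp (mcomp (fc _ i) (fc _ j.-1)) c).
    by rewrite -fc_comm.
  by rewrite ac bc !restr_comp compat.
have ex k (s : sub_sset PP k) : exists z, forall i, J i -> i < n.+3 ->
    forall a, sval s = mcomp (fc n.+1 i) a -> z = restr a (x i).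
  have [i [Ji ilt si]] := cover (svalP s); have [a sa] := fc_factor ilt si.
  exists (restr a (x i)) => j Jj jlt b sb; rewrite sa in sb.
  case: (ltngtP i j) => [ij|ji|ij]; [exact: lt_case | | ].
    by symmetry; apply: lt_case.
  by subst j; rewrite (mcomp_fc_inj sb).
pose f k s := sval (cid (ex k s)).
have fP k s : forall i, J i -> i < n.+3 -> forall a, sval s = mcomp (fc n.+1 i) a ->
  f k s = restr a (x i) := svalP (cid (ex k s)).
have fnat l k (a : mono l k) (s : sub_sset PP k) : f l (restr a s) = restr a (f k s).
  have [i [Ji ilt si]] := cover (svalP s); have [b sb] := fc_factor ilt si.
  rewrite (fP _ _ _ Ji ilt _ sb) -restr_comp; apply: fP => //.
  by rewrite /= sb.
by exists {| app := f; app_nat := fnat |} => i Ji ilt k s a sa; apply: fP.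
Qed.
End Glue.

(** The edges are 01, 12 and 02: [s] exhibits [h] as a composite of [f] followed by [g]. *)
Definition tri (Z : sset) (f g h : Z 1) (s : Z 2) : Prop :=
  [/\ restr (fc 1 2) s = f, restr (fc 1 0) s = g & restr (fc 1 1) s = h].

Lemma fc_max : fc 0 0 = mconst 0 ord_max.
Proof. by apply: mono_eq => t; apply: val_inj; rewrite /= (ord1 t). Qed.

Lemma fc_min : fc 0 1 = mconst 0 ord0.
Proof. by apply: mono_eq => t; apply: val_inj; rewrite /= (ord1 t). Qed.

Lemma is_equivE (Z : sset) (e : Z 1) : is_equiv e <-> exists e' s s',
  tri e e' (degen 1 (src e)) s /\ tri e' e (degen 1 (tgt e)) s'.
Proof.
rewrite /is_equiv /tri !mface_fc /=.
by split=> [[e' [[s hs] [s' hs']]]|[e' [s [s' [hs hs']]]]]; exists e';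
  [exists s, s' | split; [exists s | exists s']].
Qed.

Lemma src_fc (Z : sset) (e : Z 1) : src e = restr (fc 0 1) e.
Proof. by rewrite fc_min. Qed.

Lemma tgt_fc (Z : sset) (e : Z 1) : tgt e = restr (fc 0 0) e.
Proof. by rewrite fc_max. Qed.

Lemma restr_degen (Z : sset) (z : Z 0) m n (a : mono m n) : restr a (degen n z) = degen m z.
Proof.
by rewrite /degen -restr_comp; congr restr; apply: mono_eq => t; apply: val_inj.
Qed.

Lemma degen0 (Z : sset) (z : Z 0) : degen 0 z = z.
Proof.
rewrite -[RHS]restr_id; congr restr.
by apply: mono_eq => t; apply: val_inj; rewrite /= (ord1 t).
Qed.

Lemma app_degen (Z W : sset) (f : smap Z W) n (z : Z 0) : f n (degen n z) = degen n (f 0 z).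
Proof. by rewrite app_nat. Qed.

Lemma tri_src (Z : sset) (f g h : Z 1) s : tri f g h s -> src f = src h.
Proof.
case=> <- _ <-; rewrite !src_fc -!restr_comp; congr (restr _ s).
by rewrite (@fc_comm 0 1 2).
Qed.

Lemma tri_tgt (Z : sset) (f g h : Z 1) s : tri f g h s -> tgt g = tgt h.
Proof.
case=> _ <- <-; rewrite !tgt_fc -!restr_comp; congr (restr _ s).
by rewrite (@fc_comm 0 0 1).
Qed.

Lemma tri_mid (Z : sset) (f g h : Z 1) s : tri f g h s -> tgt f = src g.
Proof.
case=> <- <- _; rewrite tgt_fc src_fc -!restr_comp; congr (restr _ s).
by rewrite (@fc_comm 0 0 2).
Qed.

Lemma smap_tri (Z W : sset) (p : smap Z W) f g h s :
  tri f g h s -> tri (p 1 f) (p 1 g) (p 1 h) (p 2 s).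
Proof. by case=> <- <- <-; rewrite /tri !app_nat. Qed.

Lemma smap_equiv (Z W : sset) (p : smap Z W) e : is_equiv e -> is_equiv (p 1 e).
Proof.
move=> /is_equivE [e' [s [s' [/(smap_tri p) h /(smap_tri p) h']]]].
apply/is_equivE; exists (p 1 e'), (p 2 s), (p 2 s').
by move: h h'; rewrite !app_degen /src /tgt !app_nat.
Qed.

Lemma src_degen (Z : sset) (z : Z 0) : src (degen 1 z) = z.
Proof. by rewrite src_fc restr_degen degen0. Qed.

Lemma tgt_degen (Z : sset) (z : Z 0) : tgt (degen 1 z) = z.
Proof. by rewrite tgt_fc restr_degen degen0. Qed.

Lemma degen_equiv (Z : sset) (z : Z 0) : is_equiv (degen 1 z).
Proof.
apply/is_equivE; exists (degen 1 z), (degen 2 z), (degen 2 z).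
by rewrite src_degen tgt_degen /tri !restr_degen.
Qed.

Lemma is_equiv_sym (Z : sset) (e : Z 1) : is_equiv e ->
  exists e', [/\ is_equiv e', src e' = tgt e & tgt e' = src e].
Proof.
move=> /is_equivE [e' [s [s' [h h']]]]; exists e'.
have e1 : src e' = tgt e by rewrite (tri_src h') src_degen.
have e2 : tgt e' = src e by rewrite (tri_tgt h) tgt_degen.
by split=> //; apply/is_equivE; exists e, s', s; rewrite e1 e2.
Qed.

(** * Lifting equivalences along trivial fibrations *)

Section TrivialFibration.
Variables (Z W : sset) (r : smap Z W).
Hypothesis r_triv : trivial_fibration r.

Lemma trivial_lift_edge (a b : Z 0) (e : W 1) : src e = r 0 a -> tgt e = r 0 b ->
  exists e', [/\ r 1 e' = e, src e' = a & tgt e' = b].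
Proof.
move=> ea eb.
have ex k (s : bound 1 k) : exists z : Z k, r k z = restr (sval s) e /\
    (sval s ord0 = ord0 -> z = degen k a) /\ (sval s ord0 <> ord0 -> z = degen k b).
  case: s => s [j js] /=; case: (eqVneq (s ord0) ord0) => s0.
    exists (degen k a); split; last by split.
    rewrite app_degen -ea /degen /src -restr_comp mcomp_const; congr (restr _ e).
    apply: mono_eq => t; apply: val_inj => /=.
    have := js t; have := js ord0; rewrite s0 -!val_eqE /=.
    by case: (s t) (j) => [a2 ?] [j2 ?] /=; lia.
  exists (degen k b); split; last by split=> // e0; rewrite e0 in s0.
  rewrite app_degen -eb /degen /tgt -restr_comp mcomp_const; congr (restr _ e).
  apply: mono_eq => t; apply: val_inj => /=; have := mfunP s (leq0n t : ord0 <= t).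
  move: s0; rewrite -val_eqE /=.
  by case: (s t) (s ord0) => [a2 ?] [b2 ?] /=; lia.
pose f k s := sval (cid (ex k s)).
have fP k s : r k (f k s) = restr (sval s) e /\ (sval s ord0 = ord0 -> f k s = degen k a) /\
  (sval s ord0 <> ord0 -> f k s = degen k b) := svalP (cid (ex k s)).
have fnat l k (c : mono l k) (s : bound 1 k) : f l (restr c s) = restr c (f k s).
  have [_ [h0 h1]] := fP k s; have [_ [h0' h1']] := fP l (restr c s).
  have cst t : sval s t = sval s ord0.
    case: s {h0 h1 h0' h1'} => s [j js] /=; apply/val_inj.
    have := js t; have := js ord0; rewrite -!val_eqE /=.
    by case: (s t) (s ord0) (j) => [a1 a2] [b1 b2] [c1 c2] /=; lia.
  case: (pselect (sval s ord0 = ord0)) => s0.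
    by rewrite h0 // restr_degen h0' //= cst.
  by rewrite h1 // restr_degen h1' //= cst.
have [h [h1 h2]] := @r_triv 1 {| app := f; app_nat := fnat |} (yoneda e)
  (fun k s => (fP k s).1).
have b0 : bound_pred (mconst 0 ord0 : simplex 1 0) by exists ord_max.
have b1 : bound_pred (mconst 0 ord_max : simplex 1 0) by exists ord0.
exists (h 1 (mid 1)); split; first by rewrite h2 /= restr_id.
  rewrite /src -app_nat; apply: etrans (h1 0 (exist _ _ b0)) _ => /=.
  by rewrite (fP _ _).2.1 ?degen0.
rewrite /tgt -app_nat; apply: etrans (h1 0 (exist _ _ b1)) _ => /=.
by rewrite (fP _ _).2.2 ?degen0.
Qed.

Lemma trivial_lift_tri (f g h : Z 1) (s : W 2) : tri (r 1 f) (r 1 g) (r 1 h) s ->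
  src f = src h -> tgt g = tgt h -> tgt f = src g -> exists s', tri f g h s'.
Proof.
move=> [sf sg sh] fh gh fg.
pose x i := match i with 0 => g | 1 => h | _ => f end.
have [||u uE] := @glue Z 0 _ (@bound_predP 2) (fun _ => True) x.
- by move=> k t [j jt]; exists j; split.
- by case=> [|[|i]] [|[|[|j]]] //= _ _ _ _; rewrite -?src_fc -?tgt_fc.
have ru k t : r k (u k t) = yoneda s k (sval t).
  case: (svalP t) => j jt; have [//|//|a ta] := @fc_factor _ j _ (sval t).
  rewrite (uE j _ _ _ t a ta) // ta /= restr_comp app_nat.
  by case: j {jt ta} => [[|[|[|j]]] //= _]; congr restr.
have [l [l1 l2]] := @r_triv 2 u (yoneda s) ru.
exists (l 2 (mid 2)).
have key i : i < 3 -> restr (fc 1 i) (l 2 (mid 2)) = x i.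
  move=> i3; have b : bound_pred (fc 1 i : simplex 2 1).
    by exists (Ordinal i3) => t; rewrite -val_eqE /= eq_sym neq_bump.
  rewrite -app_nat; apply: etrans (l1 1 (exist _ _ b)) _.
  by rewrite (uE i _ _ _ _ (mid 1)) ?restr_id.
by split; apply: key.
Qed.

(** An equivalence consists of two edges and two triangles. Edges lift with prescribed ends and
    triangles with prescribed boundary; the edges 02 of the triangles are prescribed to be
    degenerate at [a] and [b]. *)
Lemma trivial_lift_equiv (a b : Z 0) (e : W 1) : is_equiv e ->
  src e = r 0 a -> tgt e = r 0 b ->
  exists e', [/\ is_equiv e', src e' = a & tgt e' = b].
Proof.
move=> /is_equivE [i [s [s' [h h']]]] ea eb.
have [f [fe fa fb]] := trivial_lift_edge ea eb.
have [||g [gi gb ga]] := @trivial_lift_edge b a i.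
- by rewrite (tri_src h') src_degen.
- by rewrite (tri_tgt h) tgt_degen.
exists f; split=> //; apply/is_equivE.
have [||||t tP] := @trivial_lift_tri f g (degen 1 a) s.
- by rewrite fe gi app_degen -ea.
- by rewrite src_degen.
- by rewrite tgt_degen.
- by rewrite fb gb.
have [||||t' tP'] := @trivial_lift_tri g f (degen 1 b) s'.
- by rewrite fe gi app_degen -eb.
- by rewrite src_degen.
- by rewrite tgt_degen.
- by rewrite ga fa.
by exists g, t, t'; rewrite fa fb.
Qed.
End TrivialFibration.

Definition sfun_pre A B X (i : smap A B) : smap (sfun B X) (sfun A X).
Proof.
refine {| app := fun n (h : sfun B X n) =>
  (scomp h (sprod_map i (sid (simplex n))) : sfun A X n) |}.
by move=> m n a h; apply: smap_eq.
Defined.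

Definition fvert K X (f : smap K X) : sfun K X 0 := scomp f (sfst K (simplex 0)).

Lemma restricts_toE K X (h : sfun K X 1) (f g : smap K X) :
  restricts_to h f g <-> src h = fvert f /\ tgt h = fvert g.
Proof.
have cst k i (b : mono k 0) : mcomp (mconst 0 (i : 'I_2)) b = mconst k i.
  exact: mono_eq.
split=> [hP|[hs ht] k x].
  by split; apply: smap_eq => k [x b] /=; rewrite cst; case: (hP k x).
split.
  have := congr1 (fun w : sfun K X 0 => w k (x, mconst k ord0)) hs.
  by rewrite /= cst.
have := congr1 (fun w : sfun K X 0 => w k (x, mconst k ord0)) ht.
by rewrite /= cst.
Qed.

Definition to_point X : smap X (discrete unit) :=
  {| app := fun n (_ : X n) => (tt : discrete unit n);
     app_nat := fun m n a x => erefl |}.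

Lemma quasicategory_inner X : quasicategory X -> inner_fibration (to_point X).
Proof.
move=> hX n i hi u v _; have [h hu] := hX n i hi u; exists h; split=> // m b.
by case: (v m b).
Qed.

Section HornEquivalence.
Variables (X : sset) (n : nat) (i : 'I_n.+1).
Hypothesis (hX : quasicategory X) (hi : 0 < i < n).
Let incl := sub_incl (@horn_predP n i).

(** After the two factors are exchanged, lifting against the boundary of Delta^m is the extension to
    Delta^m x Delta^n of a map on the union of bd Delta^m x Delta^n and Delta^m x Lambda^n_i, with
    values in [X] over a point. *)
Lemma horn_trivial : trivial_fibration (sfun_pre X incl).
Proof.
move=> m u v uv.
have ex k (z : sub_sset (@prism_domP m n i) k) : exists y : X k,
    (forall b, y = u k (exist _ (sval z).1 b) k ((sval z).2, mid k)) /\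
    (forall h, y = v k (sval z).1 k (exist _ (sval z).2 h, mid k)).
  have uv' b h : u k (exist _ (sval z).1 b) k ((sval z).2, mid k) =
      v k (sval z).1 k (exist _ (sval z).2 h, mid k).
    have := congr1 (fun w : sfun (horn i) X k => w k (exist _ (sval z).2 h, mid k))
                   (uv _ (exist _ (sval z).1 b)).
    by [].
  case: (svalP z) => [b|h].
    exists (u k (exist _ (sval z).1 b) k ((sval z).2, mid k)); split=> // b'.
    by rewrite (Prop_irrelevance b b').
  exists (v k (sval z).1 k (exist _ (sval z).2 h, mid k)); split=> // h'.
  by rewrite (Prop_irrelevance h h').
pose f k z := sval (cid (ex k z)).
have fP k z : (forall b, f k z = u k (exist _ (sval z).1 b) k ((sval z).2, mid k)) /\
    (forall h, f k z = v k (sval z).1 k (exist _ (sval z).2 h, mid k)) :=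
  svalP (cid (ex k z)).
have fnat l k (a : mono l k) z : f l (restr a z) = restr a (f k z).
  have [f1 f2] := fP k z; have [f1' f2'] := fP l (restr a z).
  case: (svalP z) => [b|h].
    rewrite (f1 b) (f1' (bound_predP a b)) -app_nat /=.
    have := app_nat u a (exist _ _ b) => /(congr1 (fun w : sfun (simplex n) X l =>
      w l (mcomp (sval z).2 a, mid l))) /= <-.
    by congr (u l _ l _); apply: sub_eq.
  rewrite (f2 h) (f2' (horn_predP a h)) -app_nat /=.
  have := app_nat v a (sval z).1 => /(congr1 (fun w : sfun (horn i) X l =>
    w l (exist _ (mcomp (sval z).2 a) (horn_predP a h), mid l))) /= ->.
  by congr (v k _ l (_, _)); apply: sub_eq.
case/andP: (hi) => i0 ilt.
have [//||h [h1 _]] := @prism_lift m n i ilt X _ (to_point X) (quasicategory_inner hX)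
  {| app := f; app_nat := fnat |} (to_point _).
  by move=> i00; rewrite i00 in i0.
unshelve eexists {| app := fun k (s : simplex m k) =>
  scomp h {| app := fun l (z : sprod (simplex n) (simplex k) l) =>
     ((mcomp s z.2, z.1) : sprod (simplex m) (simplex n) l);
     app_nat := fun _ _ _ _ => erefl |} : sfun (simplex n) X k |}.
  by move=> l k a s; apply: smap_eq => k' [x b].
split=> k s; apply: smap_eq => l [x a] /=.
  have b : bound_pred (mcomp (sval s) a) by apply: (bound_predP a (svalP s)).
  pose z : sprod (simplex m) (simplex n) l := (mcomp (sval s) a, x).
  have zb : prism_dom i z by left.
  rewrite (h1 _ z zb) /= ((fP l (exist _ z zb)).1 b) /=.
  have := app_nat u a s => /(congr1 (fun w : sfun (simplex n) X l => w l (x, mid l))) /= <-.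
  by congr (u l _ l _); apply: sub_eq.
case: x => x hx /=.
pose z : sprod (simplex m) (simplex n) l := (mcomp s a, x).
have zh : prism_dom i z by right.
rewrite (h1 _ z zh) /= ((fP l (exist _ z zh)).2 hx) /=.
by have := app_nat v a s => /(congr1 (fun w : sfun (horn i) X l => w l (exist _ x hx, mid l))).
Qed.
End HornEquivalence.

(** Fillers extend maps from the horn strictly, and an equivalence between two restrictions lifts
    along the trivial fibration [horn_trivial]. *)
Lemma horn_categorical_equivalence n (i : 'I_n.+1) : 0 < i < n ->
  categorical_equivalence (sub_incl (@horn_predP n i)).
Proof.
move=> hi X hX; split=> [u|v w [e [e_eq /restricts_toE [es et]]]].
  have [v vu] := hX n i hi u; exists v.
  have -> : scomp v (sub_incl (@horn_predP n i)) = u by apply: smap_eq.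
  exists (degen 1 (fvert u)); split; first exact: degen_equiv.
  by apply/restricts_toE; rewrite src_degen tgt_degen.
have [||e' [e'_eq e's e't]] := trivial_lift_equiv (horn_trivial hX hi) (a := fvert v)
  (b := fvert w) e_eq.
- by rewrite es; apply: smap_eq.
- by rewrite et; apply: smap_eq.
by exists e'; split=> //; apply/restricts_toE.
Qed.

Lemma categorical_fibration_inner X S (p : smap X S) :
  categorical_fibration p -> inner_fibration p.
Proof.
move=> p_fib n i hi; apply: p_fib; last exact: horn_categorical_equivalence.
by move=> k x y; apply: sub_eq.
Qed.

(** * Equivalences in quasi-categories and uniqueness of cocartesian lifts *)

Section HornFill.
Variables (Z W : sset) (q : smap Z W) (n : nat) (j : 'I_n.+3).
Variables (x : nat -> Z n.+1) (y : W n.+2).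
Hypothesis compat : forall i i', i < i' -> i' < n.+3 -> i != j -> i' != j ->
  restr (fc n i'.-1) (x i) = restr (fc n i) (x i').
Hypothesis over : forall i, i < n.+3 -> i != j -> q n.+1 (x i) = restr (fc n.+1 i) y.
Hypothesis lift_ex : forall u : smap (horn j) Z,
  (forall k s, q k (u k s) = yoneda y k (sval s)) ->
  (forall i : nat, i != j -> i < n.+3 -> forall k (s : horn j k) (a : mono k n.+1),
     sval s = mcomp (fc n.+1 i) a -> u k s = restr a (x i)) ->
  exists h : smap (simplex n.+2) Z,
    (forall m s, h m (sval s) = u m s) /\
    (forall m s, q m (h m s) = yoneda y m s).

(** The horn is given by its faces, with a junk value at [j]. The reason why it lifts is passed as
    [lift_ex], which serves inner horns and outer horns with a cocartesian first edge alike. *)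
Lemma horn_fill : exists z, q n.+2 z = y /\
  forall i : nat, i != j -> i < n.+3 -> restr (fc n.+1 i) z = x i.
Proof.
have cover k (s : simplex n.+2 k) : horn_pred j s ->
    exists i : nat, [/\ i != j, i < n.+3 & forall t, (s t : nat) != i].
  by case=> i ij si; exists i; split.
have [|u uE] := @glue Z n _ (@horn_predP n.+2 j) (fun i : nat => i != j) x cover.
  by move=> i i' *; apply: compat.
have [k s||h [h1 h2]] := lift_ex (u := u).
- have [i [ij ilt si]] := cover _ _ (svalP s); have [a sa] := fc_factor ilt si.
  by rewrite (uE i ij ilt _ _ a sa) app_nat over //= sa restr_comp.
- by move=> *; apply: uE.
exists (h n.+2 (mid n.+2)); split=> [|i ij ilt]; first by rewrite h2 /= restr_id.
have b : horn_pred j (fc n.+1 i : simplex n.+2 n.+1).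
  by exists (Ordinal ilt) => // t; rewrite -val_eqE fc_neq.
rewrite -app_nat; apply: etrans (h1 n.+1 (exist _ _ b)) _.
by rewrite (uE i ij ilt _ _ (mid n.+1)) ?restr_id.
Qed.
End HornFill.

Lemma inner_fill (Z : sset) n (j : 'I_n.+3) (x : nat -> Z n.+1) :
  quasicategory Z -> 0 < j < n.+2 ->
  (forall i i', i < i' -> i' < n.+3 -> i != j -> i' != j ->
    restr (fc n i'.-1) (x i) = restr (fc n i) (x i')) ->
  exists z, forall i : nat, i != j -> i < n.+3 -> restr (fc n.+1 i) z = x i.
Proof.
move=> hZ hj compat.
have [//|u uv _|z [_ hz]] := @horn_fill _ _ (to_point Z) n j x tt compat.
  by apply: (quasicategory_inner hZ hj).
by exists z.
Qed.

Definition first_edge n : mono 1 n.+1 :=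
  @medge n.+1 ord0 (lift ord0 ord0) (leq0n _).

(** The first edge of the horn is read off in the face opposite the last vertex [n.+2]; the value
    [x 0] is junk. *)
Lemma cocartesian_fill (Z W : sset) (q : smap Z W) (e : Z 1) n
    (x : nat -> Z n.+1) (y : W n.+2) :
  cocartesian q e ->
  (forall i i', 0 < i -> i < i' -> i' < n.+3 ->
    restr (fc n i'.-1) (x i) = restr (fc n i) (x i')) ->
  (forall i, 0 < i -> i < n.+3 -> q n.+1 (x i) = restr (fc n.+1 i) y) ->
  restr (first_edge n) (x n.+2) = e ->
  exists z, q n.+2 z = y /\
    forall i, 0 < i -> i < n.+3 -> restr (fc n.+1 i) z = x i.
Proof.
move=> ec compat over xe.
have [i i'|i|u uv uE|z [zy zx]] := @horn_fill _ _ q n ord0 x y.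
- by rewrite /= -!lt0n => *; apply: compat.
- by rewrite /= -lt0n => *; apply: over.
- apply: ec uv _ => s sE; rewrite (uE n.+2 _ _ _ _ (first_edge n)) // sE.
  by apply: mono_eq => -[[|[|t]] ?] //; apply: val_inj.
by exists z; split=> // i i0; apply: zx; rewrite /= -lt0n.
Qed.

(** * Composition of equivalences *)

Section Composition.
Variable Z : sset.
Hypothesis hZ : quasicategory Z.

Let o31 : 'I_4 := Ordinal (isT : 1 < 4).
Let o32 : 'I_4 := Ordinal (isT : 2 < 4).
Let o21 : 'I_3 := Ordinal (isT : 1 < 3).

Let compose (f g : Z 1) : tgt f = src g -> exists h s, tri f g h s.
Proof.
move=> fg; pose x i := if i is 0 then g else f.
have [||z zE] := @inner_fill Z 0 o21 x hZ => //.
  by case=> [|[|i]] [|[|[|i']]] //= _ _ _ _; rewrite -src_fc -tgt_fc.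
by exists (restr (fc 1 1) z), z; split=> //; exact: zE.
Qed.

(* The arguments are the faces 012, 013, 123 of a 3-simplex. *)
Let assoc1 f01 f12 f02 f13 f03 f23 (a b c : Z 2) :
  tri f01 f12 f02 a -> tri f01 f13 f03 b -> tri f12 f23 f13 c ->
  exists d, tri f02 f23 f03 d.
Proof.
move=> [a1 a2 a3] [b1 b2 b3] [c1 c2 c3].
pose x i := match i with 0 => c | 2 => b | _ => a end.
have [||z zE] := @inner_fill Z 1 o31 x hZ => //.
  by case=> [|[|[|i]]] [|[|[|[|i']]]] //= _ _ _ _; congruence.
exists (restr (fc 2 1) z); split; rewrite -restr_comp.
- by rewrite -(@fc_comm 1 1 3) // restr_comp zE.
- by rewrite (@fc_comm 1 0 1) // restr_comp zE.
- by rewrite -(@fc_comm 1 1 2) // restr_comp zE.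
Qed.

(* The arguments are the faces 012, 023, 123 of a 3-simplex. *)
Let assoc2 f01 f12 f02 f13 f03 f23 (a b c : Z 2) :
  tri f01 f12 f02 a -> tri f02 f23 f03 b -> tri f12 f23 f13 c ->
  exists d, tri f01 f13 f03 d.
Proof.
move=> [a1 a2 a3] [b1 b2 b3] [c1 c2 c3].
pose x i := match i with 0 => c | 1 => b | _ => a end.
have [||z zE] := @inner_fill Z 1 o32 x hZ => //.
  by case=> [|[|[|i]]] [|[|[|[|i']]]] //= _ _ _ _; congruence.
exists (restr (fc 2 2) z); split; rewrite -restr_comp.
- by rewrite -(@fc_comm 1 2 3) // restr_comp zE.
- by rewrite (@fc_comm 1 0 2) // restr_comp zE.
- by rewrite (@fc_comm 1 1 2) // restr_comp zE.
Qed.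

(** In path order, d (d' e') = (d d') e' = e', whence (e d)(d' e') = e e' = 1. The other half
    follows by applying this to [d'] and [e']. *)
Let inverse_half (d d' e e' de ed : Z 1) (s1 s2 t1 t2 : Z 2) :
  tri e e' (degen 1 (src e)) s1 -> tri d d' (degen 1 (src d)) s2 ->
  tri e d de t1 -> tri d' e' ed t2 -> exists s, tri de ed (degen 1 (src e)) s.
Proof.
move=> h1 h2 h3 h4.
have unit_tri : tri (degen 1 (src d)) e' e' (restr (Mono (@step_funP 1)) e').
  rewrite -(tri_mid h3) (tri_mid h1); split; rewrite -restr_comp.
  - rewrite /degen /src -restr_comp mcomp_const; congr restr.
    by apply: mono_eq => -[[|[|t]] ?]; apply: val_inj.
  - rewrite -[RHS]restr_id; congr restr.
    by apply: mono_eq => -[[|[|t]] ?]; apply: val_inj.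
  - rewrite -[RHS]restr_id; congr restr.
    by apply: mono_eq => -[[|[|t]] ?]; apply: val_inj.
have [s hs] := assoc2 h2 unit_tri h4.
by have [s' hs'] := assoc1 h3 h1 hs; exists s'.
Qed.

Lemma is_equiv_trans (e d : Z 1) : is_equiv e -> is_equiv d -> tgt e = src d ->
  exists c, [/\ is_equiv c, src c = src e & tgt c = tgt d].
Proof.
move=> /is_equivE [e' [s [s' [h h']]]] /is_equivE [d' [t [t' [k k']]]] ed.
have [c [r rP]] := compose ed.
have de : tgt d' = src e'.
  by rewrite (tri_tgt k) tgt_degen -(tri_mid h) ed.
have [c' [r' rP']] := compose de.
have cs : src e = src c by apply: (tri_src rP).
have ct : tgt d = tgt c by apply: (tri_tgt rP).
exists c; split=> //; apply/is_equivE.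
have [w wP] := inverse_half h k rP rP'.
have sd' : src d' = tgt d by rewrite (tri_src k') src_degen.
have se' : src e' = tgt e by rewrite (tri_src h') src_degen.
rewrite -sd' in k'; rewrite -se' in h'.
have [w' wP'] := inverse_half k' h' rP' rP.
by exists c', w, w'; rewrite -cs -ct -sd'.
Qed.
End Composition.

(** * Uniqueness of cocartesian edges *)

Section Fibre.
Variables (Z W : sset) (q : smap Z W).

Lemma fibre_predP (w : W 0) m n (a : mono m n) (z : Z n) :
  q n z = degen n w -> q m (restr a z) = degen m w.
Proof. by move=> zw; rewrite app_nat zw restr_degen. Qed.

Definition fibre (w : W 0) : sset := sub_sset (@fibre_predP w).

Let s1 : mono 2 1 := Mono (@step_funP 0).

Let s1_fc2 : mcomp s1 (fc 1 2) = mid 1.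
Proof. by apply: mono_eq => -[[|[|t]] ?]; apply: val_inj. Qed.
Let s1_fc1 : mcomp s1 (fc 1 1) = mid 1.
Proof. by apply: mono_eq => -[[|[|t]] ?]; apply: val_inj. Qed.
Let s1_fc0 : mcomp s1 (fc 1 0) = mconst 1 ord_max.
Proof. by apply: mono_eq => -[[|[|t]] ?]; apply: val_inj. Qed.

Let degen_tgt (X : sset) n (e : X 1) : degen n (tgt e) = restr (mconst n ord_max) e.
Proof. by rewrite /degen /tgt -restr_comp mcomp_const. Qed.

(** The outer horn formed by [e] and [e'] is filled over the degenerate triangle with vertices 0, 1,
    1, so that the new edge lies over a degenerate one. The projection of the triangle is recorded
    for use one dimension higher. *)
Let compare (e e' : Z 1) : cocartesian q e -> src e = src e' -> q 1 e = q 1 e' ->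
  exists d s, [/\ tri e d e' s, q 1 d = degen 1 (tgt (q 1 e)) & q 2 s = restr s1 (q 1 e)].
Proof.
move=> ec ss qq; pose x i := if i is 1 then e' else e.
have [|||z [zy zE]] := @cocartesian_fill Z W q e 0 x (restr s1 (q 1 e)) ec.
- by case=> [|[|i]] [|[|[|i']]] //= _ _ _; rewrite -!src_fc.
- by case=> [|[|[|i]]] //= _ _; rewrite -restr_comp ?s1_fc1 ?s1_fc2 restr_id.
- rewrite /= -[RHS]restr_id; congr restr.
  by apply: mono_eq => -[[|[|t]] ?] //; apply: val_inj.
exists (restr (fc 1 0) z), z; split=> //; last first.
  by rewrite app_nat zy -restr_comp s1_fc0 degen_tgt.
by split=> //; exact: zE.
Qed.

(** A 3-simplex over the map with vertices 0, 1, 1, 1 is filled from the faces 012 = [s], 023 = [s']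
    and 013 degenerate on [e]; its face 123 is the required homotopy. *)
Let compare_inverse (e e' d d' : Z 1) (s s' : Z 2) : cocartesian q e ->
  q 1 e = q 1 e' -> tri e d e' s -> tri e' d' e s' ->
  q 2 s = restr s1 (q 1 e) -> q 2 s' = restr s1 (q 1 e') ->
  exists t, tri d d' (degen 1 (tgt e)) t /\ q 2 t = degen 2 (tgt (q 1 e)).
Proof.
move=> ec qq [h1 h2 h3] [h1' h2' h3'] qs qs'.
pose c (i : 'I_4) : 'I_2 := if (i : nat) is 0 then ord0 else ord_max.
have cP (i j : 'I_4) : i <= j -> c i <= c j by case: i j => [[|i] ?] [[|j] ?].
pose s2 : mono 3 1 := Mono cP.
pose x i := match i with 1 => s' | 2 => restr s1 e | _ => s end.
have [|||z [zy zE]] := @cocartesian_fill Z W q e 1 x (restr s2 (q 1 e)) ec.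
- case=> [|[|[|i]]] [|[|[|[|i']]]] //= _ _ _;
  by rewrite -?restr_comp ?s1_fc1 ?s1_fc2 ?restr_id; congruence.
- by case=> [|[|[|[|i]]]] //= _ _; rewrite ?app_nat ?qs ?qs' -?qq -restr_comp;
     congr restr; apply: mono_eq => -[[|[|[|t]]] ?]; apply: val_inj.
- rewrite /= -h1; congr restr.
  by apply: mono_eq => -[[|[|t]] ?] //; apply: val_inj.
exists (restr (fc 2 0) z); split; last first.
  rewrite app_nat zy -restr_comp degen_tgt; congr restr.
  by apply: mono_eq => -[[|[|[|t]]] ?]; apply: val_inj.
split; rewrite -restr_comp.
- by rewrite -(@fc_comm 1 0 3) // restr_comp zE.
- by rewrite -(@fc_comm 1 0 1) // restr_comp zE.
- by rewrite -(@fc_comm 1 0 2) // restr_comp zE //= -restr_comp s1_fc0 degen_tgt.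
Qed.

Lemma cocartesian_unique (e e' : Z 1) : cocartesian q e -> cocartesian q e' ->
  src e = src e' -> q 1 e = q 1 e' ->
  exists d : fibre (tgt (q 1 e)) 1,
    [/\ is_equiv d, src (sval d) = tgt e & tgt (sval d) = tgt e'].
Proof.
move=> ec ec' ss qq.
have [d [s [h qd qs]]] := compare ec ss qq.
have [d' [s' [h' qd' qs']]] := compare ec' (esym ss) (esym qq).
have [t [tP qt]] := compare_inverse ec qq h h' qs qs'.
have [t' [tP' qt']] := compare_inverse ec' (esym qq) h' h qs' qs.
rewrite -qq in qd' qt'.
exists (exist _ d qd); split=> /=; [|exact: esym (tri_mid h)|exact: tri_tgt h].
apply/is_equivE; exists (exist _ d' qd'), (exist _ t qt), (exist _ t' qt').
have sd : src d = tgt e := esym (tri_mid h).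
have td : tgt d = tgt e' := tri_tgt h.
case: tP => a1 a2 a3; case: tP' => b1 b2 b3.
by split; split; apply: sub_eq; rewrite //= -?/(src d) -?/(tgt d) ?sd ?td.
Qed.
End Fibre.

(** * Natural equivalences over a base *)

Section NatEquivOver.
Variables (K X B : sset) (pi : smap X B) (k : smap K B).

Definition sfun_over_incl : smap (sfun_over pi k) (sfun K X) :=
  {| app := fun n (h : sfun_over pi k n) => sval h;
     app_nat := fun m n a h => erefl |}.

Lemma sfun_over_eq n (g h : sfun_over pi k n) : sval g = sval h -> g = h.
Proof. exact: sub_eq. Qed.

Lemma nat_equiv_overE (f g : smap K X) : nat_equiv_over pi k f g <->
  exists d : sfun_over pi k 1,
    [/\ is_equiv d, src (sval d) = fvert f & tgt (sval d) = fvert g].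
Proof.
split=> [[d [d_eq /restricts_toE [ds dt]]]|[d [d_eq ds dt]]]; exists d => //.
by split=> //; apply/restricts_toE.
Qed.

(** Fun_B(K, X) is the fibre over [k] of the inner fibration [sfun_post], so a horn in it is lifted
    over the constant simplex at [k]. Transitivity of natural equivalence over B rests on this. *)
Lemma sfun_over_quasicategory :
  inner_fibration pi -> quasicategory (sfun_over pi k).
Proof.
move=> pi_inner n i hi u.
have @v : smap (simplex n) (sfun K B).
  refine {| app := fun m (s : simplex n m) =>
    (scomp k (sfst K (simplex m)) : sfun K B m) |}.
  by move=> l m a s; apply: smap_eq.
have [|h [h1 h2]] := @sfun_inner K X B pi pi_inner n i hi (scomp sfun_over_incl u) v.
  by move=> m s; apply: smap_eq => l x; apply: (svalP (u m s)).
have hP m (s : simplex n m) : lies_over pi (scomp k (sfst K (simplex m))) (h m s).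
  by move=> l x; have := congr1 (fun w : sfun K B m => w l x) (h2 m s).
unshelve eexists {| app := fun m (s : simplex n m) =>
    exist _ (h m s) (hP m s) : sfun_over pi k m |}.
  by move=> l m a s; apply: sfun_over_eq; rewrite /= app_nat.
by move=> m s; apply: sfun_over_eq; rewrite /= h1.
Qed.

Lemma nat_equiv_over_sym (f g : smap K X) :
  nat_equiv_over pi k f g -> nat_equiv_over pi k g f.
Proof.
move=> /nat_equiv_overE [d [d_eq ds dt]]; have [d' [d'_eq ds' dt']] := is_equiv_sym d_eq.
apply/nat_equiv_overE; exists d'; split=> //.
  by rewrite -dt; exact: (congr1 (sfun_over_incl 0) ds').
by rewrite -ds; exact: (congr1 (sfun_over_incl 0) dt').
Qed.

Lemma nat_equiv_over_trans (f g h : smap K X) : inner_fibration pi ->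
  nat_equiv_over pi k f g -> nat_equiv_over pi k g h -> nat_equiv_over pi k f h.
Proof.
move=> pi_inner /nat_equiv_overE [d [d_eq ds dt]] /nat_equiv_overE [e [e_eq es et]].
have [|c [c_eq cs ct]] := is_equiv_trans (sfun_over_quasicategory pi_inner) d_eq e_eq.
  by apply: sfun_over_eq; apply: etrans dt (esym es).
apply/nat_equiv_overE; exists c; split=> //.
  by rewrite -ds; exact: (congr1 (sfun_over_incl 0) cs).
by rewrite -et; exact: (congr1 (sfun_over_incl 0) ct).
Qed.

End NatEquivOver.

Section NatEquivOverFunctor.
Variables (K X B : sset) (pi : smap X B) (k : smap K B).

Lemma nat_equiv_over_post Y (pi' : smap Y B) (phi : smap X Y) (f g : smap K X) :
  (forall n x, pi' n (phi n x) = pi n x) ->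
  nat_equiv_over pi k f g -> nat_equiv_over pi' k (scomp phi f) (scomp phi g).
Proof.
move=> phi_over /nat_equiv_overE [d [d_eq ds dt]].
have hP n (h : sfun_over pi k n) :
    lies_over pi' (scomp k (sfst K (simplex n))) (scomp phi (sval h)).
  by move=> l x; rewrite /= phi_over; apply: (svalP h).
have @post : smap (sfun_over pi k) (sfun_over pi' k).
  refine {| app := fun n (h : sfun_over pi k n) =>
    exist _ (scomp phi (sval h)) (hP n h) : sfun_over pi' k n |}.
  by move=> m n a h; apply: eq_exist; apply: smap_eq.
apply/nat_equiv_overE; exists (post 1 d); split; first exact: smap_equiv.
  have <- : scomp phi (fvert f) = fvert (scomp phi f) by apply: smap_eq.
  by rewrite -ds; apply: smap_eq.
have <- : scomp phi (fvert g) = fvert (scomp phi g) by apply: smap_eq.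
by rewrite -dt; apply: smap_eq.
Qed.

Lemma nat_equiv_over_pre L (l : smap L B) (j : smap L K) (f g : smap K X) :
  (forall n x, k n (j n x) = l n x) ->
  nat_equiv_over pi k f g -> nat_equiv_over pi l (scomp f j) (scomp g j).
Proof.
move=> jk /nat_equiv_overE [d [d_eq ds dt]].
have hP n (h : sfun_over pi k n) : lies_over pi (scomp l (sfst L (simplex n)))
    (scomp (sval h) (sprod_map j (sid (simplex n)))).
  by move=> m x; rewrite /= (svalP h) /= jk.
have @pre : smap (sfun_over pi k) (sfun_over pi l).
  refine {| app := fun n (h : sfun_over pi k n) =>
    exist _ (scomp (sval h) (sprod_map j (sid (simplex n)))) (hP n h) : sfun_over pi l n |}.
  by move=> m n a h; apply: eq_exist; apply: smap_eq.
apply/nat_equiv_overE; exists (pre 1 d); split; first exact: smap_equiv.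
  have <- : scomp (fvert f) (sprod_map j (sid _)) = fvert (scomp f j) by apply: smap_eq.
  by rewrite -ds; apply: smap_eq.
have <- : scomp (fvert g) (sprod_map j (sid _)) = fvert (scomp g j) by apply: smap_eq.
by rewrite -dt; apply: smap_eq.
Qed.
End NatEquivOverFunctor.

(** * The nerve of pointed finite sets *)

(* Pointed maps are encoded by partial functions on [nat], which do not depend
   on the source and the target, so that morphisms between objects which are
   only provably equal can be compared. *)
Definition fenc m n (f : fhom m n) (x : nat) : option nat :=
  if insub x is Some i then omap val (f (Some i)) else None.

Definition fdec m n (F : nat -> option nat) : fhom m n :=
  FHom (ffunc := fun o : option 'I_m => if o is Some i then obind insub (F i) else None)
       erefl.

Lemma fencE m n (f : fhom m n) (i : 'I_m) : fenc f i = omap val (f (Some i)).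
Proof. by rewrite /fenc valK. Qed.

Lemma fenc_lt m n (f : fhom m n) x y : fenc f x = Some y -> x < m /\ y < n.
Proof. by rewrite /fenc; case: insubP => // i im _; case: (f _) => //= j [<-]. Qed.

Lemma fenc_id m x : x < m -> fenc (fid m) x = Some x.
Proof. by move=> xm; rewrite /fenc insubT. Qed.

Lemma fenc_comp l m n (g : fhom m n) (f : fhom l m) x :
  fenc (fcomp g f) x = obind (fenc g) (fenc f x).
Proof.
rewrite /fenc; case: insubP => // i _ _ /=; case: (f _) => [j|] /=.
  by rewrite valK.
by rewrite ffunc0.
Qed.

Lemma fenc_inj m n (f g : fhom m n) : (forall x, x < m -> fenc f x = fenc g x) -> f = g.
Proof.
move=> e; apply: fhom_eq; apply: funext => -[i|]; last by rewrite !ffunc0.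
have := e i (ltn_ord i); rewrite !fencE.
by case: (f _) (g _) => [a|] [b|] //= [/val_inj ->].
Qed.

Lemma fencK m n F x : x < m -> (forall y, F x = Some y -> y < n) ->
  fenc (fdec m n F) x = F x.
Proof.
move=> xm FP; rewrite /fenc insubT /=; case E: (F x) => [y|] //=.
by have yn := FP _ E; rewrite insubT.
Qed.

Lemma activeE m n (f : fhom m n) : active f <-> forall x, x < m -> fenc f x <> None.
Proof.
split=> [fa x xm|h [i|] //].
  by rewrite -[x]/(val (Ordinal xm)) fencE; case E: (f _) => //; have := fa _ E.
by move=> fi; have := h i (ltn_ord i); rewrite fencE fi.
Qed.

(** No proof of [i <= j] is an argument; for [i > j] the value is junk. *)
Definition mor n (t : NFin n) (i j : 'I_n.+1) (x : nat) : option nat :=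
  if pselect (i <= j) is left h then fenc (cmor t h) x else None.

Lemma morE n (t : NFin n) (i j : 'I_n.+1) (h : i <= j) x : mor t i j x = fenc (cmor t h) x.
Proof. by rewrite /mor; case: pselect => // h'; rewrite (bool_irrelevance h' h). Qed.

Lemma mor_restr m n (a : mono m n) (t : NFin n) (i j : 'I_m.+1) :
  i <= j -> mor (restr a t) i j = mor t (a i) (a j).
Proof.
by move=> ij; apply: funext => x; rewrite (morE _ ij) (morE t (mfunP a ij)).
Qed.

Lemma mor_lt n (t : NFin n) (i j : 'I_n.+1) x y :
  mor t i j x = Some y -> x < cob t i /\ y < cob t j.
Proof. by rewrite /mor; case: pselect => // h /fenc_lt. Qed.

Lemma mor_id n (t : NFin n) (i : 'I_n.+1) x : x < cob t i -> mor t i i x = Some x.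
Proof. by move=> xi; rewrite (morE t (leqnn i)) cmor_id fenc_id. Qed.

Lemma mor_cmp n (t : NFin n) (i j k : 'I_n.+1) x : i <= j -> j <= k ->
  mor t i k x = obind (mor t j k) (mor t i j x).
Proof.
move=> ij jk; rewrite (morE t (leq_trans ij jk)) (cmor_cmp t ij jk) fenc_comp (morE t ij).
by case: (fenc _ x) => //= y; rewrite (morE t jk).
Qed.

Lemma chain_ext n (t t' : NFin n) : (forall i, cob t i = cob t' i) ->
  (forall (i j : 'I_n.+1) x, i <= j -> x < cob t i -> mor t i j x = mor t' i j x) -> t = t'.
Proof.
case: t t' => [b m m1 m2] [b' m' m1' m2'] /= /funext e; case: _ / e m' m1' m2'.
move=> m' m1' m2' em.
have e : m = m'.
  apply: functional_extensionality_dep => i; apply: functional_extensionality_dep => j.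
  apply: functional_extensionality_dep => h; apply: fenc_inj => x xi.
  by have := em i j x h xi; rewrite !(morE _ h).
case: _ / e m1' m2' {em} => m1' m2'.
by rewrite (Prop_irrelevance m1 m1') (Prop_irrelevance m2 m2').
Qed.

Lemma chain_build n (b : 'I_n.+1 -> nat) (mr : 'I_n.+1 -> 'I_n.+1 -> nat -> option nat) :
  (forall i x, x < b i -> mr i i x = Some x) ->
  (forall (i j : 'I_n.+1) x y, i <= j -> x < b i -> mr i j x = Some y -> y < b j) ->
  (forall (i j k : 'I_n.+1) x, i <= j -> j <= k -> x < b i ->
     mr i k x = obind (mr j k) (mr i j x)) ->
  exists t : NFin n, (forall i, cob t i = b i) /\
    forall (i j : 'I_n.+1) x, i <= j -> x < b i -> mor t i j x = mr i j x.
Proof.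
move=> m1 mlt mc.
pose m (i j : 'I_n.+1) (h : i <= j) : fhom (b i) (b j) := fdec (b i) (b j) (mr i j).
have mE (i j : 'I_n.+1) (h : i <= j) x : x < b i -> fenc (m i j h) x = mr i j x.
  by move=> xi; apply: fencK => // y; apply: mlt.
have h1 (i : 'I_n.+1) (h : i <= i) : m i i h = fid (b i).
  by apply: fenc_inj => x xi; rewrite mE // fenc_id // m1.
have h2 (i j k : 'I_n.+1) (hij : i <= j) (hjk : j <= k) (hik : i <= k) :
    m i k hik = fcomp (m j k hjk) (m i j hij).
  apply: fenc_inj => x xi; rewrite fenc_comp !mE // (mc i j k) //.
  by case E: (mr i j x) => [y|] //=; rewrite mE //; apply: mlt E.
exists (@Chain FinPt n b m h1 h2); split=> // i j x ij xi.
by rewrite (morE _ ij) /= mE.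
Qed.

(** * The arrow category of pointed sets: simplices as two chains [ev] joined by vertical maps
    [vert] *)

Definition vert n (T : FunArr n) (i : 'I_n.+1) : nat -> option nat :=
  mor (T 1 (mid 1, mconst 1 i)) ord0 ord_max.

Definition ev (e : 'I_2) n (T : FunArr n) : NFin n := T n (mconst n e, mid n).

Lemma eq_ord2 (i : 'I_2) : i = if i == ord0 then ord0 else ord_max.
Proof. by case: i => [[|[|i]] ?] //; apply: val_inj. Qed.

Section FunArr.
Variables (n : nat).

Lemma arr_cob (T : FunArr n) k (a : mono k 1) (b : mono k n) r :
  cob (T k (a, b)) r = cob (ev (a r) T) (b r).
Proof.
transitivity (cob (restr (mconst 0 r) (T k (a, b))) ord0) => //.
rewrite -app_nat /= !mcomp_const.
transitivity (cob (restr (mconst 0 (b r)) (ev (a r) T)) ord0) => //.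
by rewrite /ev -app_nat /= !mcomp_const.
Qed.

Lemma mor_edge k (t : NFin k) (i j : 'I_k.+1) (h : i <= j) :
  mor t i j = mor (restr (medge h) t) ord0 ord_max.
Proof. by apply: funext => x; rewrite mor_restr. Qed.

Lemma arr_mor_const (T : FunArr n) k (a : mono k 1) (b : mono k n) (r r' : 'I_k.+1) :
  r <= r' -> a r = a r' -> mor (T k (a, b)) r r' = mor (ev (a r) T) (b r) (b r').
Proof.
move=> rr e; rewrite (mor_edge _ rr) (mor_edge _ (mfunP b rr)) /ev -!app_nat /=.
congr (mor (T 1 (_, _)) _ _); apply: mono_eq => -[[|t] ?] //=.
Qed.

Let ord1_3 : 'I_3 := lift ord0 ord0.

(** The diagonal of the square over [i <= j] is the edge 02 of the triangle through (1, i); in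
    [arr_mor_square0] it is that of the triangle through (0, j). Together they give the naturality
    [vert_nat]. *)
Lemma arr_mor_square1 (T : FunArr n) (i j : 'I_n.+1) (h : i <= j) x :
  mor (T 1 (mid 1, medge h)) ord0 ord_max x = obind (mor (ev ord_max T) i j) (vert T i x).
Proof.
pose s c : mono 2 1 := Mono (@step_funP c).
pose U := T 2 (s 0, mcomp (medge h) (s 1)).
have e02 : mor (T 1 (mid 1, medge h)) ord0 ord_max = mor U ord0 ord_max.
  rewrite (@mor_edge _ U _ _ (leq0n _ : ord0 <= ord_max)) -app_nat.
  by congr (mor (T 1 (_, _)) _ _); apply: mono_eq => -[[|[|t]] ?] //; apply: val_inj.
have e01 : vert T i = mor U ord0 ord1_3.
  rewrite (@mor_edge _ U _ _ (leq0n _ : ord0 <= ord1_3)) -app_nat.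
  by congr (mor (T 1 (_, _)) _ _); apply: mono_eq => -[[|[|t]] ?] //; apply: val_inj.
have e12 : mor (ev ord_max T) i j = mor U ord1_3 ord_max.
  rewrite [RHS]arr_mor_const; [|by []|by apply: val_inj].
  by congr (mor (ev _ T) _ _); apply: val_inj.
by rewrite e02 e01 e12 -mor_cmp.
Qed.

Lemma arr_mor_square0 (T : FunArr n) (i j : 'I_n.+1) (h : i <= j) x :
  mor (T 1 (mid 1, medge h)) ord0 ord_max x = obind (vert T j) (mor (ev ord0 T) i j x).
Proof.
pose s c : mono 2 1 := Mono (@step_funP c).
pose U := T 2 (s 1, mcomp (medge h) (s 0)).
have e02 : mor (T 1 (mid 1, medge h)) ord0 ord_max = mor U ord0 ord_max.
  rewrite (@mor_edge _ U _ _ (leq0n _ : ord0 <= ord_max)) -app_nat.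
  by congr (mor (T 1 (_, _)) _ _); apply: mono_eq => -[[|[|t]] ?] //; apply: val_inj.
have e12 : vert T j = mor U ord1_3 ord_max.
  rewrite (@mor_edge _ U ord1_3 ord_max isT) -app_nat.
  by congr (mor (T 1 (_, _)) _ _); apply: mono_eq => -[[|[|t]] ?] //; apply: val_inj.
have e01 : mor (ev ord0 T) i j = mor U ord0 ord1_3.
  rewrite [RHS]arr_mor_const; [|by []|by apply: val_inj].
  by congr (mor (ev _ T) _ _); apply: val_inj.
by rewrite e02 e01 e12 -mor_cmp.
Qed.

Lemma arr_mor_up (T : FunArr n) k (a : mono k 1) (b : mono k n) (r r' : 'I_k.+1) x :
  r <= r' -> a r = ord0 -> a r' = ord_max ->
  mor (T k (a, b)) r r' x = obind (mor (ev ord_max T) (b r) (b r')) (vert T (b r) x).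
Proof.
move=> rr a0 a1; rewrite (mor_edge _ rr) -app_nat -(arr_mor_square1 T (mfunP b rr)) /=.
congr (mor (T 1 (_, _)) _ _ x); apply: mono_eq => -[[|[|t]] ?] //=; rewrite ?a0 ?a1 //;
by apply: val_inj.
Qed.

Lemma arr_ext (T T' : FunArr n) : (forall e, ev e T = ev e T') ->
  (forall i x, x < cob (ev ord0 T) i -> vert T i x = vert T' i x) -> T = T'.
Proof.
move=> ee ve; apply: smap_eq => k [a b]; apply: chain_ext => [r|r r' x rr].
  by rewrite (arr_cob T a b) (arr_cob T' a b) ee.
rewrite (arr_cob T a b) => xr; case: (eqVneq (a r) (a r')) => [e|ne].
  by rewrite (arr_mor_const T b rr e) (arr_mor_const T' b rr e) ee.
have [a0 a1] : a r = ord0 /\ a r' = ord_max.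
  move: ne (mfunP a rr); case: (a r) (a r') => [[|[|u]] ?] [[|[|w]] ?] //= _ _.
  by split; apply: val_inj.
by rewrite (arr_mor_up T b x rr a0 a1) (arr_mor_up T' b x rr a0 a1) ee ve // -a0.
Qed.

(** On a simplex [(a, b)] of Delta^1 x Delta^n the chain follows [t0] as long as [a] is 0, crosses
    once by [vt], and then follows [t1]. The composition law across the crossing is the assumed
    naturality. *)
Lemma arr_build (t0 t1 : NFin n) (vt : 'I_n.+1 -> nat -> option nat) :
  (forall i x y, x < cob t0 i -> vt i x = Some y -> y < cob t1 i) ->
  (forall (i j : 'I_n.+1) x, i <= j -> x < cob t0 i ->
     obind (mor t1 i j) (vt i x) = obind (vt j) (mor t0 i j x)) ->
  exists T : FunArr n, [/\ ev ord0 T = t0, ev ord_max T = t1 &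
    forall i x, x < cob t0 i -> vert T i x = vt i x].
Proof.
move=> vlt vnat.
have ex k (z : sprod (simplex 1) (simplex n) k) : exists t : NFin k,
    (forall r, cob t r = if z.1 r == ord0 then cob t0 (z.2 r) else cob t1 (z.2 r)) /\
    (forall (r r' : 'I_k.+1) x, r <= r' -> x < cob t r -> mor t r r' x =
       if z.1 r' == ord0 then mor t0 (z.2 r) (z.2 r') x
       else if z.1 r == ord0 then obind (mor t1 (z.2 r) (z.2 r')) (vt (z.2 r) x)
       else mor t1 (z.2 r) (z.2 r') x).
  case: z => a b /=.
  have a_le (r r' : 'I_k.+1) : r <= r' -> a r' = ord0 -> a r = ord0.
    move=> /(mfunP a) rr e; rewrite e leqn0 in rr.
    by apply: val_inj; apply/eqP.
  pose ob r := if a r == ord0 then cob t0 (b r) else cob t1 (b r).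
  pose mr r r' x := if a r' == ord0 then mor t0 (b r) (b r') x
       else if a r == ord0 then obind (mor t1 (b r) (b r')) (vt (b r) x)
       else mor t1 (b r) (b r') x.
  have [r x|r r' x y rr|r r' r'' x rr rr'|t [tb tm]] := @chain_build k ob mr.
  - by rewrite /ob /mr; case: eqP => _ xr; rewrite mor_id.
  - rewrite /ob /mr; case: (eqVneq (a r') ord0) => [_ _ /mor_lt []//|_].
    case: eqP => _ _; last by move=> /mor_lt [].
    by case: (vt _ x) => //= z /mor_lt [].
  - rewrite /ob /mr; case: (eqVneq (a r'') ord0) => [e2|n2].
      rewrite (a_le _ _ rr' e2) eqxx => _.
      by rewrite (mor_cmp _ _ (mfunP b rr) (mfunP b rr')).
    case: (eqVneq (a r') ord0) => [e1|n1].
      rewrite (a_le _ _ rr e1) eqxx => xr.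
      transitivity (obind (mor t1 (b r') (b r''))
                     (obind (mor t1 (b r) (b r')) (vt (b r) x))).
        by case: (vt (b r) x) => //= z; rewrite (mor_cmp _ _ (mfunP b rr) (mfunP b rr')).
      by rewrite (vnat _ _ _ (mfunP b rr) xr); case: (mor t0 _ _ _).
    case: eqP => [e0|n0] xr; last by rewrite (mor_cmp _ _ (mfunP b rr) (mfunP b rr')).
    by case: (vt (b r) x) => //= z; rewrite (mor_cmp _ _ (mfunP b rr) (mfunP b rr')).
  by exists t; split=> // r r' x rr; rewrite tb; apply: tm.
pose c k z := sval (cid (ex k z)).
have cP k (z : sprod (simplex 1) (simplex n) k) :
    (forall r, cob (c k z) r = if z.1 r == ord0 then cob t0 (z.2 r) else cob t1 (z.2 r)) /\
    (forall (r r' : 'I_k.+1) x, r <= r' -> x < cob (c k z) r -> mor (c k z) r r' x =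
       if z.1 r' == ord0 then mor t0 (z.2 r) (z.2 r') x
       else if z.1 r == ord0 then obind (mor t1 (z.2 r) (z.2 r')) (vt (z.2 r) x)
       else mor t1 (z.2 r) (z.2 r') x) := svalP (cid (ex k z)).
have c_nat k l (a : mono k l) z : c k (restr a z) = restr a (c l z).
  apply: chain_ext => [r|r r' x rr]; first by rewrite (cP k _).1 /= (cP l z).1.
  rewrite (cP k _).1 => xr; rewrite (cP k _).2 ?(cP k _).1 // mor_restr //.
  by rewrite (cP l z).2 ?(mfunP a) // (cP l z).1.
pose T : FunArr n := {| app := c; app_nat := c_nat |}.
have T0 : ev ord0 T = t0.
  apply: chain_ext => [r|r r' x rr]; first by rewrite /= (cP n _).1 /=.
  by rewrite /= (cP n _).1 /= => xr; rewrite (cP n _).2 //= (cP n _).1.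
have T1 : ev ord_max T = t1.
  apply: chain_ext => [r|r r' x rr]; first by rewrite /= (cP n _).1 /=.
  by rewrite /= (cP n _).1 /= => xr; rewrite (cP n _).2 //= (cP n _).1.
exists T; split=> // i x xi; rewrite /vert /= (cP 1 _).2 ?(cP 1 _).1 //=.
by case E: (vt i x) => [y|] //=; rewrite mor_id //; apply: vlt E.
Qed.
End FunArr.

Lemma vert_restr m n (a : mono m n) (T : FunArr n) i : vert (restr a T) i = vert T (a i).
Proof. by rewrite /vert /= mcomp_const. Qed.

Lemma arr_active n (T : FunArr n) :
  funact_pred T <-> forall i x, x < cob (ev ord0 T) i -> vert T i x <> None.
Proof.
have b0 i : cob (T 1 (mid 1, mconst 1 i)) ord0 = cob (ev ord0 T) i.
  exact: (arr_cob T (mid 1) (mconst 1 i) ord0).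
have vE i x : vert T i x = fenc (edge_hom (T 1 (mid 1, mconst 1 i))) x.
  by rewrite /vert (morE _ (leq0n _ : ord0 <= ord_max)).
split=> [h i x xi|h i].
  by rewrite vE; apply: ((activeE _).1 (h i)); rewrite b0.
by apply/activeE => x xi; rewrite -vE; apply: h; rewrite -b0.
Qed.

Lemma vert_lt n (T : FunArr n) i x y : vert T i x = Some y ->
  x < cob (ev ord0 T) i /\ y < cob (ev ord_max T) i.
Proof.
move=> /mor_lt [].
by rewrite (arr_cob T (mid 1) (mconst 1 i) ord0) (arr_cob T (mid 1) (mconst 1 i) ord_max).
Qed.

Lemma vert_nat n (T : FunArr n) (i j : 'I_n.+1) x : i <= j ->
  obind (mor (ev ord_max T) i j) (vert T i x) = obind (vert T j) (mor (ev ord0 T) i j x).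
Proof. by move=> ij; rewrite -(arr_mor_square1 T ij) arr_mor_square0. Qed.

(** * Extending horns in the nerve of pointed finite sets *)

Section HornChain.
Variables (n : nat) (j : 'I_n.+1) (t : smap (horn j) NFin).
Hypothesis n1 : 1 < n.

Definition hob (i : 'I_n.+1) : nat :=
  if pselect (horn_pred j (mconst 0 i)) is left h then cob (t 0 (exist _ _ h)) ord0 else 0.

(** For [i <= i'] the value is junk only at the edge opposite [j] when [n = 2]. *)
Definition hmor (i i' : 'I_n.+1) (x : nat) : option nat :=
  if pselect (exists h : i <= i', horn_pred j (medge h)) is left h
  then mor (t 1 (exist (@horn_pred n j 1) (medge (sval (cid h))) (svalP (cid h)))) ord0 ord_max x else None.

Lemma hobE k (s : horn j k) r : cob (t k s) r = hob (sval s r).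
Proof.
rewrite /hob; case: pselect => [h|[]]; last first.
  by case: (svalP s) => l lj sl; exists l => // u; apply: sl.
transitivity (cob (restr (mconst 0 r) (t k s)) ord0) => //; rewrite -app_nat.
by congr (cob (t 0 _) _); apply: sub_eq; rewrite /= mcomp_const.
Qed.

Lemma hmorE k (s : horn j k) (r r' : 'I_k.+1) :
  r <= r' -> mor (t k s) r r' = hmor (sval s r) (sval s r').
Proof.
move=> rr; apply: funext => x; rewrite /hmor; case: pselect => [h|[]]; last first.
  exists (mfunP (sval s) rr); case: (svalP s) => l lj sl; exists l => // u.
  by rewrite /= /edge_fun; case: (nat_of_ord u).
rewrite (mor_edge _ rr) -app_nat; congr (mor (t 1 _) _ _ x); apply: sub_eq => /=.
by apply: mono_eq => -[[|u] ?].
Qed.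

Lemma hmor_lt i i' x y : hmor i i' x = Some y -> x < hob i /\ y < hob i'.
Proof.
rewrite /hmor; case: pselect => // h /mor_lt []; rewrite !hobE /=.
by [].
Qed.

Definition mtri_fun (i0 i1 i2 : 'I_n.+1) (u : 'I_3) : 'I_n.+1 :=
  match val u with 0 => i0 | 1 => i1 | _ => i2 end.

Lemma mtriP (i0 i1 i2 : 'I_n.+1) (h : i0 <= i1) (h' : i1 <= i2) (u v : 'I_3) :
  u <= v -> mtri_fun i0 i1 i2 u <= mtri_fun i0 i1 i2 v.
Proof.
by case: u v => [[|[|[|u]]] ?] [[|[|[|v]]] ?] //= _; rewrite /mtri_fun /=; lia.
Qed.

(** A triangle belongs to the horn if it misses a vertex [l] other than [j]. Such an [l] has to be
    produced for each composition; for [n <= 3] some triangles have none. *)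
Lemma hmor_cmp (i0 i1 i2 l : 'I_n.+1) x : i0 <= i1 -> i1 <= i2 -> l != j ->
  i0 != l -> i1 != l -> i2 != l ->
  hmor i0 i2 x = obind (hmor i1 i2) (hmor i0 i1 x).
Proof.
move=> h h' lj l0 l1 l2.
have sP : horn_pred j (Mono (mtriP h h')).
  by exists l => // u; rewrite /= /mtri_fun; case: (val u) => [|[|]].
pose o : 'I_3 := lift ord0 ord0.
have := @mor_cmp 2 (t 2 (exist _ _ sP)) ord0 o ord_max x (leq0n _) isT.
by rewrite !hmorE.
Qed.

Lemma hmor_id i x : x < hob i -> hmor i i x = Some x.
Proof.
move=> xi; have [l lj li] : exists2 l : 'I_n.+1, l != j & i != l.
  have n2 : n = n.-2.+2 by lia.
  have o0 : 0 < n.+1 by []. have o1 : 1 < n.+1 by lia. have o2 : 2 < n.+1 by lia.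
  pose c0 := Ordinal o0; pose c1 := Ordinal o1; pose c2 := Ordinal o2.
  case: (boolP ((c0 != j) && (i != c0))) => [/andP []|h0]; first by exists c0.
  case: (boolP ((c1 != j) && (i != c1))) => [/andP []|h1]; first by exists c1.
  by exists c2; move: h0 h1; rewrite -!val_eqE /=; lia.
have sP : horn_pred j (mconst 0 i) by exists l.
have := @mor_id 0 (t 0 (exist _ _ sP)) ord0 x.
by rewrite hobE hmorE //=; apply.
Qed.

Lemma chain_agree (t0 : NFin n) : (forall i, cob t0 i = hob i) ->
  (forall k (s : horn j k) (r r' : 'I_k.+1) x, r <= r' -> x < hob (sval s r) ->
     mor t0 (sval s r) (sval s r') x = hmor (sval s r) (sval s r') x) ->
  forall k (s : horn j k), restr (sval s) t0 = t k s.
Proof.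
move=> tb tm k s; apply: chain_ext => [r|r r' x rr]; first by rewrite hobE -tb.
by rewrite [cob _ _]tb => xr; rewrite mor_restr // hmorE // tm.
Qed.

(* Both [0, j] and [j, n] miss a vertex other than [j]. *)
Lemma chain_horn_inner : 0 < j < n ->
  exists t0 : NFin n, forall k (s : horn j k), restr (sval s) t0 = t k s.
Proof.
move=> /andP [j0 jn].
have cmp_lo (i0 i1 i2 : 'I_n.+1) x : i0 <= i1 -> i1 <= i2 -> i2 <= j ->
    hmor i0 i2 x = obind (hmor i1 i2) (hmor i0 i1 x).
  by move=> h h' h2; apply: (@hmor_cmp _ _ _ ord_max) => //; rewrite -val_eqE /=; lia.
have cmp_hi (i0 i1 i2 : 'I_n.+1) x : i0 <= i1 -> i1 <= i2 -> j <= i0 ->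
    hmor i0 i2 x = obind (hmor i1 i2) (hmor i0 i1 x).
  by move=> h h' h2; apply: (@hmor_cmp _ _ _ ord0) => //; rewrite -val_eqE /=; lia.
(* A morphism across [j] is defined as the composite through [j], since the horn may lack the edge
   or the composition law. On the cells of the horn [hmor_cmp] shows that nothing has changed. *)
pose mr (i i' : 'I_n.+1) x :=
  if (i < j) && (j < i') then obind (hmor j i') (hmor i j x) else hmor i i' x.
have mrE (i i' : 'I_n.+1) x : i <= j -> j <= i' -> x < hob i ->
    mr i i' x = obind (hmor j i') (hmor i j x).
  rewrite /mr => ij ji' xi; case: (ltngtP i j) ij => // [ij|/val_inj ij] _ /=.
    case: (ltngtP j i') ji' => //= /val_inj <- _.
    by case E: (hmor i j x) => [y|] //=; rewrite hmor_id //; have [] := hmor_lt E.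
  by rewrite -ij hmor_id.
have mr_hi (i i' : 'I_n.+1) x : j <= i -> mr i i' x = hmor i i' x.
  by rewrite /mr ltnNge => ->.
have mr_lo (i i' : 'I_n.+1) x : i' <= j -> mr i i' x = hmor i i' x.
  by rewrite /mr (ltnNge j) => ->; rewrite andbF.
have [i x xi|i i' x y ii' xi|i i' i'' x ii' ii'' xi|t0 [tb tm]] := @chain_build n hob mr.
- by rewrite /mr hmor_id //; case: ifP => //; lia.
- rewrite /mr; case: ifP => _; last by move=> /hmor_lt [].
  by case: (hmor i j x) => //= z /hmor_lt [].
- case: (leqP i j) => ij; last first.
    have ji := ltnW ij; rewrite !(mr_hi i _ _ ji) (cmp_hi _ _ _ x ii' ii'' ji).
    by case: (hmor i i' x) => //= y; rewrite mr_hi // (leq_trans ji).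
  case: (leqP j i'') => ji''; last first.
    have h1 := ltnW ji''; have h2 := leq_trans ii'' h1.
    rewrite (mr_lo i i'' x h1) (mr_lo i i' x h2) (@cmp_lo i i' i'') //.
    by case: (hmor i i' x) => //= y; rewrite (mr_lo i' i'' y h1).
  rewrite mrE //; case: (leqP i' j) => i'j.
    rewrite (@cmp_lo i i' j) // mr_lo //.
    by case E: (hmor i i' x) => [y|] //=; rewrite mrE //; have [] := hmor_lt E.
  rewrite (mrE _ _ _ ij (ltnW i'j) xi); case: (hmor i j x) => //= y.
  rewrite (cmp_hi _ _ _ y (ltnW i'j) ii'' (leqnn j)); case: (hmor j i' y) => //= z.
  by rewrite mr_hi // ltnW.
exists t0; apply: chain_agree => // k s r r' x rr xr.
rewrite tm ?(mfunP (sval s)) // /mr; case: ifP => // /andP [rj jr].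
case: (svalP s) => l lj sl; have jl : j != l by rewrite eq_sym.
by rewrite (hmor_cmp x (ltnW rj) (ltnW jr) lj (sl r) jl (sl r')).
Qed.

Let v1 : 'I_n.+1 := Ordinal (ltnW n1 : 1 < n.+1).

(** The map from vertex 0 to vertex 1 is a bijection from the elements it does not kill, with
    inverse [sigma]. A map out of vertex 0 that kills the remaining elements factors uniquely
    through it, which forces the maps out of vertex 1. The second conclusion records these, as for
    [n = 2] the edge opposite 0 is not in the horn. *)
Lemma chain_horn_outer (sigma : nat -> nat) : j = ord0 ->
  (forall y, y < hob v1 -> sigma y < hob ord0 /\ hmor ord0 v1 (sigma y) = Some y) ->
  (forall x x' y, hmor ord0 v1 x = Some y -> hmor ord0 v1 x' = Some y -> x = x') ->
  (forall (i : 'I_n.+1) x, v1 < i -> x < hob ord0 ->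
     hmor ord0 v1 x = None -> hmor ord0 i x = None) ->
  exists t0 : NFin n, (forall k (s : horn j k), restr (sval s) t0 = t k s) /\
    forall (i : 'I_n.+1) y, v1 < i -> y < hob v1 -> mor t0 v1 i y = hmor ord0 i (sigma y).
Proof.
move=> j0 sP inj kill.
pose mr (i i' : 'I_n.+1) x :=
  if (i == v1) && (v1 < i') then hmor ord0 i' (sigma x) else hmor i i' x.
have v1j : v1 != j by rewrite j0 -val_eqE.
have key (i : 'I_n.+1) x : v1 < i -> x < hob ord0 ->
    obind (mr v1 i) (hmor ord0 v1 x) = hmor ord0 i x.
  move=> vi xi; case E: (hmor ord0 v1 x) => [y|] /=; last by rewrite kill.
  have [_ yv] := hmor_lt E; have [_ sy] := sP y yv.
  by rewrite /mr eqxx vi /= (inj _ _ _ E sy).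
have cmp1 (i0 i1 i2 : 'I_n.+1) x : i0 <= i1 -> i1 <= i2 -> i0 != v1 -> i1 != v1 ->
    i2 != v1 -> hmor i0 i2 x = obind (hmor i1 i2) (hmor i0 i1 x).
  by move=> h h' n0 n1' n2; apply: (@hmor_cmp _ _ _ v1).
have mr_ne (i i' : 'I_n.+1) x : i != v1 -> mr i i' x = hmor i i' x.
  by rewrite /mr => /negPf ->.
have gt1 (i : 'I_n.+1) : v1 < i -> i != v1.
  by move=> vi; rewrite -val_eqE neq_ltn vi orbT.
have [i x xi|i i' x y ii' xi|i i' i'' x ii' ii'' xi|t0 [tb tm]] := @chain_build n hob mr.
- by rewrite /mr hmor_id //; case: eqP => // ->; rewrite ltnn.
- by rewrite /mr; case: ifP => _ /hmor_lt [].
- case: (eqVneq i' v1) => [e'|ne'].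
    subst i'; case: (eqVneq i'' v1) => [e''|ne''].
      subst i''; have -> : mr i v1 x = hmor i v1 x by rewrite /mr ltnn andbF.
      case E: (hmor i v1 x) => [y|] //=; rewrite /mr ltnn andbF hmor_id //.
      by have [] := hmor_lt E.
    have vi'' : v1 < i'' by rewrite ltn_neqAle ii'' andbT eq_sym.
    case: (eqVneq i v1) => [e|ne].
      have mr11 : mr v1 v1 x = Some x by rewrite /mr ltnn andbF hmor_id // -e.
      by rewrite e mr11.
    have e : i = ord0.
      by apply: val_inj; move: ii' ne; rewrite -val_eqE /=; case: (val i) => [|[]].
    by rewrite !(mr_ne i) //; subst i; rewrite -(key _ _ vi'').
  case: (eqVneq i'' v1) => [e''|ne''].
    subst i''; have i'0 : i' = ord0.
      by apply: val_inj; move: ii'' ne'; rewrite -val_eqE /=; case: (val i') => [|[]].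
    subst i'; have -> : i = ord0 by apply: val_inj; apply/eqP; rewrite -leqn0.
    move: xi; have -> : i = ord0 by apply: val_inj; apply/eqP; rewrite -leqn0.
    by move=> xi; rewrite !mr_ne // hmor_id.
  case: (eqVneq i v1) => [e|ne].
    subst i; have v' : v1 < i' by rewrite ltn_neqAle ii' andbT eq_sym.
    have v'' : v1 < i'' by apply: leq_trans v' ii''.
    have mr1 (i : 'I_n.+1) : v1 < i -> mr v1 i x = hmor ord0 i (sigma x).
      by rewrite /mr eqxx => ->.
    rewrite !mr1 // (cmp1 ord0 i' i'' _ (leq0n _) ii'' isT ne' ne'').
    by case: (hmor ord0 i' _) => //= y; rewrite mr_ne.
  rewrite !(mr_ne i) // (cmp1 _ _ _ x ii' ii'') //.
  by case: (hmor i i' x) => //= y; rewrite mr_ne.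
exists t0; split=> [|i y vi yv]; last first.
  by rewrite (tm v1 i y (ltnW vi) yv) /mr eqxx vi.
apply: chain_agree => // k s r r' x rr xr.
rewrite tm ?(mfunP (sval s)) // /mr; case: ifP => // /andP [/eqP rv vr].
case: (svalP s) => l lj sl; rewrite rv in xr *; have [_ sx] := sP x xr.
have l0 : ord0 != l by rewrite eq_sym -j0.
have lv : v1 != l by rewrite -rv sl.
by rewrite (hmor_cmp _ (leq0n _ : ord0 <= v1) (ltnW vr) lj l0 lv (sl r')) sx.
Qed.
End HornChain.

(** * Cocartesian morphisms of the monoidal envelope *)

Lemma inert_enc m n (f : fhom m n) : inert f ->
  (forall y, y < n -> exists x, x < m /\ fenc f x = Some y) /\
  (forall x x' y, fenc f x = Some y -> fenc f x' = Some y -> x = x').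
Proof.
move=> f_inert; split=> [y yn|x x' y].
  have [[x|] [fx _]] := f_inert (Ordinal yn); last by rewrite ffunc0 in fx.
  by exists x; rewrite fencE fx.
move=> e e'; have [xm yn] := fenc_lt e; have [xm' _] := fenc_lt e'.
have [z [_ zu]] := f_inert (Ordinal yn).
have key w (wm : w < m) : fenc f w = Some y -> z = Some (Ordinal wm).
  rewrite -[w]/(val (Ordinal wm)) fencE => E; apply: zu.
  by case: (f _) E => //= a [ay]; congr Some; apply: val_inj.
by have := key _ xm e; rewrite (key _ xm' e') => -[].
Qed.

Lemma ev_restr m n (a : mono m n) (T : FunArr n) e : ev e (restr a T) = restr a (ev e T).
Proof. by rewrite /ev -app_nat. Qed.

Lemma simplex_app Y n (v : smap (simplex n) Y) k (s : simplex n k) :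
  v k s = restr s (v n (mid n)).
Proof. exact: (app_nat v s (mid n : simplex n n)). Qed.

Section Env.
Variables (C M : sset) (p : smap M (sprod C NFin)).

Definition env_obj : smap (Env p) M :=
  {| app := fun n (x : Env p n) => (sval x).1; app_nat := fun m n a x => erefl |}.

Definition env_arr : smap (Env p) FunArr :=
  {| app := fun n (x : Env p n) => sval (sval x).2; app_nat := fun m n a x => erefl |}.

Lemma env_ev0 n (x : Env p n) : ev ord0 (env_arr n x) = (p n (env_obj n x)).2.
Proof. exact: esym (svalP x). Qed.

Lemma env_active n (x : Env p n) : funact_pred (env_arr n x).
Proof. exact: (svalP (sval x).2). Qed.

Lemma env_ext n (x y : Env p n) :
  env_obj n x = env_obj n y -> env_arr n x = env_arr n y -> x = y.
Proof.
case: x y => [[x1 [x2 ?]] ?] [[y1 [y2 ?]] ?] /= e1 e2.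
by apply: eq_exist; congr pair; [exact: e1 | apply: eq_exist; exact: e2].
Qed.

Lemma env_build n (y : M n) (T : FunArr n) : ev ord0 T = (p n y).2 -> funact_pred T ->
  exists x : Env p n, env_obj n x = y /\ env_arr n x = T.
Proof.
move=> e a; have e' : scomp (ssnd C NFin) p n y = eval ord0 n (exist _ T a) by rewrite /= -e.
by exists (exist _ (y, exist _ T a) e').
Qed.

Lemma env_projE n (x : Env p n) :
  Env_proj p n x = ((p n (env_obj n x)).1, ev ord_max (env_arr n x)).
Proof. by []. Qed.

Section Horn.
Variables (n : nat) (j : 'I_n.+1) (u : smap (horn j) (Env p)).
Variable v : smap (simplex n) (sprod C NFin).
Hypothesis n1 : 1 < n.
Hypothesis uv : forall k s, Env_proj p k (u k s) = v k (sval s).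

Let t : smap (horn j) NFin := scomp (ssnd C NFin) (scomp p (scomp env_obj u)).
Let t1 : NFin n := (v n (mid n)).2.
Let vt (i : 'I_n.+1) : nat -> option nat :=
  if pselect (horn_pred j (mconst 0 i)) is left h
  then vert (env_arr 0 (u 0 (exist (@horn_pred n j 0) (mconst 0 i) h))) ord0
  else fun=> None.

Let vertex (i : 'I_n.+1) : horn_pred j (mconst 0 i : simplex n 0).
Proof.
have o1 : 1 < n.+1 by apply: ltnW. have o2 : 2 < n.+1 by [].
case: (boolP ((ord0 != j) && (i != ord0))) => [/andP []|h0]; first by exists ord0.
case: (boolP ((Ordinal o1 != j) && (i != Ordinal o1))) => [/andP []|h1].
  by exists (Ordinal o1).
by exists (Ordinal o2) => [|r]; move: h0 h1; rewrite -!val_eqE /=; lia.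
Qed.

Let vtE k (s : horn j k) r : vert (env_arr k (u k s)) r = vt (sval s r).
Proof.
rewrite /vt; case: pselect => [h|[]]; last exact: vertex.
transitivity (vert (restr (mconst 0 r) (env_arr k (u k s))) ord0).
  by rewrite vert_restr.
rewrite -!app_nat; congr (vert (env_arr 0 (u 0 _)) _).
by apply: sub_eq; rewrite /= mcomp_const.
Qed.

Let ev1E k (s : horn j k) : ev ord_max (env_arr k (u k s)) = restr (sval s) t1.
Proof.
by have := congr1 snd (uv s); rewrite env_projE /= => ->; rewrite simplex_app.
Qed.

Let ev0E k (s : horn j k) : ev ord0 (env_arr k (u k s)) = t k s.
Proof. by rewrite env_ev0. Qed.

Let nat_edge (i i' : 'I_n.+1) (h : i <= i') x : horn_pred j (medge h) ->
  obind (mor t1 i i') (vt i x) = obind (vt i') (hmor t i i' x).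
Proof.
move=> hP; pose s : horn j 1 := exist _ (medge h) hP.
have := @vert_nat 1 (env_arr 1 (u 1 s)) ord0 ord_max x (leq0n _).
by rewrite ev1E ev0E mor_restr // !vtE hmorE.
Qed.

Let vt_active (i : 'I_n.+1) x : x < hob t i -> vt i x <> None.
Proof.
pose s : horn j 0 := exist _ (mconst 0 i : simplex n 0) (vertex i).
have := (arr_active (env_arr 0 (u 0 s))).1 (@env_active _ (u 0 s)) ord0 x.
by rewrite vtE ev0E hobE.
Qed.

Let vt_lt (i : 'I_n.+1) x y : vt i x = Some y -> x < hob t i /\ y < cob t1 i.
Proof.
pose s : horn j 0 := exist _ (mconst 0 i : simplex n 0) (vertex i).
have := @vert_lt _ (env_arr 0 (u 0 s)) ord0 x y.
by rewrite vtE ev0E ev1E hobE.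
Qed.

(** All vertices lie in the horn, so the vertical maps and their activity are given, and only
    naturality along new edges has to be supplied. Then there is an arrow from [t0] to [t1], and
    what remains is a lifting problem for [p] over the first component of [v] paired with [t0]. *)
Let extend (t0 : NFin n) : (forall k (s : horn j k), restr (sval s) t0 = t k s) ->
  (forall (i i' : 'I_n.+1) x, i <= i' -> x < cob t0 i ->
     obind (mor t1 i i') (vt i x) = obind (vt i') (mor t0 i i' x)) ->
  (forall w : smap (simplex n) (sprod C NFin),
     (forall k s, p k (env_obj k (u k s)) = w k (sval s)) ->
     exists h : smap (simplex n) M, (forall k s, h k (sval s) = env_obj k (u k s)) /\
       (forall k s, p k (h k s) = w k s)) ->
  exists h : smap (simplex n) (Env p), (forall k s, h k (sval s) = u k s) /\
       (forall k s, Env_proj p k (h k s) = v k s).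
Proof.
move=> t0E t_nat lift.
have cobE i : cob t0 i = hob t i.
  pose s : horn j 0 := exist _ (mconst 0 i : simplex n 0) (vertex i).
  by rewrite -[RHS](hobE t s ord0) -t0E.
have [|//|T [T0 T1 Tv]] := @arr_build n t0 t1 vt.
  by move=> i x y _ /vt_lt [].
have T_active : funact_pred T.
  apply/arr_active => i x; rewrite T0 => xi; rewrite Tv //.
  by apply: vt_active; rewrite -cobE.
have @w : smap (simplex n) (sprod C NFin).
  refine {| app := fun k (s : simplex n k) =>
    (((v k s).1, restr s t0) : sprod C NFin k) |}.
  by move=> k l a s; rewrite app_nat.
have [|h [h1 h2]] := lift w.
  move=> k s; rewrite [LHS]surjective_pairing; congr pair; last exact: esym (t0E k s).
  exact: (congr1 fst (uv s)).
have ex k (s : simplex n k) : exists x : Env p k,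
    env_obj k x = h k s /\ env_arr k x = restr s T.
  apply: env_build; first by rewrite h2 ev_restr T0.
  exact: funact_predP.
pose f k s := sval (cid (ex k s)).
have f1 k s : env_obj k (f k s) = h k s := (svalP (cid (ex k s))).1.
have f2 k s : env_arr k (f k s) = restr s T := (svalP (cid (ex k s))).2.
have f_nat k l (a : mono k l) (s : simplex n l) : f k (restr a s) = restr a (f l s).
  apply: env_ext; first by rewrite f1 !app_nat f1.
  by rewrite f2 app_nat f2 -restr_comp.
exists {| app := f; app_nat := f_nat |}; split=> k s.
  apply: env_ext; first by rewrite f1 h1.
  rewrite f2; apply: arr_ext => [e|i x].
    rewrite ev_restr (eq_ord2 e); case: ifP => _; first by rewrite T0 t0E ev0E.
    by rewrite T1 ev1E.
  rewrite ev_restr T0 => xi; rewrite vert_restr Tv ?vtE //.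
change (Env_proj p k (f k s) = v k s); rewrite env_projE f1 f2 h2 ev_restr T1.
rewrite [RHS]surjective_pairing; congr pair.
by rewrite (simplex_app v s).
Qed.

Let edge_horn (i i' l : 'I_n.+1) (h : i <= i') :
  l != j -> i != l -> i' != l -> horn_pred j (medge h).
Proof.
by move=> lj il i'l; exists l => // r; rewrite /= /edge_fun; case: (nat_of_ord r).
Qed.

Let hmor_extension (t0 : NFin n) (i i' : 'I_n.+1) (h : i <= i') :
  (forall k (s : horn j k), restr (sval s) t0 = t k s) -> horn_pred j (medge h) ->
  mor t0 i i' = hmor t i i'.
Proof.
move=> t0E hP; pose s : horn j 1 := exist _ (medge h) hP.
have : mor (restr (sval s) t0) ord0 ord_max = mor (t 1 s) ord0 ord_max by rewrite t0E.
by rewrite mor_restr // hmorE.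
Qed.

(** Naturality along an edge across [j] is obtained by pasting the squares on its two parts, both of
    which lie in the horn. *)
Lemma env_horn_inner : 0 < j < n -> inner_fibration p ->
  exists h : smap (simplex n) (Env p), (forall k s, h k (sval s) = u k s) /\
       (forall k s, Env_proj p k (h k s) = v k s).
Proof.
move=> hj p_inner; have [t0 t0E] := @chain_horn_inner n j t n1 hj.
apply: (extend t0E) => [i i' x ii' xi|w wE]; last exact: (p_inner n j hj (scomp env_obj u) w wE).
have {}edge (i0 i1 : 'I_n.+1) y (h : i0 <= i1) : horn_pred j (medge h) ->
    obind (mor t1 i0 i1) (vt i0 y) = obind (vt i1) (mor t0 i0 i1 y).
  by move=> hP; rewrite (hmor_extension t0E hP) (nat_edge _ hP).
have lo (i0 i1 : 'I_n.+1) (h : i0 <= i1) : i1 <= j -> horn_pred j (medge h).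
  by move=> h1; apply: (@edge_horn _ _ ord_max); rewrite -val_eqE /=; lia.
have hi (i0 i1 : 'I_n.+1) (h : i0 <= i1) : j <= i0 -> horn_pred j (medge h).
  by move=> h1; apply: (@edge_horn _ _ ord0); rewrite -val_eqE /=; lia.
case: (leqP i' j) => i'j; first by apply: (edge _ _ _ ii'); apply: lo.
case: (leqP j i) => ij; first by apply: (edge _ _ _ ii'); apply: hi.
have ij' := ltnW ij; have ji' := ltnW i'j.
transitivity (obind (mor t1 j i') (obind (mor t1 i j) (vt i x))).
  by case: (vt i x) => //= y; rewrite (mor_cmp _ _ ij' ji').
rewrite (edge _ _ _ ij' (lo _ _ ij' (leqnn j))) (mor_cmp _ _ ij' ji').
by case: (mor t0 i j x) => //= y; rewrite (edge _ _ _ ji' (hi _ _ ji' (leqnn j))).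
Qed.

Let v1 : 'I_n.+1 := Ordinal (ltnW n1 : 1 < n.+1).

Lemma env_horn_outer (e : Env p 1) : j = ord0 -> inert (edge_hom (p 1 (env_obj 1 e)).2) ->
  (forall s : horn j 1, sval s = @medge n ord0 v1 (leq0n _) -> u 1 s = e) ->
  (forall w : smap (simplex n) (sprod C NFin),
     (forall k s, p k (env_obj k (u k s)) = w k (sval s)) ->
     exists h : smap (simplex n) M, (forall k s, h k (sval s) = env_obj k (u k s)) /\
       (forall k s, p k (h k s) = w k s)) ->
  exists h : smap (simplex n) (Env p), (forall k s, h k (sval s) = u k s) /\
       (forall k s, Env_proj p k (h k s) = v k s).
Proof.
move=> j0 /inert_enc [surj inj] ue lift.
have le01 : (ord0 : 'I_n.+1) <= v1 by [].
have o2 : 2 < n.+1 by [].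
have edge0 (i : 'I_n.+1) (h : (ord0 : 'I_n.+1) <= i) : horn_pred j (medge h).
  case: (eqVneq i v1) => [e1|ne].
    by apply: (@edge_horn _ _ (Ordinal o2)); rewrite ?e1 ?j0 -?val_eqE.
  by apply: (@edge_horn _ _ v1); rewrite ?j0 -?val_eqE.
pose s01 : horn j 1 := exist _ (medge le01) (edge0 v1 le01).
have us : u 1 s01 = e by apply: ue; apply: mono_eq.
have hE : hmor t ord0 v1 = fenc (edge_hom (p 1 (env_obj 1 e)).2).
  apply: funext => x; have := hmorE t s01 (leq0n _ : ord0 <= (ord_max : 'I_2)).
  move=> /(congr1 (fun f => f x)) <-; rewrite (morE _ (leq0n _ : ord0 <= (ord_max : 'I_2))).
  by rewrite /t /= us.
have hob0 : hob t ord0 = cob (p 1 (env_obj 1 e)).2 ord0.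
  by rewrite -(hobE t s01 ord0) /t /= us.
have hob1 : hob t v1 = cob (p 1 (env_obj 1 e)).2 ord_max.
  by rewrite -(hobE t s01 ord_max) /t /= us.
have [sigma sP] : exists sigma : nat -> nat, forall y, y < hob t v1 ->
    sigma y < hob t ord0 /\ hmor t ord0 v1 (sigma y) = Some y.
  have ex y : exists x, y < hob t v1 -> x < hob t ord0 /\ hmor t ord0 v1 x = Some y.
    case: (ltnP y (hob t v1)) => [yv|_]; last by exists 0.
    by have [x xP] := surj y ltac:(by rewrite -hob1); exists x => _; rewrite hob0 hE.
  by have [sigma sP] := choice ex; exists sigma.
have kill (i : 'I_n.+1) x : v1 < i -> x < hob t ord0 ->
    hmor t ord0 v1 x = None -> hmor t ord0 i x = None.
  move=> vi xi xN; have le0i : (ord0 : 'I_n.+1) <= i by [].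
  have h1 := nat_edge x (edge0 _ le01); have h2 := nat_edge x (edge0 _ le0i).
  case E: (hmor t ord0 i x) h2 => [y|] //= h2.
  have [_ yi] := hmor_lt E; case: (vt_active yi); rewrite -h2.
  rewrite xN /= in h1; case: (vt ord0 x) h1 => //= z h1.
  by rewrite (mor_cmp _ _ le01 (ltnW vi)) h1.
have [|t0 [t0E t0v]] := @chain_horn_outer n j t n1 sigma j0 sP _ kill.
  by move=> x x' y; rewrite hE; apply: inj.
apply: (extend t0E) => // i i' x ii' xi.
have {}edge (i0 i1 : 'I_n.+1) y (h : i0 <= i1) : horn_pred j (medge h) ->
    obind (mor t1 i0 i1) (vt i0 y) = obind (vt i1) (mor t0 i0 i1 y).
  by move=> hP; rewrite (hmor_extension t0E hP) (nat_edge _ hP).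
have cobE i0 : cob t0 i0 = hob t i0.
  pose s : horn j 0 := exist _ (mconst 0 i0 : simplex n 0) (vertex i0).
  by rewrite -[RHS](hobE t s ord0) -t0E.
case: (eqVneq i v1) => [iv|iv]; last first.
  case: (eqVneq i ord0) => [i0|i0].
    by subst i; apply: (edge _ _ _ ii'); apply: edge0.
  apply: (edge _ _ _ ii'); apply: (@edge_horn _ _ v1); rewrite ?j0 //.
  by move: ii' i0 iv; rewrite -!val_eqE /=; lia.
subst i; case: (eqVneq i' v1) => [iv|iv].
  subst i'; case E: (vt v1 x) => [y|] /=.
    by rewrite !mor_id //=; have [] := vt_lt E.
  by rewrite mor_id //= E.
have vi : v1 < i' by rewrite ltn_neqAle ii' andbT eq_sym.
have xv : x < hob t v1 by rewrite -cobE.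
(* Naturality along the edge from 1 to [i'] is tested on the preimage [sigma x], where it follows
   from the squares on the edges from 0 to 1 and from 0 to [i']. *)
have [sx sx1] := sP x xv; rewrite t0v //.
have le0i' : (ord0 : 'I_n.+1) <= i' by [].
have h1 := nat_edge (sigma x) (edge0 _ le01); rewrite sx1 /= in h1.
rewrite -(nat_edge (sigma x) (edge0 _ le0i')) -h1.
by case: (vt ord0 _) => //= z; rewrite -(mor_cmp _ _ le01 (ltnW vi)).
Qed.
End Horn.

Lemma env_inner : inner_fibration p -> inner_fibration (Env_proj p).
Proof.
move=> p_inner n j hj u v uv; apply: env_horn_inner => //.
by case/andP: hj => h1 h2; apply: leq_ltn_trans h1 h2.
Qed.

Lemma env_cocartesian (e : Env p 1) : cocartesian p (env_obj 1 e) ->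
  inert (edge_hom (p 1 (env_obj 1 e)).2) -> cocartesian (Env_proj p) e.
Proof.
move=> ec ei n u v uv ue; apply: (@env_horn_outer n.+2 ord0 u v isT uv e erefl ei) => [s sE|w wE].
  by apply: ue; rewrite sE; apply: mono_eq => -[[|r] ?]; apply: val_inj.
by apply: (ec _ (scomp env_obj u) w wE) => s sE; rewrite /= ue.
Qed.
End Env.

(** * The direct sum of a cone *)

Lemma mor_nvert k (m : nat) (r r' : 'I_k.+1) x : r <= r' -> x < m ->
  mor (degen k (nvert (C := FinPt) m)) r r' x = Some x.
Proof. by move=> rr xm; rewrite (morE _ rr) fenc_id. Qed.

Lemma mor_nedge m n (u : fhom m n) x :
  mor (nedge (C := FinPt) u) ord0 ord_max x = fenc u x.
Proof. by rewrite (morE _ (leq0n _ : ord0 <= (ord_max : 'I_2))). Qed.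

Lemma nedge_src m n (u : fhom m n) k :
  restr (mconst k ord0) (nedge (C := FinPt) u) = degen k (nvert (C := FinPt) m).
Proof.
apply: chain_ext => // r r' x rr xm; rewrite mor_nvert // (morE _ rr) /= fenc_id //.
Qed.

Lemma nedge_tgt m n (u : fhom m n) k :
  restr (mconst k ord_max) (nedge (C := FinPt) u) = degen k (nvert (C := FinPt) n).
Proof.
apply: chain_ext => // r r' x rr xm; rewrite mor_nvert // (morE _ rr) /= fenc_id //.
Qed.

Section DirectSum.
Variables (C M : sset) (p : smap M (sprod C NFin)).

(** As N(Fin) is the nerve of a category, a lift of [phi] to Env(M) amounts to a natural
    transformation into [t1], given on vertices and checked on edges. It is active because each
    [vt v] is defined on its whole source. *)
Lemma env_lift L (phi : smap L M) (t1 : smap L NFin) (vt : L 0 -> nat -> option nat) :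
  (forall (v : L 0) x, x < cob (p 0 (phi 0 v)).2 ord0 ->
     exists2 y, vt v x = Some y & y < cob (t1 0 v) ord0) ->
  (forall (e : L 1) x, x < cob (p 1 (phi 1 e)).2 ord0 ->
     obind (mor (t1 1 e) ord0 ord_max) (vt (src e) x) =
     obind (vt (tgt e)) (mor (p 1 (phi 1 e)).2 ord0 ord_max x)) ->
  exists F : smap L (Env p), forall m (x : L m), [/\ env_obj p m (F m x) = phi m x,
    ev ord_max (env_arr p m (F m x)) = t1 m x &
    forall r y, y < cob (p m (phi m x)).2 r ->
      vert (env_arr p m (F m x)) r y = vt (restr (mconst 0 r) x) y].
Proof.
move=> vt_lt vt_nat.
have cob0 m (x : L m) r : cob (p 0 (phi 0 (restr (mconst 0 r) x))).2 ord0 =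
    cob (p m (phi m x)).2 r by rewrite !app_nat.
have cob1 m (x : L m) r : cob (t1 0 (restr (mconst 0 r) x)) ord0 = cob (t1 m x) r.
  by rewrite app_nat.
have ex m (x : L m) : exists y : Env p m, [/\ env_obj p m y = phi m x,
    ev ord_max (env_arr p m y) = t1 m x &
    forall r z, z < cob (p m (phi m x)).2 r ->
      vert (env_arr p m y) r z = vt (restr (mconst 0 r) x) z].
  have [r z w zr E|r r' z rr zr|T [T0 T1 Tv]] := @arr_build m (p m (phi m x)).2 (t1 m x)
    (fun r => vt (restr (mconst 0 r) x)).
  - rewrite -cob0 in zr; have [w' E' wlt] := vt_lt _ _ zr.
    by move: E'; rewrite E -cob1 => -[->].
  - have := vt_nat (restr (medge rr) x) z; rewrite /src /tgt -!restr_comp !mcomp_const.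
    by rewrite !app_nat !mor_restr //; apply.
  have T_active : funact_pred T.
    apply/arr_active => r z; rewrite T0 => zr; rewrite Tv //.
    by rewrite -cob0 in zr; have [w -> _] := vt_lt _ _ zr.
  by have [y [y1 y2]] := env_build T0 T_active; exists y; rewrite y1 y2.
pose F m x := sval (cid (ex m x)).
have FP m (x : L m) : [/\ env_obj p m (F m x) = phi m x,
    ev ord_max (env_arr p m (F m x)) = t1 m x &
    forall r y, y < cob (p m (phi m x)).2 r ->
      vert (env_arr p m (F m x)) r y = vt (restr (mconst 0 r) x) y] := svalP (cid (ex m x)).
have F_nat l m (a : mono l m) (x : L m) : F l (restr a x) = restr a (F m x).
  have [h1 h2 h3] := FP m x; have [h1' h2' h3'] := FP l (restr a x).
  apply: env_ext; first by rewrite app_nat h1 h1' app_nat.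
  rewrite app_nat; apply: arr_ext => [e|r y].
    rewrite ev_restr (eq_ord2 e); case: ifP => _; last by rewrite h2 h2' app_nat.
    by rewrite !env_ev0 h1 h1' !app_nat.
  rewrite env_ev0 h1' => yr; rewrite h3' // -restr_comp mcomp_const vert_restr h3 //.
  by move: yr; rewrite !app_nat.
by exists {| app := F; app_nat := F_nat |}.
Qed.

Lemma env_lift_unique m (x y : Env p m) : env_obj p m x = env_obj p m y ->
  ev ord_max (env_arr p m x) = ev ord_max (env_arr p m y) ->
  (forall r z, z < cob (p m (env_obj p m x)).2 r ->
     vert (env_arr p m x) r z = vert (env_arr p m y) r z) -> x = y.
Proof.
move=> e0 e1 ve; apply: env_ext => //; apply: arr_ext => [e|r z].
  by rewrite (eq_ord2 e); case: ifP => _ //; rewrite !env_ev0 e0.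
by rewrite env_ev0; apply: ve.
Qed.

(** [env_fib_base] is the base change of [Env_proj] along the inclusion of C x {<n>} in C x
    N(Fin). *)
Lemma env_fib_inner n : inner_fibration p -> inner_fibration (env_fib_base p n).
Proof.
move=> p_inner m i hi u v uv.
pose incl := sub_incl (@env_fib_predP C M p n).
have @w : smap (simplex m) (sprod C NFin).
  refine {| app := fun l (s : simplex m l) =>
    ((v l s, degen l (nvert (C := FinPt) n)) : sprod C NFin l) |}.
  by move=> l l' a s; congr pair; apply: app_nat.
have [|h [h1 h2]] := env_inner p_inner hi (u := scomp incl u) (v := w).
  move=> l s; rewrite [LHS]surjective_pairing; congr pair; first exact: uv.
  exact: (svalP (u l s)).
have hP l (s : simplex m l) : env_fib_pred n (h l s) by rewrite /env_fib_pred h2.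
unshelve eexists {| app := fun l (s : simplex m l) => exist _ (h l s) (hP l s) : Env_fib p n l |}.
  by move=> l l' a s; apply: sub_eq; apply: (app_nat h a s).
split=> l s; first by apply: sub_eq; apply: (h1 l s).
exact: (congr1 fst (h2 l s)).
Qed.

Definition Mact_pow_projm n (i : 'I_n) : smap (Mact_pow p n) (Mact p) :=
  {| app := fun l (x : Mact_pow p n l) => Mact_pow_proj i x; app_nat := fun l m a x => erefl |}.

(** Inverses and homotopies can be chosen in each component, so a tuple of equivalences is an
    equivalence in the power of Fun_C(K, M_act). The map [tup] carries it to the fibre product, all
    components having the same projection [k]. *)
Lemma nat_equiv_over_tuple K (k : smap K C) n (a b : smap K (Mact_pow p n)) :
  lies_over (Mact_pow_base p n) k a -> lies_over (Mact_pow_base p n) k b ->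
  (forall i, nat_equiv_over (Mact_base p) k
     (scomp (Mact_pow_projm i) a) (scomp (Mact_pow_projm i) b)) ->
  nat_equiv_over (Mact_pow_base p n) k a b.
Proof.
move=> ak bk ab.
pose Z := sfun_over (Mact_base p) k.
have ex i : exists d : Z 1, [/\ is_equiv d,
    src (sval d) = fvert (scomp (Mact_pow_projm i) a) &
    tgt (sval d) = fvert (scomp (Mact_pow_projm i) b)].
  by have /nat_equiv_overE := ab i.
have {ex ab} [d dP] := choice ex.
have d_equiv : @is_equiv (power 'I_n Z) d.
  apply/is_equivE.
  have ex i : exists z : Z 1 * Z 2 * Z 2,
      tri (d i) z.1.1 (degen 1 (src (d i))) z.1.2 /\
      tri z.1.1 (d i) (degen 1 (tgt (d i))) z.2.
    by have [/is_equivE [e' [s [s' h]]] _ _] := dP i; exists (e', s, s').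
  have [z zP] := choice ex.
  exists (fun i => (z i).1.1), (fun i => (z i).1.2), (fun i => (z i).2).
  by split; split; apply: funext => i; case: (zP i) => -[h1 h2 h3] [h1' h2' h3'].
have @tup : smap (power 'I_n Z) (sfun_over (Mact_pow_base p n) k).
  unshelve refine {| app := fun l (h : power 'I_n Z l) =>
    exist _ {| app := fun m (x : sprod K (simplex l) m) =>
      (exist _ (fun i => sval (h i) m x, k m x.1)
        (funext (fun i => svalP (h i) m x)) : Mact_pow p n m) |} _
    : sfun_over (Mact_pow_base p n) k l |}.
  - move=> m m' c x; apply: eq_exist; congr pair; last by rewrite app_nat.
    by apply: funext => i; rewrite app_nat.
  - by [].
  - by move=> l m c h; apply: sfun_over_eq; apply: smap_eq => m' x; apply: eq_exist.
have eta (c : smap K (Mact_pow p n)) (h : sfun_over (Mact_pow_base p n) k 0) :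
    lies_over (Mact_pow_base p n) k c ->
    (forall i m x, (sval (sval h m x)).1 i = fvert (scomp (Mact_pow_projm i) c) m x) ->
    sval h = fvert c.
  move=> ck hc; apply: smap_eq => m x; apply: sub_eq.
  rewrite [LHS]surjective_pairing [RHS]surjective_pairing; congr pair.
    by apply: funext => i; apply: hc.
  by rewrite -[LHS]/(Mact_pow_base p n m (sval h m x)) (svalP h) /= -ck.
apply/nat_equiv_overE; exists (tup 1 d); split; first exact: smap_equiv.
- apply: (eta _ (src (tup 1 d)) ak) => i m x; have [_ <- _] := dP i.
  by [].
- apply: (eta _ (tgt (tup 1 d)) bk) => i m x; have [_ _ <-] := dP i.
  by [].
Qed.

(** * The lift of a cone of inert transformations to the envelope *)

Section Cone.
Variables (K : sset) (k : smap K C) (n : nat) (hn : 1 <= n).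
Variables (f : smap K (Mact p)) (g : 'I_n -> smap K (Mact p)).
Variable alpha : 'I_n -> smap (sprod K (simplex 1)) M.
Hypothesis hf : lies_over (Mact_base p) k f.
Hypothesis alpha_over : forall i,
  lies_over (scomp (sfst C NFin) p) (scomp k (sfst K (simplex 1))) (alpha i).
Hypothesis alpha_ends : forall i,
  restricts_to (alpha i) (scomp (sub_incl (act_predP (p := p))) f)
                         (scomp (sub_incl (act_predP (p := p))) (g i)).
Hypothesis alpha_inert : forall i (v : K 0), inert_edge p (component (alpha i) v).
Hypothesis alpha_bij : forall v : K 0,
  exists (m : nat) (m_ : 'I_n -> nat) (u : forall i, fhom m (m_ i)),
    (forall i, (p 1 (component (alpha i) v)).2 = nedge (C := FinPt) (u i)) /\
    induces_bijection u.

Let um i (v : K 0) : nat -> option nat :=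
  mor (p 1 (component (alpha i) v)).2 ord0 ord_max.

(* The active map <m(v)> -> <n> sending the summand <m_i(v)>^o of <m(v)>^o to i. *)
Let block (v : K 0) (x : nat) : option nat :=
  omap val [pick i : 'I_n | um i v x != None].

Let act_incl := sub_incl (act_predP (p := p)).

Let um_src i v : cob (p 1 (component (alpha i) v)).2 ord0 = cob (p 0 (sval (f 0 v))).2 ord0.
Proof.
transitivity (cob (restr (mconst 0 ord0) (p 1 (component (alpha i) v))).2 ord0) => //.
rewrite -app_nat -app_nat; congr (cob (p 0 _).2 _).
rewrite -[sval _]/(scomp act_incl f 0 v) -(alpha_ends i v).1.
by congr (alpha i 0 (_, _)); rewrite restr_degen degen0.
Qed.

(** If [u i] sends [x] to [y], then the element that the bijection attaches to [(i, y)] is also sent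
    to [y], so it is [x], because an inert map is injective on what it does not kill. Hence [x] lies
    in one summand only. *)
Let blockP (v : K 0) x : x < cob (p 0 (sval (f 0 v))).2 ord0 ->
  exists i : 'I_n, block v x = Some (val i) /\ forall i', um i' v x <> None <-> i' = i.
Proof.
have [m [m_ [u [uE [b [[c bc cb] bu]]]]]] := alpha_bij v.
have umE i : um i v = fenc (u i) by apply: funext => y; rewrite /um uE mor_nedge.
(* As [n >= 1] there is an index, and its map shows that [m] is the arity of [f(v)]. *)
rewrite -(um_src (Ordinal hn)) uE => xm; have {}xm : x < m := xm.
pose s := c (Ordinal xm).
have bs : b s = Ordinal xm by apply: cb.
have us : um (tag s) v x = Some (val (tagged s)).
  by rewrite umE -[x]/(val (Ordinal xm)) -bs fencE bu.
have uniq_s i : um i v x <> None -> i = tag s.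
  rewrite umE; case E: (fenc (u i) x) => [y|] // _.
  have [_ yi] := fenc_lt E; pose s' := existT (fun i => 'I_(m_ i)) i (Ordinal yi).
  have [_ _] := alpha_inert i v; rewrite uE => /inert_enc [_ inj].
  have E' : fenc (u i) (b s') = Some y by rewrite fencE (bu s').
  have ss : s' = s by apply: (can_inj bc); rewrite bs; apply: val_inj; apply: inj E' E.
  by rewrite -ss.
exists (tag s); split=> [|i]; last by split=> [/uniq_s//|->]; rewrite us.
rewrite /block; case: pickP => [i /eqP /uniq_s -> //|/(_ (tag s))].
by rewrite us.
Qed.

Let arrow (i : 'I_n) m (x : K m) : FunArr m.
Proof.
refine {| app := fun l (z : sprod (simplex 1) (simplex m) l) =>
  (p l (alpha i l (restr z.2 x, z.1))).2 |}.
move=> l l' a z; rewrite restr_comp.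
by rewrite -[(_, _)]/(@restr (sprod K (simplex 1)) _ _ a (restr z.2 x, z.1)) !app_nat.
Defined.

Let arrow0 i m (x : K m) : ev ord0 (arrow i x) = (p m (sval (f m x))).2.
Proof.
by rewrite /ev /= restr_id (alpha_ends i x).1.
Qed.

Let arrow1 i m (x : K m) : ev ord_max (arrow i x) = (p m (sval (g i m x))).2.
Proof.
by rewrite /ev /= restr_id (alpha_ends i x).2.
Qed.

Let vert_arrow i m (x : K m) r : vert (arrow i x) r = um i (restr (mconst 0 r) x).
Proof.
by rewrite /vert /um /= /component /degen -restr_comp mcomp_const.
Qed.

Let act_some m (y : Mact p m) (r r' : 'I_m.+1) z : r <= r' ->
  z < cob (p m (sval y)).2 r -> exists z', mor (p m (sval y)).2 r r' z = Some z'.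
Proof.
move=> rr zr; rewrite (morE _ rr); case E: (fenc _ z) => [z'|]; first by exists z'.
by have := (activeE _).1 (svalP y r r' rr) z zr.
Qed.

(** If [alpha i] does not kill [z], its naturality and the activity of the maps in [g i] show that
    it does not kill the image of [z] either, so [z] and its image lie in the same block. *)
Let block_nat m (x : K m) (r r' : 'I_m.+1) z : r <= r' ->
  z < cob (p m (sval (f m x))).2 r ->
  obind (block (restr (mconst 0 r') x)) (mor (p m (sval (f m x))).2 r r' z) =
  block (restr (mconst 0 r) x) z.
Proof.
move=> rr zr; have [z' zz] := act_some rr zr; rewrite zz /=.
have vtx s : restr (mconst 0 s) (p m (sval (f m x))) = p 0 (sval (f 0 (restr (mconst 0 s) x))).
  by rewrite app_nat /= app_nat.
have [|i [bi iP]] := @blockP (restr (mconst 0 r) x) z.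
  by rewrite -vtx.
have [|i' [bi' iP']] := @blockP (restr (mconst 0 r') x) z'.
  by rewrite -vtx; have [] := mor_lt zz.
rewrite bi bi'; congr (Some (val _)); symmetry; apply/(iP' i).
have := vert_nat (arrow i x) z rr; rewrite !vert_arrow arrow0 arrow1 zz /= => <-.
have /(iP i) : i = i by []. case E: (um i _ z) => [w|] // _ /=.
have [_] := @vert_lt _ (arrow i x) r z w ltac:(by rewrite vert_arrow).
by rewrite arrow1 => /(act_some rr) [w' ->].
Qed.

Let cob_vtx m (x : K m) r :
  cob (p 0 (sval (f 0 (restr (mconst 0 r) x)))).2 ord0 = cob (p m (sval (f m x))).2 r.
Proof. by rewrite -[sval _]/(scomp act_incl f 0 (restr (mconst 0 r) x)) !app_nat. Qed.

Let const_n : smap K NFin.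
Proof.
by refine {| app := fun m (x : K m) => (degen m (nvert (C := FinPt) n) : NFin m) |}.
Defined.

Lemma cone_lift : exists F : smap K (Env p), forall m (x : K m),
  [/\ env_obj p m (F m x) = sval (f m x),
    ev ord_max (env_arr p m (F m x)) = degen m (nvert (C := FinPt) n) &
    forall r y, y < cob (p m (sval (f m x))).2 r ->
      vert (env_arr p m (F m x)) r y = block (restr (mconst 0 r) x) y].
Proof.
apply: (@env_lift K (scomp act_incl f) const_n block) => [v x xv|e x xe].
  by have [i [-> _]] := blockP xv; exists (val i) => //; apply: ltn_ord.
have := @block_nat 1 e ord0 ord_max x isT xe; rewrite -/(src e) -/(tgt e) => ->.
have xs : x < cob (p 0 (sval (f 0 (src e)))).2 ord0 by rewrite cob_vtx.
by have [i [-> _]] := blockP xs; rewrite /= mor_nvert.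
Qed.

Let edge_n (i : 'I_n) : smap (sprod K (simplex 1)) NFin :=
  scomp (yoneda (nedge (C := FinPt) (rho i))) (ssnd K (simplex 1)).

(** At the end 0 this is the structure map of F; at the end 1 it is the active map to <1>, whose
    only element other than the base point is encoded by 0. *)
Let edge_vt (v : sprod K (simplex 1) 0) : nat -> option nat :=
  if v.2 ord0 == ord0 then block v.1 else fun=> Some 0.

Let ends0 i (m : nat) (x : K m) : alpha i m (x, mconst m ord0) = sval (f m x).
Proof. exact: (alpha_ends i x).1. Qed.

Let ends1 i (m : nat) (x : K m) : alpha i m (x, mconst m ord_max) = sval (g i m x).
Proof. exact: (alpha_ends i x).2. Qed.

(** On an edge from [f] to [g i], naturality says that [rho i] after [block] kills the same elements
    as [alpha i], namely those of the blocks other than [i]. On edges inside one end it is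
    [block_nat] or holds because the maps in [g i] are active. *)
Lemma cone_edge_lift (i : 'I_n) : exists A : smap (sprod K (simplex 1)) (Env p),
  forall m (x : sprod K (simplex 1) m),
  [/\ env_obj p m (A m x) = alpha i m x,
    ev ord_max (env_arr p m (A m x)) = restr x.2 (nedge (C := FinPt) (rho i)) &
    forall r y, y < cob (p m (alpha i m x)).2 r ->
      vert (env_arr p m (A m x)) r y =
      if x.2 r == ord0 then block (restr (mconst 0 r) x.1) y else Some 0].
Proof.
have [v x xv|e x xe|A AP] := @env_lift _ (alpha i) (edge_n i) edge_vt.
- case: v xv => v s; have -> : s = mconst 0 (s ord0).
    by apply: mono_eq => r; rewrite (ord1 r).
  rewrite (eq_ord2 (s ord0)) /edge_vt /=; case: ifP => _ /=; last first.
    by exists 0.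
  by rewrite ends0 => xv; have [i' [-> _]] := blockP xv; exists (val i') => //; apply: ltn_ord.
- case: e xe => e s.
  have sE : s = Mono (edge_funP (mfunP s (leq0n _ : ord0 <= (ord_max : 'I_2)))).
    by apply: mono_eq => -[[|[|r]] r2] //=; congr (s _); apply: val_inj.
  pose es : sprod K (simplex 1) 1 := (e, s).
  rewrite -/es; have -> : edge_n i 1 es = restr s (nedge (C := FinPt) (rho i)) by [].
  have -> : edge_vt (src es) = if s ord0 == ord0 then block (src e) else fun=> Some 0 by [].
  have -> : edge_vt (tgt es) = if s ord_max == ord0 then block (tgt e) else fun=> Some 0.
    by [].
  rewrite {}/es; case: (eqVneq (s ord_max) ord0) => [s1|s1].
    have s0 : s ord0 = ord0.
      apply: val_inj; apply/eqP; rewrite -leqn0.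
      by have := mfunP s (leq0n _ : ord0 <= (ord_max : 'I_2)); rewrite s1.
    have {}sE : s = mconst 1 ord0.
      by rewrite sE; apply: mono_eq => -[[|[|r]] r2] //=.
    rewrite s0 sE eqxx ends0 nedge_src => xe.
    have := @block_nat 1 e ord0 ord_max x isT xe; rewrite -/(src e) -/(tgt e) => ->.
    have xs : x < cob (p 0 (sval (f 0 (src e)))).2 ord0 by rewrite cob_vtx.
    by have [i' [-> _]] := blockP xs; rewrite /= mor_nvert.
  have {}s1 : s ord_max = ord_max by rewrite (eq_ord2 (s ord_max)) (negPf s1).
  case: (eqVneq (s ord0) ord0) => [s0|s0]; last first.
    have {}s0 : s ord0 = ord_max by rewrite (eq_ord2 (s ord0)) (negPf s0).
    have {}sE : s = mconst 1 ord_max.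
      by rewrite sE; apply: mono_eq => -[[|[|r]] r2] //=.
    rewrite sE ends1 nedge_tgt => xe; rewrite /= mor_nvert //.
    by have [z ->] := act_some (isT : (ord0 : 'I_2) <= (ord_max : 'I_2)) xe.
  have {}sE : s = mid 1.
    by rewrite sE; apply: mono_eq => -[[|[|r]] r2] //=; rewrite ?s0 ?s1; apply: val_inj.
  rewrite sE => xe.
  have xs : x < cob (p 0 (sval (f 0 (src e)))).2 ord0.
    rewrite -(ends0 i); move: xe.
    rewrite -[cob _ _]/(cob (restr (mconst 0 ord0) (p 1 (alpha i 1 (e, mid 1)))).2 ord0).
    by rewrite -!app_nat.
  have [i' [bi iP]] := blockP xs; rewrite bi restr_id /= mor_nedge fencE /=.
  have -> : mor (p 1 (alpha i 1 (e, mid 1))).2 ord0 ord_max x =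
      obind (mor (p 1 (sval (g i 1 e))).2 ord0 ord_max) (um i (src e) x).
    transitivity (mor (arrow i e 1 (mid 1, mid 1)) ord0 ord_max x).
      by rewrite /= restr_id.
    rewrite (@arr_mor_up 1 (arrow i e) 1 (mid 1) (mid 1) ord0 ord_max x isT erefl erefl).
    by rewrite arrow1 vert_arrow.
  case E: (um i (src e) x) => [w|] /=.
    have ii : i' = i by symmetry; apply/(iP i); rewrite E.
    have [_] := @vert_lt _ (arrow i e) ord0 x w ltac:(by rewrite vert_arrow).
    by rewrite arrow1 => /(act_some (isT : (ord0 : 'I_2) <= (ord_max : 'I_2))) [z ->];
       rewrite ii eqxx.
  case: eqP => // -[ii]; have /(iP i) : i = i' by [].
  by rewrite E.
exists A => m x; have [h1 h2 h3] := AP m x; split=> // r y yr; rewrite h3 //.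
by rewrite /edge_vt /=; case: ifP.
Qed.

Hypothesis hg : forall i, lies_over (Mact_base p) k (g i).

Let over_k i m (x : sprod K (simplex 1) m) : (p m (alpha i m x)).1 = k m x.1.
Proof. exact: (alpha_over i x). Qed.

(** The transformations [e], obtained from [H] by composing with [F], and [A'], the lift of
    [alpha i], are cocartesian in Fun(K, Env(M)) with equal sources and projections. Their targets
    are thus equivalent in a fibre, which maps to Fun_C(K, M_act) by forgetting the arrows. *)
Lemma pushforward_cone (F : smap K (Env_fib p n)) (i : 'I_n) R :
  inner_fibration p -> lies_over (env_fib_base p n) k F -> is_pushforward i R ->
  (forall m (x : K m), env_obj p m (sval (F m x)) = sval (f m x)) ->
  (forall m (x : K m) r y, y < cob (p m (sval (f m x))).2 r ->
      vert (env_arr p m (sval (F m x))) r y = block (restr (mconst 0 r) x) y) ->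
  nat_equiv_over (Mact_base p) k (scomp (Env_forget p 1) (scomp R F)) (g i).
Proof.
move=> p_inner F_over [H [H_ends H_proj H_coc]] F_obj F_vert.
have [A AP] := cone_edge_lift i.
pose incl m := sub_incl (@env_fib_predP C M p m).
pose e : sfun K (Env p) 1 := scomp H (sprod_map F (sid (simplex 1))).
pose A' : sfun K (Env p) 1 := A.
pose Q := sfun_post K (Env_proj p).
have q_inner := env_inner p_inner.
have e_coc : cocartesian Q e.
  apply: sfun_cocartesian => // v.
  have -> : component e v = component H (F 0 v) by rewrite /component /= app_degen.
  exact: H_coc.
have A_coc : cocartesian Q A'.
  apply: sfun_cocartesian => // v.
  have [obj _ _] := AP 1 (degen 1 v, mid 1); have [c1 _ c2] := alpha_inert i v.
  by apply: env_cocartesian; rewrite -[component A' v]/(A 1 (degen 1 v, mid 1)) obj.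
have [es et] : src e = fvert (scomp (incl n) F) /\ tgt e = fvert (scomp (incl 1) (scomp R F)).
  by apply/restricts_toE => m x; apply: (H_ends m (F m x)).
have As : src A' = fvert (scomp (incl n) F).
  apply: smap_eq => m [x b].
  have -> : src A' m (x, b) = A m (x, mconst m ord0) by congr (A m (_, _)); apply: mono_eq.
  have [obj ev1 ve] := AP m (x, mconst m ord0); apply: env_lift_unique.
  - by rewrite obj ends0; apply: esym (F_obj m x).
  - by rewrite ev1 nedge_src; apply: esym (svalP (F m x)).
  - rewrite obj => r z zr; rewrite ve //= F_vert //.
    by rewrite -(ends0 i).
have QQ : Q 1 e = Q 1 A'.
  apply: smap_eq => m [x b]; have [obj ev1 _] := AP m (x, b).
  rewrite -[LHS]/(Env_proj p m (H m (F m x, b))) H_proj F_over.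
  by rewrite -[RHS]/(Env_proj p m (A m (x, b))) env_projE obj ev1 over_k.
have [d [d_eq ds dt]] := cocartesian_unique e_coc A_coc (etrans es (esym As)) QQ.
pose Z := fibre Q (tgt (Q 1 e)).
(* The fibre lies over the constant simplex at [k] paired with <1>, so its cells take their values
   in [Env_fib p 1]. *)
have Z_proj m (h : Z m) l z : Env_proj p l (sval h l z) =
    (k l z.1, degen l (nvert (C := FinPt) 1)).
  have -> : Env_proj p l (sval h l z) = Q m (sval h) l z by [].
  rewrite (svalP h) /degen /tgt -restr_comp mcomp_const.
  have -> : restr (mconst m ord_max) (Q 1 e) l z =
      Env_proj p l (H l (F l z.1, mconst l ord_max)) by congr (Env_proj p l (H l (_, _))); apply: mono_eq.
  by rewrite H_proj F_over nedge_tgt.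
have Z_fib m (h : Z m) l z : env_fib_pred 1 (sval h l z) by rewrite /env_fib_pred Z_proj.
have @phi : smap Z (sfun_over (Mact_base p) k).
  unshelve refine {| app := fun m (h : Z m) => exist _
    {| app := fun l z => Env_forget p 1 l (exist _ (sval h l z) (Z_fib m h l z)) |} _
      : sfun_over (Mact_base p) k m |}.
  - by move=> l l' a z; apply: sub_eq => /=; rewrite app_nat.
  - by move=> l z; have := congr1 fst (Z_proj m h l z).
  - by move=> m m' a h; apply: sfun_over_eq; apply: smap_eq => l z; apply: sub_eq.
apply/nat_equiv_overE; exists (phi 1 d); split; first exact: smap_equiv.
  apply: smap_eq => l [x b]; apply: sub_eq.
  have := congr1 (fun w : sfun K (Env p) 0 => env_obj p l (w l (x, b))) (etrans ds et).
  by [].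
apply: smap_eq => l [x b]; apply: sub_eq.
have := congr1 (fun w : sfun K (Env p) 0 => env_obj p l (w l (x, b))) dt.
have -> : (tgt A' : sfun K (Env p) 0) l (x, b) = A l (x, mconst l ord_max).
  by congr (A l (_, _)); apply: mono_eq.
have [-> _ _] := AP l (x, mconst l ord_max); rewrite ends1.
by [].
Qed.

Lemma direct_sum_cone (S : smap (Mact_pow p n) (Mact p)) :
  inner_fibration p -> is_direct_sum S ->
  nat_equiv_over (Mact_base p) k f (scomp S (Mact_pow_tuple hg)).
Proof.
move=> p_inner [R [T [inv [R_push [T_over T_proj] inv_over [invT _] ->]]]].
have [F FP] := cone_lift.
have F_fib m x : env_fib_pred n (F m x) by case: (FP m x).
have @F' : smap K (Env_fib p n).
  refine {| app := fun m x => exist _ (F m x) (F_fib m x) : Env_fib p n m |}.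
  by move=> l m a x; apply: sub_eq; apply: (app_nat F a x).
have F_obj m x : env_obj p m (sval (F' m x)) = sval (f m x) by case: (FP m x).
have F_over : lies_over (env_fib_base p n) k F'.
  move=> m x; rewrite -hf -[LHS]/(p m (env_obj p m (sval (F' m x)))).1 F_obj.
  by [].
have F_forget : scomp (Env_forget p n) F' = f.
  by apply: smap_eq => m x; apply: sub_eq; apply: F_obj.
have fib_inner := env_fib_inner (n := n) p_inner.
have TF : nat_equiv_over (Mact_pow_base p n) k (scomp T F') (Mact_pow_tuple hg).
  apply: nat_equiv_over_tuple => [m x||i].
  - by rewrite -F_over -T_over.
  - by [].
  have -> : scomp (Mact_pow_projm i) (scomp T F') = scomp (Env_forget p 1) (scomp (R i) F').
    by apply: smap_eq => m x; apply: T_proj.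
  have -> : scomp (Mact_pow_projm i) (Mact_pow_tuple hg) = g i by apply: smap_eq.
  by apply: pushforward_cone => // m x; case: (FP m x).
have e1 : nat_equiv_over (env_fib_base p n) k (scomp (scomp inv T) F') F'.
  have -> : F' = scomp (sid (Env_fib p n)) F' by apply: smap_eq.
  exact: nat_equiv_over_pre F_over invT.
have e2 := nat_equiv_over_post inv_over TF.
(* By [e1] and [e2], [F'] is equivalent to [inv T F'] and this to [inv] of the tuple of the [g i];
   [Env_forget] turns the two ends into the two sides of the claim. *)
rewrite -[X in nat_equiv_over _ _ X]F_forget.
have -> : scomp (scomp (Env_forget p n) inv) (Mact_pow_tuple hg) =
    scomp (Env_forget p n) (scomp inv (Mact_pow_tuple hg)) by apply: smap_eq.
apply: (nat_equiv_over_post (pi := env_fib_base p n)) => //.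
apply: nat_equiv_over_trans fib_inner (nat_equiv_over_sym e1) _.
have -> : scomp (scomp inv T) F' = scomp inv (scomp T F') by apply: smap_eq.
exact: e2.
Qed.
End Cone.
End DirectSum.

Theorem corollary4p5 (C M K : sset) (p : smap M (sprod C NFin))
    (hC : quasicategory C) (hp : operad_family p)
    (k : smap K C) (n : nat) (hn : 1 <= n)
    (f : smap K (Mact p)) (g : 'I_n -> smap K (Mact p))
    (hf : lies_over (Mact_base p) k f) (hg : forall i, lies_over (Mact_base p) k (g i))
    (alpha : 'I_n -> smap (sprod K (simplex 1)) M)
    (alpha_over : forall i,
      lies_over (scomp (sfst C NFin) p) (scomp k (sfst K (simplex 1))) (alpha i))
    (alpha_ends : forall i,
      restricts_to (alpha i) (scomp (sub_incl (act_predP (p := p))) f)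
                             (scomp (sub_incl (act_predP (p := p))) (g i)))
    (alpha_inert : forall i (v : K 0), inert_edge p (component (alpha i) v))
    (alpha_limit : forall v : K 0,
      is_limit_cone p (sval (f 0 v)) (fun i => component (alpha i) v))
    (alpha_bij : forall v : K 0,
      exists (m : nat) (m_ : 'I_n -> nat) (u : forall i, fhom m (m_ i)),
        (forall i, (p 1 (component (alpha i) v)).2 = nedge (C := FinPt) (u i)) /\
        induces_bijection u) :
  forall S : smap (Mact_pow p n) (Mact p), is_direct_sum S ->
  nat_equiv_over (Mact_base p) k f (scomp S (Mact_pow_tuple hg)).
Proof.
move=> S; apply: (direct_sum_cone hn hf alpha_over alpha_ends alpha_inert alpha_bij).
exact: categorical_fibration_inner (family_fib hp).
Qed.
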